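(* Let $(X_i)_{i\in\mathbb{Z}}$ and $(Y_i)_{i\in\mathbb{Z}}$ be two strictly stationary, 2-ergodic sequences of real-valued random variables, the two sequences being independent of each other. Assume that $$\sum_{k=1}^\infty \alpha_{1,\mathbf{X}}(k)<\infty\quad\text{and}\quad \sum_{k=1}^\infty \alpha_{1,\mathbf{Y}}(k)<\infty .$$ Let $(m_n)_{n\ge 1}$ be a sequence of positive integers such that $\lim_{n\to\infty} n/m_n=c$ for some $c\in[0,\infty)$. Then the random variables $\sqrt{n}\,(U_n-\pi)$ converge in distribution, as $n\to\infty$, to $\mathcal{N}(0,V)$, where $$V=\mathrm{Var}(H_Y(X_0))+2\sum_{k=1}^\infty \mathrm{Cov}(H_Y(X_0),H_Y(X_k))+c\left(\mathrm{Var}(G_X(Y_0))+2\sum_{k=1}^\infty \mathrm{Cov}(G_X(Y_0),G_X(Y_k))\right).$$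
   Context: Notation. With $m=m_n$, the Mann-Whitney U-statistic is $U_n=\frac{1}{nm}\sum_{i=1}^n\sum_{j=1}^m \mathbf{1}_{X_i<Y_j}$. Moreover $\pi=\mathbb{P}(X_1<Y_1)$, $H_Y(t)=\mathbb{P}(Y_1>t)$ and $G_X(t)=\mathbb{P}(X_1<t)$ for $t\in\mathbb{R}$. Dependence coefficients. For a strictly stationary sequence $(X_i)_{i\in\mathbb{Z}}$ of real-valued random variables, let $\mathcal{F}_0=\sigma(X_k,k\le 0)$ and let $F$ be the distribution function of $X_0$. For any non-negative integer $n$, $$\alpha_{1,\mathbf{X}}(n)=\sup_{x\in\mathbb{R}}\left\|\mathbb{E}(\mathbf{1}_{X_n\le x}\mid\mathcal{F}_0)-F(x)\right\|_1 ,$$ where $\|\cdot\|_1$ is the $\mathbb{L}^1$ norm; $\alpha_{1,\mathbf{Y}}$ is defined in the same way from $(Y_i)_{i\in\mathbb{Z}}$. 2-ergodicity. A strictly stationary sequence $(X_i)_{i\in\mathbb{Z}}$ is 2-ergodic if, for any bounded measurable function $f:\mathbb{R}^2\to\mathbb{R}$ and any non-negative integer $k$, $\lim_{n\to\infty}\frac1n\sum_{i=1}^n f(X_i,X_{i+k})=\mathbb{E}(f(X_0,X_k))$ almost surely. $\mathcal{N}(0,V)$ is the normal distribution with mean $0$ and variance $V$ (the Dirac mass at $0$ if $V=0$). *)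

(* Defs.v *)
From HB Require Import structures.
From mathcomp Require Import all_boot all_order all_algebra.
From mathcomp Require Import all_classical all_reals all_analysis.
From mathcomp Require Import measurable_realfun.

Set Implicit Arguments.
Unset Strict Implicit.
Unset Printing Implicit Defensive.
Import Order.TTheory GRing.Theory Num.Theory.
Import numFieldNormedType.Exports.
Local Open Scope classical_set_scope.
Local Open Scope ring_scope.

Section cond_exp.
Context d (T : measurableType d) (R : realType) (P : probability T R).
Implicit Types (G : set (set T)) (f g : T -> R).

(* Kolmogorov's definition: [g] is a version of the conditional expectation of
   [f] given the sub-sigma-algebra [G]. *)
Definition is_cond_exp G f g : Prop :=
  [/\ preimage_set_system setT g measurable `<=` G,
      P.-integrable setT (EFin \o g) &
      forall A, G A -> (\int[P]_(x in A) (g x)%:E = \int[P]_(x in A) (f x)%:E)%E].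

Definition cond_exp G f : T -> R := xget (cst 0) (is_cond_exp G f).

(* A version always exists, so that the default value in [cond_exp] is not
   reached. *)
Lemma cond_expP G f :
  sigma_algebra setT G -> G `<=` measurable ->
  P.-integrable setT (EFin \o f) -> is_cond_exp G f (cond_exp G f).
Proof.
move=> sG GM intf; rewrite /cond_exp; apply: (xgetPex (cst 0)).
pose TG := g_sigma_algebraType G.
have mG : (measurable : set (set TG)) = G by exact: sigma_algebra_id.
have mid : measurable_fun setT (idfun : T -> TG).
  by move=> _ A mA; rewrite setTI; apply: GM; rewrite -mG.
pose phi : {mfun T >-> TG} := HB.pack (idfun : T -> TG)
  (isMeasurableFun.Build _ _ _ _ (idfun : T -> TG) mid).
pose Q : probability TG R := distribution P phi.
pose nu : {charge set TG -> \bar R} :=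
  measure_function_pushforward__canonical__charge_Charge
    (induced_charge intf) mid.
have nuQ : nu `<< Q.
  apply: (@dominates_pushforward _ _ _ _ _ P (induced_charge intf) _ mid).
  apply/null_content_dominatesP => A mA PA0; apply: null_set_integral => //.
  by apply: (measurable_funS measurableT) => //; exact: measurable_int intf.
have [h [hfin hint hE]] : exists h : TG -> \bar R,
    [/\ (forall x, h x \is a fin_num), Q.-integrable setT h &
      forall A, measurable A -> nu A = (\int[Q]_(x in A) h x)%E].
  exists (Radon_Nikodym nu Q); split.
  - by move=> x; exact: Radon_Nikodym_fin_num.
  - exact: Radon_Nikodym_integrable.
  - by move=> A mA; exact: Radon_Nikodym_integral.
have mh : measurable_fun [set: TG] h by exact: measurable_int hint.
have hfine : EFin \o (fine \o h) = h by apply/funext => x /=; rewrite fineK.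
have hP : P.-integrable setT h.
  apply/integrableP; split; first exact: (measurableT_comp mh mid).
  have /integrableP[_] := hint.
  rewrite ge0_integral_pushforward ?preimage_setT//.
  exact: measurableT_comp.
exists (fine \o h); split.
- move=> _ [B mB <-]; rewrite -mG.
  by apply: (measurableT_comp _ mh) => //; exact: measurable_fine.
- by rewrite hfine.
- move=> A GA; have mA : measurable (A : set TG) by rewrite mG.
  transitivity (\int[Q]_(x in A) h x)%E; last by rewrite -hE.
  rewrite (@integral_pushforward _ _ T TG _ _ mid P A h mh _ mA) ?preimage_id//.
    by apply: eq_integral => x _ /=; rewrite fineK.
  exact: (integrableS measurableT (GM _ GA) (@subsetT _ _) hP).
Qed.

End cond_exp.

Section processes.
Context d (T : measurableType d) (R : realType) (P : probability T R).
Local Notation process := (int -> {RV P >-> R}).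
Implicit Types X Y : process.

Definition strictly_stationary X : Prop :=
  forall (n : nat) (t : n.-tuple int) (h : int) (A : set (n.-tuple R)),
    measurable A ->
    P [set w | A [tuple X (tnth t i) w | i < n]] =
    P [set w | A [tuple X (tnth t i + h) w | i < n]].

Definition sigma_process X (I : set int) : set (set T) :=
  <<s \bigcup_(i in I) preimage_set_system setT (X i) measurable >>.

Lemma sigma_processP X I :
  sigma_algebra setT (sigma_process X I) /\ sigma_process X I `<=` measurable.
Proof.
split; first exact: smallest_sigma_algebra.
apply: smallest_sub; first exact: sigma_algebra_measurable.
by move=> _ [i _ [B mB <-]]; exact: measurable_funPT.
Qed.

Definition independent_processes X Y : Prop :=
  forall A B, sigma_process X setT A -> sigma_process Y setT B ->
    P (A `&` B) = (P A * P B)%E.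

Definition two_ergodic X : Prop :=
  forall (f : R * R -> R) (k : nat),
    measurable_fun setT f -> (exists M : R, forall z, `|f z| <= M) ->
    {ae P, forall w,
      (fun n : nat => n%:R^-1 * \sum_(1 <= i < n.+1) f (X i w, X (i + k)%N w))
        @ \oo --> fine 'E_P[(fun w' => f (X 0 w', X k w'))]}.

Definition past X : set (set T) := sigma_process X [set k | k <= 0].

Definition alpha1 X (n : nat) : \bar R :=
  ereal_sup [set ('N[P]_1[(fun w =>
      (cond_exp P (past X) \1_[set w' | (X n w' <= x)%R] w
       - fine (cdf (X 0%R) x))%:E)])%E | x in [set: R]].

Definition mann_whitney X Y (n m : nat) (w : T) : R :=
  (n%:R * m%:R)^-1 *
  \sum_(1 <= i < n.+1) \sum_(1 <= j < m.+1) \1_[set w' | X i w' < Y j w'] w.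

Definition prob_lt X Y : R := fine (P [set w | X 1 w < Y 1 w]).
Definition H_ Y (t : R) : R := fine (P [set w | t < Y 1 w]).
Definition G_ X (t : R) : R := fine (P [set w | X 1 w < t]).

Definition cov_sum (g : R -> R) X (n : nat) : R :=
  \sum_(1 <= k < n.+1) fine (covariance P (g \o X 0) (g \o X k)).

Definition long_run_variance (g : R -> R) X : R :=
  fine 'V_P[g \o X 0] + 2 * limn (cov_sum g X).

Definition mann_whitney_variance X Y (c : R) : R :=
  long_run_variance (H_ Y) X + c * long_run_variance (G_ X) Y.

Definition cvg_in_distribution (Z : nat -> T -> R)
    (mu : probability (measurableTypeR R) R) : Prop :=
  (forall n, measurable_fun setT (Z n)) /\
  forall f : R -> R, continuous f -> (exists M : R, forall x, `|f x| <= M) ->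
    'E_P[f \o Z n]%E @[n --> \oo] --> (\int[mu]_x (f x)%:E)%E.

End processes.

(* The second parameter of [normal_prob] is the standard deviation, and
   [normal_prob 0 0] is not the Dirac mass at [0]. *)
Definition centered_normal (R : realType) (V : R) :
    probability (measurableTypeR R) R :=
  if V == 0 then (\d_(0 : measurableTypeR R) : probability _ R)
  else (normal_prob 0 (Num.sqrt V) : probability _ R).

(* Main.v *)
(* Hoeffding's decomposition writes sqrt n (U_n - pi) as the sum of a
   normalized partial sum of H_Y(X_i) - pi, one of G_X(Y_j) - pi, and a
   degenerate remainder.

   For a bounded centred function f of one process, with S_k the partial sums,
   E cos(s S_n + b) is compared with exp(-s^2 n V / 2) cos b by a telescoping
   argument: S_(k+1) is expanded around S_(k-L).  The first order term is
   E f(X_k) sin(s S_(k-L) + b), which telescopes over the past into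
   correlations at lags larger than L and is controlled by the tail of the
   dependence coefficients.  In the second order term the products
   f(X_(k-l)) f(X_k) are averaged over blocks on which cos(s S_(k-L) + b) is
   almost constant, and 2-ergodicity replaces them by their means.

   The covariances of the remainder kernel are bounded by the coefficients of X
   at the lag of the X-indices and by those of Y at the lag of the Y-indices;
   using the first bound at large lags and the second one at small lags, the
   remainder tends to 0 in L^2.

   By independence the cosine transforms multiply, which gives the limit of
   E cos(t Z_n + b).  That the limit variance is nonnegative follows from
   |E cos| <= 1.  Finally, on a large interval a continuous function is a
   polynomial in sin(w x) up to a small error (Bernstein), so that convergence
   of all cosine transforms and bounded second moments give convergence in
   distribution. *)
Require Import Defs.
From HB Require Import structures.
From mathcomp Require Import all_boot all_order all_algebra.
From mathcomp Require Import all_classical all_reals all_analysis.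
From mathcomp Require Import measurable_realfun.
From mathcomp Require Import ring lra zify.

Set Implicit Arguments.
Unset Strict Implicit.
Unset Printing Implicit Defensive.
Import Order.TTheory GRing.Theory Num.Theory.
Import numFieldNormedType.Exports.
Local Open Scope classical_set_scope.
Local Open Scope ring_scope.

(** * Expectations of bounded measurable functions *)

Section bounded_measurable.
Context d (T : measurableType d) (R : realType).
Implicit Types f g : T -> R.

(** The coefficient [alpha1] controls one future variable given the past, never a product of two of
    them. Mixing is therefore used only where a single future factor stands against a bounded
    function of the past, and the second order terms, which are products, are left to 2-ergodicity.
    Blocks of a fixed length can be averaged because one step moves the argument of the cosine by at
    most a constant times the vanishing scale.

    The parameters are fixed in the order lag, block length, sample size: the tail of the
    coefficients determines the lag, ergodicity then determines the block length, and only
    afterwards does the sample size grow.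

    The coefficients concern indicators of half-lines, whereas the summands are [H_ Y] and [G_ X].
    These are averages of such indicators and inherit the coefficients without loss.

    The phase [b] in cos (s x + b) replaces complex exponentials: sine transforms are the case of a
    phase shifted by pi / 2, and the addition formulas stay within the family. *)

Definition bounded_measurable f : Prop :=
  measurable_fun setT f /\ exists M : R, forall w, `|f w| <= M.

Lemma bmf_cst (c : R) : bounded_measurable (fun=> c).
Proof. by split; [exact: measurable_cst|exists `|c|]. Qed.

Lemma bmfD f g : bounded_measurable f -> bounded_measurable g ->
  bounded_measurable (fun w => f w + g w).
Proof.
move=> [mf [Mf fM]] [mg [Mg gM]]; split; first exact: measurable_funD.
by exists (Mf + Mg) => w; rewrite (le_trans (ler_normD _ _))// lerD.
Qed.

Lemma bmfN f : bounded_measurable f -> bounded_measurable (fun w => - f w).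
Proof.
move=> [mf [Mf fM]]; split; first exact: measurable_funN.
by exists Mf => w; rewrite normrN.
Qed.

Lemma bmfB f g : bounded_measurable f -> bounded_measurable g ->
  bounded_measurable (fun w => f w - g w).
Proof. by move=> bf /bmfN bg; exact: bmfD bf bg. Qed.

Lemma bmfM f g : bounded_measurable f -> bounded_measurable g ->
  bounded_measurable (fun w => f w * g w).
Proof.
move=> [mf [Mf fM]] [mg [Mg gM]]; split; first exact: measurable_funM.
by exists (Mf * Mg) => w; rewrite normrM ler_pM.
Qed.

Lemma bmfX f n : bounded_measurable f -> bounded_measurable (fun w => f w ^+ n).
Proof.
move=> [mf [Mf fM]]; split; first exact: measurable_funX.
by exists (Mf ^+ n) => w; rewrite normrX lerXn2r ?nnegrE ?(le_trans _ (fM w)).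
Qed.

Lemma bmf_norm f : bounded_measurable f -> bounded_measurable (fun w => `|f w|).
Proof.
move=> [mf [Mf fM]]; split; first exact: measurableT_comp.
by exists Mf => w; rewrite normr_id.
Qed.

Lemma bmf_sum (I : Type) (r : seq I) (p : pred I) (F : I -> T -> R) :
  (forall i, bounded_measurable (F i)) ->
  bounded_measurable (fun w => \sum_(i <- r | p i) F i w).
Proof.
move=> bF; elim: r => [|i r IH].
  by under eq_fun do rewrite big_nil; exact: bmf_cst.
under eq_fun do rewrite big_cons.
by case: (p i) => //; exact: bmfD.
Qed.

Lemma bmf_cos f : measurable_fun setT f -> bounded_measurable (fun w => cos (f w)).
Proof.
move=> mf; split; last by exists 1 => w; exact: cos_max.
by apply: measurableT_comp => //; apply: continuous_measurable_fun;
  exact: continuous_cos.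
Qed.

Lemma bmf_sin f : measurable_fun setT f -> bounded_measurable (fun w => sin (f w)).
Proof.
move=> mf; split; last by exists 1 => w; exact: sin_max.
by apply: measurableT_comp => //; apply: continuous_measurable_fun;
  exact: continuous_sin.
Qed.

Lemma bmf_indic (A : set T) : measurable A ->
  bounded_measurable (fun w => \1_A w).
Proof.
move=> mA; split; first exact: measurable_indic.
by exists 1 => w; rewrite indicE; case: (_ \in _); rewrite ?normr1 ?normr0.
Qed.

End bounded_measurable.

Lemma bmf_comp d d' (T : measurableType d) (T' : measurableType d')
  (R : realType) (f : T' -> R) (g : T -> T') :
  bounded_measurable f -> measurable_fun setT g ->
  bounded_measurable (fun w => f (g w)).
Proof.
move=> [mf [M fM]] mg; split; first exact: (measurableT_comp mf mg).
by exists M => w; exact: fM.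
Qed.

Section expectation_of_bounded.
Context d (T : measurableType d) (R : realType) (P : probability T R).
Implicit Types f g : T -> R.
Local Notation bmf := (@bounded_measurable _ T R).

Lemma bmf_integrable f : bmf f -> P.-integrable setT (EFin \o f).
Proof.
move=> [mf [M fM]]; apply: (@le_integrable _ _ _ P setT measurableT _ (EFin \o cst M)).
- exact/measurable_EFinP.
- by move=> w _ /=; rewrite lee_fin (le_trans (fM w))// ler_norm.
- apply/integrableP; split; first exact/measurable_EFinP/measurable_cst.
  by rewrite (eq_integral (cst `|M|%:E))// integral_cst//= probability_setT mule1 ltry.
Qed.

Lemma Ex_EFin f : bmf f -> (\int[P]_w (f w)%:E)%E = (\int[P]_w f w)%:E.
Proof.
by move=> bf; rewrite /Rintegral fineK//; apply: integrable_fin_num => //;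
  exact: bmf_integrable.
Qed.

Lemma Ex_cst (c : R) : \int[P]_w c = c.
Proof. by rewrite Rintegral_cst//= probability_setT mulr1. Qed.

Lemma ExD f g : bmf f -> bmf g ->
  \int[P]_w (f w + g w) = \int[P]_w f w + \int[P]_w g w.
Proof. by move=> bf bg; rewrite RintegralD//; exact: bmf_integrable. Qed.

Lemma ExB f g : bmf f -> bmf g ->
  \int[P]_w (f w - g w) = \int[P]_w f w - \int[P]_w g w.
Proof. by move=> bf bg; rewrite RintegralB//; exact: bmf_integrable. Qed.

Lemma ExZ (c : R) f : bmf f -> \int[P]_w (c * f w) = c * \int[P]_w f w.
Proof. by move=> bf; rewrite RintegralZl//; exact: bmf_integrable. Qed.

Lemma ExN f : bmf f -> \int[P]_w (- f w) = - \int[P]_w f w.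
Proof.
move=> bf; rewrite -mulN1r -ExZ//; congr fine.
by apply: eq_integral => w _; rewrite mulN1r.
Qed.

Lemma Ex_sum (I : Type) (r : seq I) (p : pred I) (F : I -> T -> R) :
  (forall i, bmf (F i)) ->
  \int[P]_w (\sum_(i <- r | p i) F i w) = \sum_(i <- r | p i) \int[P]_w F i w.
Proof.
move=> bF; elim: r => [|i r IH].
  by under eq_Rintegral do rewrite big_nil; rewrite Ex_cst big_nil.
under eq_Rintegral do rewrite big_cons.
rewrite big_cons; case: (p i) => //.
by rewrite ExD ?IH//; exact: bmf_sum.
Qed.

Lemma le_Ex f g : bmf f -> bmf g -> (forall w, f w <= g w) ->
  \int[P]_w f w <= \int[P]_w g w.
Proof. by move=> bf bg fg; apply: le_Rintegral => //; exact: bmf_integrable. Qed.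

Lemma le_norm_Ex f : bmf f -> `|\int[P]_w f w| <= \int[P]_w `|f w|.
Proof. by move=> bf; apply: le_normr_Rintegral => //; exact: bmf_integrable. Qed.

Lemma norm_Ex_le f g : bmf f -> bmf g -> (forall w, `|f w| <= g w) ->
  `|\int[P]_w f w| <= \int[P]_w g w.
Proof.
by move=> bf bg fg; rewrite (le_trans (le_norm_Ex bf))// le_Ex//; exact: bmf_norm.
Qed.

Lemma norm_Ex_le_cst f (B : R) : bmf f -> (forall w, `|f w| <= B) ->
  `|\int[P]_w f w| <= B.
Proof.
by move=> bf fB; rewrite -[leRHS]Ex_cst norm_Ex_le//; exact: bmf_cst.
Qed.

Lemma eq_Ex f g : f =1 g -> \int[P]_w f w = \int[P]_w g w.
Proof. by move=> fg; apply: eq_Rintegral => w _; exact: fg. Qed.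

End expectation_of_bounded.

(** * Trigonometric expansions *)

Section taylor.
Context {R : realType}.
Implicit Types (f g : R -> R) (x y : R).

(** The end points are not ordered, so that the Taylor bounds below treat both signs at once; all
    they need of the intermediate point is its distance to [x]. *)
Lemma MVT_between f g : (forall x, is_derive x 1 f (g x)) ->
  forall x y, exists2 c, `|c - x| <= `|y - x| & f y - f x = g c * (y - x).
Proof.
move=> fg x y.
have cf : continuous f.
  by move=> z; apply: differentiable_continuous; apply/derivable1_diffP; apply: ex_derive.
have fgW (a b z : R) : z \in `]a, b[ -> is_derive z 1 f (g z) by [].
have [xy|yx] := leP x y.
  have [c cxy E] := MVT_segment xy (@fgW x y) (continuous_subspaceT cf).
  exists c => //; move: cxy; rewrite in_itv/= => /andP[xc cy].
  by rewrite !ger0_norm ?subr_ge0//; lra.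
have [c cxy E] := MVT_segment (ltW yx) (@fgW y x) (continuous_subspaceT cf).
exists c; last by rewrite -opprB E -mulrN opprB.
move: cxy; rewrite in_itv/= => /andP[xc cy].
by rewrite !ler0_norm ?subr_le0 ?(ltW yx)//; lra.
Qed.

(** The mean value theorem turns a bound of order [n] on the derivative into one of order [n.+1] on
    the function. Repeated use gives the Taylor bounds below; factorials are given up, since only
    the orders matter. *)
Lemma norm_le_of_derive f g (C : R) n : 0 <= C ->
  (forall x, is_derive x 1 f (g x)) ->
  f 0 = 0 -> forall y, (forall x, `|x| <= `|y| -> `|g x| <= C * `|x| ^+ n) ->
  `|f y| <= C * `|y| ^+ n.+1.
Proof.
move=> C0 fg f0 y gC; have [c] := MVT_between fg 0 y.
rewrite f0 !subr0 => cy ->; rewrite normrM exprSr mulrA ler_wpM2r//.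
by rewrite (le_trans (gC _ cy))// ler_wpM2l// lerXn2r ?nnegrE.
Qed.

Lemma cosB1_le y : `|cos y - 1| <= `|y|.
Proof.
have D (x : R) : is_derive x 1 (fun z => cos z - 1) (- sin x).
  by apply: is_derive_eq; rewrite subr0.
rewrite -[leRHS]mul1r -[X in _ * X]expr1.
apply: (norm_le_of_derive _ D) => //; first by rewrite cos0 subrr.
by move=> x _; rewrite expr0 mulr1 normrN sin_max.
Qed.

Lemma sin_le y : `|sin y| <= `|y|.
Proof.
rewrite -[leRHS]mul1r -[X in _ * X]expr1.
apply: (@norm_le_of_derive _ cos) => //; first by rewrite sin0.
by move=> x _; rewrite expr0 mulr1 cos_max.
Qed.

Lemma cosB1_le2 y : `|cos y - 1| <= `|y| ^+ 2.
Proof.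
have D (x : R) : is_derive x 1 (fun z => cos z - 1) (- sin x).
  by apply: is_derive_eq; rewrite subr0.
rewrite -[leRHS]mul1r.
apply: (norm_le_of_derive _ D) => //; first by rewrite cos0 subrr.
by move=> x _; rewrite mul1r normrN sin_le.
Qed.

(** The exponent is left free because the sine is needed at order 2, inside the derivative of the
    cosine remainder, and at order 3. *)
Lemma sinB_le n y : (forall x : R, `|cos x - 1| <= `|x| ^+ n) ->
  `|sin y - y| <= `|y| ^+ n.+1.
Proof.
move=> cn.
have D (x : R) : is_derive x 1 (fun z => sin z - z) (cos x - 1).
  by apply: is_derive_eq.
rewrite -[leRHS]mul1r.
apply: (norm_le_of_derive _ D) => //; first by rewrite sin0 subrr.
by move=> x _; rewrite mul1r.
Qed.

Lemma sin_taylor3 y : `|sin y - y| <= `|y| ^+ 3.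
Proof. by apply: sinB_le => x; exact: cosB1_le2. Qed.

Lemma cos_taylor3 y : `|cos y - 1 + y ^+ 2 / 2| <= `|y| ^+ 3.
Proof.
have D (x : R) : is_derive x 1 (fun z => cos z - 1 + z ^+ 2 / 2) (x - sin x).
  by apply: is_derive_eq; rewrite /GRing.scale/=; field.
rewrite -[leRHS]mul1r.
apply: (norm_le_of_derive _ D) => //.
  by rewrite cos0 subrr expr0n/= mul0r addr0.
by move=> x _; rewrite mul1r distrC sinB_le// => z; rewrite expr1 cosB1_le.
Qed.

Lemma cos_lip x y : `|cos x - cos y| <= `|x - y|.
Proof.
have [c _ ->] := MVT_between (@is_derive_cos R) y x.
by rewrite normrM -[leRHS]mul1r ler_wpM2r// normrN sin_max.
Qed.

Lemma expRB1_le y : `|y| <= 1 -> `|expR y - 1| <= expR 1 * `|y|.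
Proof.
move=> y1.
have D (x : R) : is_derive x 1 (fun z => expR z - 1) (expR x).
  by apply: is_derive_eq; rewrite subr0.
rewrite -[X in _ * X]expr1.
apply: (norm_le_of_derive _ D) => //; rewrite ?expR_ge0// ?expR0 ?subrr//.
move=> x xy; rewrite expr0 mulr1 ger0_norm ?expR_ge0// ler_expR.
by rewrite (le_trans (ler_norm _))// (le_trans xy).
Qed.

Lemma expR_taylor2 y : `|y| <= 1 -> `|expR y - 1 - y| <= expR 1 * `|y| ^+ 2.
Proof.
move=> y1.
have D (x : R) : is_derive x 1 (fun z => expR z - 1 - z) (expR x - 1).
  by apply: is_derive_eq; rewrite subr0.
apply: (norm_le_of_derive _ D) => //; rewrite ?expR_ge0// ?expR0 ?subrr// ?subr0//.
by move=> x xy; rewrite expr1 expRB1_le// (le_trans xy).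
Qed.

(** Here [x] is the base point, [v] the last step and [u] the sum of the steps in between. The
    coefficient of cos x is half of (u + v)^2 - u^2; it is the origin of [lagged_products]. *)
Lemma cos_increment_taylor x u v (K : R) : `|u| <= K -> `|u + v| <= K ->
  `|cos (x + (u + v)) - cos (x + u) + v * sin x + (u * v + v ^+ 2 / 2) * cos x|
    <= 4 * K ^+ 3.
Proof.
move=> uK uvK.
set cu := cos u - 1 + u ^+ 2 / 2; set cw := cos (u + v) - 1 + (u + v) ^+ 2 / 2.
set su := sin u - u; set sw := sin (u + v) - (u + v).
have -> : cos (x + (u + v)) - cos (x + u) + v * sin x +
    (u * v + v ^+ 2 / 2) * cos x = cos x * (cw - cu) - sin x * (sw - su).
  by rewrite (cosD x (u + v)) (cosD x u) /cu /cw /su /sw; field.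
have K3 (z : R) : `|z| <= K -> `|z| ^+ 3 <= K ^+ 3.
  by move=> zK; rewrite lerXn2r ?nnegrE// (le_trans _ zK).
have h1 : `|cw - cu| <= 2 * K ^+ 3.
  rewrite (le_trans (ler_normB _ _))// mulr_natl mulr2n lerD//.
    exact: le_trans (cos_taylor3 _) (K3 _ uvK).
  exact: le_trans (cos_taylor3 _) (K3 _ uK).
have h2 : `|sw - su| <= 2 * K ^+ 3.
  rewrite (le_trans (ler_normB _ _))// mulr_natl mulr2n lerD//.
    exact: le_trans (sin_taylor3 _) (K3 _ uvK).
  exact: le_trans (sin_taylor3 _) (K3 _ uK).
rewrite (le_trans (ler_normB _ _))// !normrM.
have c1 : `|cos x| * `|cw - cu| <= 1 * (2 * K ^+ 3) by rewrite ler_pM// cos_max.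
have c2 : `|sin x| * `|sw - su| <= 1 * (2 * K ^+ 3) by rewrite ler_pM// sin_max.
lra.
Qed.

End taylor.

(** * A central limit theorem for cosines of partial sums *)

Ltac bmf := repeat progress first
  [ assumption
  | match goal with H : forall _, bounded_measurable _ |- _ => exact: H end
  | match goal with H : forall _ _, bounded_measurable _ |- _ => exact: H end
  | apply: bmf_cst | apply: bmfD | apply: bmfN
  | apply: bmfM | apply: bmfX | apply: bmf_norm | apply: bmf_sum => ? ].

(** * Sums with slowly varying weights and small block averages *)

Section averaging.
Context d (T : measurableType d) (R : realType) (P : probability T R).
Variables (A eta : nat -> T -> R) (W delta K e : R) (p N : nat).
Hypotheses (p0 : (0 < p)%N) (W0 : 0 <= W) (delta0 : 0 <= delta).
Hypotheses (bA : forall k, bounded_measurable (A k)).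
Hypotheses (beta : forall k, bounded_measurable (eta k)).
Hypotheses (AW : forall k w, (k < N)%N -> `|A k w| <= W).
Hypotheses (Adelta : forall k w, (k.+1 < N)%N -> `|A k.+1 w - A k w| <= delta).
Hypotheses (etaK : forall k w, `|eta k w| <= K).
Hypotheses (etae : forall q, \int[P]_w `|\sum_(0 <= i < p) eta (q + i)%N w|
                               <= e * p%:R).

Let K0 : 0 <= K.
Proof.
(* A pointwise bound by [K] gives its sign only at some point of the space; there is one because the
   total mass is 1. *)
have [w|T0] := pselect (exists w : T, True).
  by have [x _] := w; exact: le_trans (etaK 0 x).
have : P setT = 0%E.
  by rewrite (_ : setT = set0) ?measure0//; apply/seteqP; split => x // _; case: T0; exists x.
by rewrite probability_setT => /eqP; rewrite onee_eq0.
Qed.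

Let slow q i w : (q + i < N)%N -> `|A (q + i) w - A q w| <= i%:R * delta.
Proof.
elim: i => [|i IH] h; first by rewrite addn0 subrr normr0 mul0r.
rewrite -(subrKA (A (q + i) w)) (le_trans (ler_normD _ _))//.
rewrite -natr1 mulrDl mul1r addrC lerD//; first by apply: IH; lia.
by rewrite addnS; apply: Adelta; rewrite -addnS.
Qed.

Let block q : (q + p <= N)%N ->
  `|\sum_(0 <= i < p) \int[P]_w (A (q + i)%N w * eta (q + i)%N w)|
    <= p%:R * (W * e + p%:R * delta * K).
Proof.
move=> qN.
have -> : \sum_(0 <= i < p) \int[P]_w (A (q + i)%N w * eta (q + i)%N w) =
    \int[P]_w (A q w * \sum_(0 <= i < p) eta (q + i)%N w) +
    \sum_(0 <= i < p) \int[P]_w ((A (q + i)%N w - A q w) * eta (q + i)%N w).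
  rewrite -Ex_sum; last by move=> i; bmf.
  rewrite -Ex_sum; last by move=> i; bmf.
  rewrite -ExD; [|by bmf|by bmf].
  apply: eq_Ex => w; rewrite mulr_sumr -big_split/=.
  by apply: eq_bigr => i _; ring.
rewrite (le_trans (ler_normD _ _))// mulrDr lerD//.
  apply: (@le_trans _ _ (\int[P]_w (W * `|\sum_(0 <= i < p) eta (q + i)%N w|))).
    apply: norm_Ex_le; [by bmf|by bmf|move=> w].
    by rewrite normrM ler_wpM2r// AW//; lia.
  rewrite ExZ; last by bmf.
  by rewrite mulrCA ler_wpM2l// mulrC etae.
rewrite (le_trans (ler_norm_sum _ _ _))//.
apply: (@le_trans _ _ (\sum_(0 <= i < p) (p%:R * delta * K))); last first.
  by rewrite sumr_const_nat subn0 -[leLHS]mulr_natl.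
rewrite !big_nat; apply: ler_sum => i /andP[_ ip].
apply: norm_Ex_le_cst; first by bmf.
move=> w; rewrite normrM ler_pM//.
apply: le_trans (slow _ _) _; first lia.
by rewrite ler_wpM2r// ler_nat ltnW.
Qed.

(** Full blocks are bounded by [block]. Fewer than [p] terms are left over, and their trivial bound
    is the last summand. *)
Lemma averaging :
  `|\sum_(0 <= k < N) \int[P]_w (A k w * eta k w)|
    <= N%:R * (W * e + p%:R * delta * K) + p%:R * (W * K).
Proof.
set F := fun k => \int[P]_w (A k w * eta k w).
set B := W * e + p%:R * delta * K.
have e0 : 0 <= e.
  have := etae 0; rewrite -(pmulr_lge0 e (_ : 0 < p%:R)) ?ltr0n//.
  by apply: le_trans; apply: Rintegral_ge0.
have B0 : 0 <= B by rewrite addr_ge0// ?mulr_ge0.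
have H Q : (Q * p <= N)%N -> `|\sum_(0 <= k < Q * p) F k| <= (Q * p)%:R * B.
  elim: Q => [|Q IH] QN; first by rewrite mul0n big_geq// normr0 mul0r.
  rewrite mulSnr (big_cat_nat _ (n := (Q * p)%N)) ?leq_addr//=.
  rewrite (le_trans (ler_normD _ _))// natrD mulrDl lerD// ?IH//; first lia.
  rewrite -[X in \sum_(X <= _ < _) _]add0n big_addn addKn.
  under eq_bigr do rewrite addnC.
  by apply: block; rewrite -mulSnr.
rewrite (big_cat_nat _ (n := (N %/ p * p)%N)) ?leq_divM//=.
rewrite (le_trans (ler_normD _ _))// lerD//.
  rewrite (le_trans (H _ _)) ?leq_divM// ler_wpM2r// ler_nat leq_divM//.
rewrite (le_trans (ler_norm_sum _ _ _))//.
apply: (@le_trans _ _ (\sum_(N %/ p * p <= k < N) (W * K))).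
  rewrite !big_nat; apply: ler_sum => k /andP[_ kN].
  apply: norm_Ex_le_cst; first by bmf.
  by move=> w; rewrite normrM ler_pM// AW.
rewrite sumr_const_nat -[leLHS]mulr_natl ler_wpM2r ?mulr_ge0//.
by rewrite ler_nat leq_subLR {1}(divn_eq N p) leq_add2l ltnW// ltn_mod.
Qed.

End averaging.

Lemma cvg_expR (R : realType) (u : nat -> R) (l : R) :
  u @ \oo --> l -> (fun k => expR (u k)) @ \oo --> expR l.
Proof. by move=> ul; apply: continuous_cvg ul; exact: continuous_expR. Qed.

(** * Telescoping for cosine transforms of partial sums *)

Section clt.
Context d (T : measurableType d) (R : realType) (P : probability T R).
Variables (xi : nat -> T -> R) (M : R) (a tau v : nat -> R) (V : R).

Definition psum (k : nat) (w : T) : R := \sum_(0 <= i < k) xi i w.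
(** Second order coefficient of the increment of the cosine at step [j + L], expanded around the
    partial sum at [j]: the last step times the [L] steps before it, plus half of its square. *)
Definition lagged_products (L j : nat) (w : T) : R :=
  (\sum_(0 <= i < L) xi (j + i)%N w) * xi (j + L)%N w + xi (j + L)%N w ^+ 2 / 2.
Local Notation S := psum.
Local Notation Q := lagged_products.

Hypotheses (mxi : forall k, measurable_fun setT (xi k)).
Hypotheses (M0 : 0 <= M) (xiM : forall k w, `|xi k w| <= M).
Hypothesis mean0 : forall k, \int[P]_w xi k w = 0.
(** Increments of the cosine are of size [|s| * M]; correlating them, instead of the cosines
    themselves, gains the factor [|s|]. *)
Hypothesis dep : forall (s b : R) i l, (0 < l)%N ->
  `|\int[P]_w ((cos (s * S i.+1 w + b) - cos (s * S i w + b)) * xi (i + l)%N w)|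
    <= `|s| * M * a l.
Hypothesis tail : forall L n, \sum_(L.+1 <= l < n) a l <= tau L.
Hypothesis erg : forall L (e : R), 0 < e -> exists2 p, (0 < p)%N &
  forall q, \int[P]_w `|\sum_(0 <= i < p) (Q L (q + i)%N w - v L)| <= e * p%:R.
Hypothesis tau0 : tau @ \oo --> 0.
Hypothesis vV : v @ \oo --> V / 2.

Let bxi k : bounded_measurable (xi k).
Proof. by split=> //; exists M => w; exact: xiM. Qed.

Let bS k : bounded_measurable (S k).
Proof. by rewrite /S; bmf. Qed.

Let bQ L j : bounded_measurable (Q L j).
Proof. by rewrite /Q; bmf. Qed.

Let bcS (s b : R) k : bounded_measurable (fun w => cos (s * S k w + b)).
Proof.
apply: bmf_cos; apply: measurable_funD => //; apply: measurable_funM => //.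
by have [] := bS k.
Qed.

Let bsS (s b : R) k : bounded_measurable (fun w => sin (s * S k w + b)).
Proof.
apply: bmf_sin; apply: measurable_funD => //; apply: measurable_funM => //.
by have [] := bS k.
Qed.

Let SD j L w : S (j + L)%N w = S j w + \sum_(0 <= i < L) xi (j + i)%N w.
Proof.
rewrite /S (big_cat_nat _ (n := j)) ?leq_addr//=; congr (_ + _).
rewrite -[X in \sum_(X <= _ < _) _]add0n big_addn addKn.
by apply: eq_bigr => i _; rewrite addnC.
Qed.

Let S1 j w : S j.+1 w = S j w + xi j w.
Proof. by rewrite /S big_nat_recr. Qed.

Let blockM j L w : `|\sum_(0 <= i < L) xi (j + i)%N w| <= L%:R * M.
Proof.
rewrite (le_trans (ler_norm_sum _ _ _))//.
apply: (@le_trans _ _ (\sum_(0 <= i < L) M)); first exact: ler_sum.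
by rewrite sumr_const_nat subn0 mulr_natl.
Qed.

Let QM L j w : `|Q L j w| <= L%:R * M * M + M ^+ 2.
Proof.
rewrite (le_trans (ler_normD _ _))// lerD//; first by rewrite normrM ler_pM.
rewrite normrM normrX [`|2^-1|]ger0_norm// ler_pdivrMr//.
apply: (@le_trans _ _ (M ^+ 2)); first by rewrite lerXn2r ?nnegrE.
by rewrite ler_peMr ?sqr_ge0//; lra.
Qed.

(** As [xi] has mean zero, the cosine may be replaced by the sum of its increments since time 0, all
    of them at lags larger than [L]. Multiplied by the [s] of the first order term, the bound is of
    order s^2 tau(L), which remains small after summation over about s^-2 steps. *)
Let dep_far (s b : R) j L :
  `|\int[P]_w (cos (s * S j w + b) * xi (j + L)%N w)| <= `|s| * M * tau L.
Proof.
have -> : \int[P]_w (cos (s * S j w + b) * xi (j + L)%N w) =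
    \sum_(0 <= i < j) \int[P]_w ((cos (s * S i.+1 w + b) - cos (s * S i w + b))
                                * xi (j + L)%N w).
  rewrite -Ex_sum; last by move=> i; bmf.
  have m0 : \int[P]_w (cos b * xi (j + L)%N w) = 0 by rewrite ExZ// mean0 mulr0.
  rewrite -[LHS]subr0 -[X in _ - X]m0.
  rewrite -ExB; [|by bmf|by bmf].
  apply: eq_Ex => w /=; rewrite -mulr_suml telescope_sumr// mulrBl.
  by rewrite (_ : S 0 w = 0) ?mulr0 ?add0r// /S big_geq.
rewrite (le_trans (ler_norm_sum _ _ _))//.
apply: (@le_trans _ _ (`|s| * M * \sum_(0 <= i < j) a (j + L - i)%N)).
  rewrite mulr_sumr !big_nat; apply: ler_sum => i /andP[_ ij].
  by rewrite {1}(_ : j + L = i + (j + L - i))%N ?dep//; lia.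
rewrite ler_wpM2l ?mulr_ge0//.
(* The lags [j + L - i] with [i < j] run through [L.+1], ..., [L + j] in reverse order. *)
have := tail L (L.+1 + j); rewrite -[X in \sum_(X <= _ < _) _]add0n big_addn addKn.
rewrite big_nat_rev/=; apply: le_trans.
rewrite le_eqVlt; apply/orP; left; apply/eqP.
by rewrite !big_nat; apply: eq_bigr => i /andP[_ ij]; congr a; lia.
Qed.

Let dep_far_sin (s b : R) j L :
  `|\int[P]_w (sin (s * S j w + b) * xi (j + L)%N w)| <= `|s| * M * tau L.
Proof.
have := dep_far s (b - pi / 2) j L; congr (`|_| <= _).
by apply: eq_Ex => w /=; rewrite addrA cosBpihalf.
Qed.

Let x (s b : R) k := \int[P]_w cos (s * S k w + b).

Let xD (s b : R) j L : `|x s b (j + L)%N - x s b j| <= `|s| * (L%:R * M).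
Proof.
rewrite /x -ExB; [|by bmf|by bmf].
apply: norm_Ex_le_cst; first by bmf.
move=> w; rewrite (le_trans (cos_lip _ _))// SD.
rewrite (_ : _ - _ = s * \sum_(0 <= i < L) xi (j + i)%N w); last by ring.
by rewrite normrM ler_wpM2l.
Qed.

Let x1 (s b : R) k : `|x s b k| <= 1.
Proof. by apply: norm_Ex_le_cst => [|w]; [by bmf|exact: cos_max]. Qed.

Let e1 : R := expR 1.
Let e1_ge0 : 0 <= e1. Proof. exact: expR_ge0. Qed.

(** For the first [L] steps, which have no base point [L] steps back. The bound is only of order
    [|s|], but it is used a fixed number of times. *)
Let step_crude (s b : R) (k : nat) (theta : R) : `|theta| <= 1 ->
  `|x s b k.+1 - expR (- theta) * x s b k| <= `|s| * M + e1 * `|theta|.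
Proof.
move=> th1.
have -> : x s b k.+1 - expR (- theta) * x s b k =
  (x s b k.+1 - x s b k) - (expR (- theta) - 1) * x s b k by ring.
rewrite (le_trans (ler_normB _ _))// lerD//.
  by have := xD s b k 1; rewrite addn1 mul1r.
rewrite normrM -[leRHS]mulr1 ler_pM//.
by rewrite -[X in _ * X]normrN expRB1_le// normrN.
Qed.

(** One step multiplies [x] by nearly exp (- theta). The centred product term is not negligible in a
    single step, so it is kept on the left and treated after summation. *)
Let step (s b : R) L j : let theta := s ^+ 2 * V / 2 in `|theta| <= 1 ->
  `|x s b (j + L).+1 - expR (- theta) * x s b (j + L)
    + s ^+ 2 * \int[P]_w (cos (s * S j w + b) * (Q L j w - v L))|
  <= 4 * (`|s| * (L.+1%:R * M)) ^+ 3 + `|s| * (`|s| * M * tau L)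
     + s ^+ 2 * `|V / 2 - v L| + e1 * theta ^+ 2 + `|theta| * (`|s| * (L%:R * M)).
Proof.
move=> theta th1.
set C := fun w => cos (s * S j w + b); set D := fun w => sin (s * S j w + b).
have bC : bounded_measurable C by exact: bcS.
have bD : bounded_measurable D by exact: bsS.
pose err w := cos (s * S (j + L).+1 w + b) - cos (s * S (j + L) w + b)
  + s * (D w * xi (j + L)%N w) + s ^+ 2 * (C w * Q L j w).
have berr : bounded_measurable err by rewrite /err; bmf.
have errE : `|\int[P]_w err w| <= 4 * (`|s| * (L.+1%:R * M)) ^+ 3.
  apply: norm_Ex_le_cst => // w.
  set U := \sum_(0 <= i < L) xi (j + i)%N w; set z := xi (j + L)%N w.
  have -> : err w = cos ((s * S j w + b) + (s * U + s * z))
      - cos ((s * S j w + b) + s * U) + s * z * sin (s * S j w + b)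
      + (s * U * (s * z) + (s * z) ^+ 2 / 2) * cos (s * S j w + b).
    rewrite /err /Q S1 SD -/U -/z /C /D.
    rewrite (_ : s * (S j w + U + z) + b = s * S j w + b + (s * U + s * z)); last by ring.
    rewrite (_ : s * (S j w + U) + b = s * S j w + b + s * U); last by ring.
  by field.
  apply: cos_increment_taylor.
    rewrite normrM ler_wpM2l// (le_trans (blockM _ _ _))// ler_wpM2r//.
    by rewrite ler_nat.
  rewrite -mulrDr normrM ler_wpM2l// -natr1 mulrDl mul1r.
  by apply: le_trans (ler_normD _ _) _; apply: lerD; [exact: blockM|exact: xiM].
have I1 : \int[P]_w err w = x s b (j + L).+1 - x s b (j + L)
  + s * \int[P]_w (D w * xi (j + L)%N w) + s ^+ 2 * \int[P]_w (C w * Q L j w).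
  rewrite /err /x -ExB; [|by bmf|by bmf].
  rewrite -!ExZ; [|by bmf|by bmf].
  by rewrite -!ExD//; bmf.
have I2 : \int[P]_w (C w * (Q L j w - v L)) = \int[P]_w (C w * Q L j w) - v L * x s b j.
  rewrite /x -ExZ; last by bmf.
  by rewrite -ExB; [|by bmf|by bmf]; apply: eq_Ex => w /=; rewrite -/(C w); ring.
set J := \int[P]_w (D w * xi (j + L)%N w) in I1.
set I := \int[P]_w err w in errE I1.
rewrite -/C I2.
set G := \int[P]_w (C w * Q L j w) in I1 *.
(* Five errors: the Taylor remainder, the first order term, the replacement of [v L] by [V / 2], the
   remainder of the exponential, and the move of the base point of [x] from [j] to [j + L]. *)
have -> : x s b (j + L).+1 - expR (- theta) * x s b (j + L) +
    s ^+ 2 * (G - v L * x s b j) =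
  I - s * J + s ^+ 2 * (V / 2 - v L) * x s b j
   - (expR (- theta) - 1 - (- theta)) * x s b (j + L)
   + theta * (x s b (j + L) - x s b j).
  by rewrite I1 /theta; field.
rewrite (le_trans (ler_normD _ _))// lerD//; last by rewrite normrM ler_wpM2l ?xD.
rewrite (le_trans (ler_normB _ _))// lerD//; last first.
  rewrite normrM -[leRHS]mulr1 ler_pM//.
  have := @expR_taylor2 R (- theta); rewrite normrN => /(_ th1).
  by rewrite real_normK ?num_real.
rewrite (le_trans (ler_normD _ _))// lerD//; last first.
  rewrite normrM (normrM (s ^+ 2)) (ger0_norm (sqr_ge0 s)) -[leRHS]mulr1.
  by apply: ler_wpM2l; [rewrite mulr_ge0 ?sqr_ge0|exact: x1].
rewrite (le_trans (ler_normB _ _))// lerD// normrM ler_wpM2l//.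
exact: dep_far_sin.
Qed.


(** A discrete integrating factor: after multiplication by exp (theta k), the one-step differences
    telescope. The sign of [V] is not known at this stage, so the weights are bounded through
    [|V|]. *)
Let total (s b : R) (n L p : nat) (e : R) :
  let theta := s ^+ 2 * V / 2 in
  let W := expR (n%:R * s ^+ 2 * `|V| / 2) in
  let K := L%:R * M * M + M ^+ 2 + `|v L| in
  `|theta| <= 1 -> (0 < p)%N -> 0 <= e ->
  (forall q, \int[P]_w `|\sum_(0 <= i < p) (Q L (q + i)%N w - v L)| <= e * p%:R) ->
  `|expR (theta * n%:R) * x s b n - cos b| <=
    W * (L%:R * (`|s| * M + e1 * `|theta|) +
      n%:R * (4 * (`|s| * (L.+1%:R * M)) ^+ 3 + `|s| * (`|s| * M * tau L)
     + s ^+ 2 * `|V / 2 - v L| + e1 * theta ^+ 2 + `|theta| * (`|s| * (L%:R * M))))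
    + s ^+ 2 * (n%:R * (W * e + p%:R * (W * (e1 * `|theta| + `|s| * M)) * K)
      + p%:R * (W * K)).
Proof.
move=> theta W K th1 p0 e0 He.
set r := 4 * _ + _ + _ + _ + _.
pose w k := expR (theta * k.+1%:R).
have wW k : (k < n)%N -> `|w k| <= W.
  move=> kn; rewrite ger0_norm ?expR_ge0// ler_expR.
  rewrite (_ : n%:R * s ^+ 2 * `|V| / 2 = `|theta| * n%:R); last first.
    rewrite /theta normrM (normrM (s ^+ 2)) (ger0_norm (sqr_ge0 s)).
    by rewrite [`|2^-1|]ger0_norm//; field.
  rewrite (le_trans (ler_norm _))// normrM ler_wpM2l// ger0_norm//.
  by rewrite ler_nat.
have wWL k : (k < n - L)%N -> `|w (k + L)%N| <= W.
  by rewrite ltn_subRL addnC; exact: wW.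
have W0 : 0 <= W by exact: expR_ge0.
have K0 : 0 <= K by rewrite !addr_ge0 ?mulr_ge0 ?sqr_ge0.
have -> : expR (theta * n%:R) * x s b n - cos b =
    \sum_(0 <= k < n) w k * (x s b k.+1 - expR (- theta) * x s b k).
  have -> : cos b = expR (theta * 0%:R) * x s b 0.
    rewrite mulr0 expR0 mul1r /x -[LHS](Ex_cst P); apply: eq_Ex => t /=.
    by rewrite (_ : S 0 t = 0) ?mulr0 ?add0r// /S big_geq.
  rewrite -(telescope_sumr (fun k => expR (theta * k%:R) * x s b k))//.
  apply: eq_bigr => k _; rewrite mulrBr mulrA /w -expRD.
  by congr (_ - expR _ * _); rewrite -natr1; ring.
(* The minimum covers the case [n < L], in which all steps get the crude bound. *)
rewrite (big_cat_nat _ (n := minn L n)) ?geq_minr//=.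
rewrite (le_trans (ler_normD _ _))// mulrDr -addrA lerD//.
  rewrite (le_trans (ler_norm_sum _ _ _))//.
  apply: (@le_trans _ _ (\sum_(0 <= k < minn L n) W * (`|s| * M + e1 * `|theta|))).
    rewrite !big_nat; apply: ler_sum => k /andP[_ kn]; rewrite normrM ler_pM//.
      by apply: wW; rewrite (leq_trans kn)// geq_minr.
    exact: step_crude.
  rewrite sumr_const_nat subn0 -[leLHS]mulr_natl mulrCA.
  by rewrite ler_wpM2l// ler_wpM2r ?addr_ge0 ?mulr_ge0// ler_nat geq_minl.
have -> : \sum_(minn L n <= k < n) w k * (x s b k.+1 - expR (- theta) * x s b k) =
   \sum_(0 <= j < n - L) w (j + L)%N * (x s b (j + L).+1 - expR (- theta) * x s b (j + L)).
  have [Ln|nL] := leqP L n.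
    by rewrite -[X in \sum_(X <= _ < _) _]add0n big_addn.
  by rewrite !big_geq//; lia.
pose eta j t := Q L j t - v L.
(* The integrating factor is absorbed into the slowly varying weight of [averaging]. *)
pose A j t := w (j + L)%N * cos (s * S j t + b).
have bA j : bounded_measurable (A j) by rewrite /A; bmf.
have beta j : bounded_measurable (eta j) by rewrite /eta; bmf.
have -> : \sum_(0 <= j < n - L) w (j + L)%N * (x s b (j + L).+1 - expR (- theta) * x s b (j + L))
  = \sum_(0 <= j < n - L) w (j + L)%N * (x s b (j + L).+1 - expR (- theta) * x s b (j + L)
       + s ^+ 2 * \int[P]_t (cos (s * S j t + b) * (Q L j t - v L)))
  - s ^+ 2 * \sum_(0 <= j < n - L) \int[P]_t (A j t * eta j t).
  rewrite mulr_sumr -sumrB; apply: eq_bigr => j _.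
  have -> : \int[P]_t (A j t * eta j t) =
    w (j + L)%N * \int[P]_t (cos (s * S j t + b) * (Q L j t - v L)).
    by rewrite -ExZ; [apply: eq_Ex => t; rewrite /A /eta mulrA|bmf].
  by ring.
have nLn : (n - L)%:R <= n%:R :> R by rewrite ler_nat leq_subr.
have tau_ge0 : 0 <= tau L by have := tail L 0; rewrite big_geq.
rewrite (le_trans (ler_normB _ _))// lerD//.
  rewrite (le_trans (ler_norm_sum _ _ _))//.
  apply: (@le_trans _ _ (\sum_(0 <= k < n - L) W * r)).
    rewrite !big_nat; apply: ler_sum => k /andP[_ kn]; rewrite normrM ler_pM//.
      exact: wWL.
    exact: step.
  rewrite sumr_const_nat subn0 -[leLHS]mulr_natl mulrCA.
  rewrite ler_wpM2l// ler_wpM2r//.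
  exact: le_trans (normr_ge0 _) (step b L 0 th1).
rewrite normrM (ger0_norm (sqr_ge0 s)) ler_wpM2l ?sqr_ge0//.
(* Consecutive weights differ for two reasons: a factor exp theta, and one more step in the partial
   sum. *)
set delta := W * (e1 * `|theta| + `|s| * M).
have delta0 : 0 <= delta.
  by rewrite /delta; apply: mulr_ge0 => //; apply: addr_ge0; apply: mulr_ge0.
apply: le_trans (averaging (delta := delta) (K := K) (N := n - L) p0 W0 delta0 bA beta _ _ _ He) _.
- by move=> k t kn; rewrite normrM -[leRHS]mulr1 ler_pM ?cos_max// wWL.
- move=> k t kn; rewrite /A.
  have -> : w (k.+1 + L)%N * cos (s * S k.+1 t + b) - w (k + L)%N * cos (s * S k t + b)
   = w (k + L)%N * ((expR theta - 1) * cos (s * S k.+1 t + b)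
       + (cos (s * S k.+1 t + b) - cos (s * S k t + b))).
    have -> : w (k.+1 + L)%N = w (k + L)%N * expR theta.
      by rewrite /w -expRD; congr expR; rewrite addSn -[in LHS]natr1; ring.
    by ring.
  rewrite normrM ler_pM//; first exact: (wWL _ (ltnW kn)).
  rewrite (le_trans (ler_normD _ _))// lerD//.
    by rewrite normrM -[leRHS]mulr1 ler_pM ?cos_max ?expRB1_le.
  rewrite (le_trans (cos_lip _ _))// S1.
  rewrite (_ : _ - _ = s * xi k t); last by ring.
  by rewrite normrM ler_wpM2l.
- by move=> k t; rewrite (le_trans (ler_normB _ _))// lerD.
rewrite lerD// ler_wpM2r//.
by do ?[exact: W0|exact: e0|apply: addr_ge0|apply: mulr_ge0].
Qed.


Lemma clt_cos (N : nat -> nat) (s : nat -> R) (t b : R) :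
  s @ \oo --> 0 -> (fun k => (N k)%:R * s k ^+ 2) @ \oo --> t ->
  (fun k => \int[P]_w cos (s k * S (N k) w + b)) @ \oo -->
    expR (- (t * V / 2)) * cos b.
Proof.
move=> s0 Yt; set Y := fun k => (N k)%:R * s k ^+ 2 in Yt.
have t0 : 0 <= t.
  by apply: (cvgr_to_ge Yt); apply: nearW => k; rewrite mulr_ge0 ?sqr_ge0.
suff H : (fun k => expR (Y k * V / 2) * x (s k) b (N k)) @ \oo --> cos b.
  have E : (fun k => \int[P]_w cos (s k * S (N k) w + b)) =
      (fun k => expR (- (Y k * V / 2)) * (expR (Y k * V / 2) * x (s k) b (N k))).
    by apply/funext => k; rewrite mulrA -expRD addNr expR0 mul1r.
  rewrite E; apply: cvgM H.
  by apply: cvg_expR; apply: cvgN; do 2 (apply: cvgM; last exact: cvg_cst).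
pose W y : R := expR (y * `|V| / 2).
(* The bound of [total] as a function of the weight bound [u], of c = |s| and of y = N s^2. It is
   polynomial in these, so its limit is its value at [c = 0]. *)
pose F L p e (u c y : R) :=
    let th := c * c * `|V| / 2 in
    let K := L%:R * M * M + M ^+ 2 + `|v L| in
    u * (L%:R * (c * M + e1 * th) +
      y * (4 * (c * (L.+1%:R * M * (L.+1%:R * M) * (L.+1%:R * M))) + M * tau L
     + `|V / 2 - v L| + e1 * (c * c * (V / 2 * (V / 2))) +  c * (`|V| / 2 * (L%:R * M))))
    + (y * (u * e + p%:R * (u * (e1 * th + c * M)) * K)
      + c * c * (p%:R * (u * K))).
have c0 : (fun k => `|s k|) @ \oo --> 0 by rewrite -(normr0 R); apply: cvg_norm.
have cW : W (Y k) @[k --> \oo] --> W t.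
  by apply: cvg_expR; do 2 (apply: cvgM; last exact: cvg_cst).
have cF L p e (u c y : nat -> R) l : u @ \oo --> l -> c @ \oo --> 0 ->
    y @ \oo --> t -> F L p e (u k) (c k) (y k) @[k --> \oo] --> F L p e l 0 t.
  move=> cu cc cy; rewrite /F; cbv zeta.
  repeat lazymatch goal with
  | |- cvg_to _ (nbhs (_ + _)) => apply: cvgD
  | |- cvg_to _ (nbhs (_ * _)) => apply: cvgM
  | |- cvg_to _ (nbhs l) => exact: cu
  | |- cvg_to _ (nbhs 0) => exact: cc
  | |- cvg_to _ (nbhs t) => exact: cy
  | |- _ => exact: cvg_cst
  end.
apply/cvgrPdist_le => eps eps0.
(* At [c = 0] there remain only the terms in [M * tau L + |V / 2 - v L|] and in the ergodic error.
   With both at most [e0] they contribute at most [W t * t * 2 * e0]; the [+ 1] covers [t = 0]. *)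
pose e0 := eps / (W t * t * 2 + 1).
have W0 y : 0 <= W y by exact: expR_ge0.
have D0 : 0 < W t * t * 2 + 1 by rewrite ltr_wpDl// !mulr_ge0.
have e0_gt0 : 0 < e0 by rewrite divr_gt0.
have [L HL] : exists L, M * tau L + `|V / 2 - v L| <= e0.
  have : (fun L => M * tau L + `|V / 2 - v L|) @ \oo --> 0.
    rewrite -[X in _ --> X](_ : M * 0 + `|V / 2 - V / 2| = 0); last first.
      by rewrite mulr0 subrr normr0 addr0.
    apply: cvgD; first by apply: cvgM => //; exact: cvg_cst.
    by apply: cvg_norm; apply: cvgB => //; exact: cvg_cst.
  move=> /cvgrPdist_le/(_ _ e0_gt0)[L _ /(_ L (leqnn L))].
  by rewrite sub0r normrN => /(le_trans (ler_norm _)); exists L.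
have [p p0 Hp] := erg L e0_gt0.
have FL : F L p e0 (W t) 0 t < eps.
  have -> : F L p e0 (W t) 0 t = W t * (t * (M * tau L + `|V / 2 - v L|)) + t * (W t * e0).
    by rewrite /F; ring.
  apply: (@le_lt_trans _ _ (W t * t * 2 * e0)).
    rewrite (_ : _ * _ * 2 * e0 = W t * (t * e0) + t * (W t * e0)); last by ring.
    by rewrite lerD2r ler_wpM2l// ler_wpM2l.
  rewrite /e0 mulrA ltr_pdivrMr// mulrC ltr_pM2l//.
  by rewrite ltrDl.
have hF := cvgr_lt _ (cF L p e0 _ _ _ _ cW c0 Yt) _ FL.
have /cvgrPdist_le/(_ 1 ltr01) hs : (fun k => `|s k| * `|s k| * `|V| / 2) @ \oo --> 0.
  rewrite -[X in _ --> X](_ : 0 * 0 * `|V| / 2 = 0); last by rewrite !mul0r.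
  by repeat first [exact: c0|exact: cvg_cst|apply: cvgM].
near=> k.
have Fk : F L p e0 (W (Y k)) `|s k| (Y k) <= eps by apply: ltW; near: k; exact: hF.
have th1 : `| `|s k| * `|s k| * `|V| / 2| <= 1.
  by rewrite -normrN -sub0r; near: k; exact: hs.
rewrite distrC (_ : Y k * V / 2 = s k ^+ 2 * V / 2 * (N k)%:R); last by rewrite /Y; ring.
have nth : `|s k ^+ 2 * V / 2| = `|s k| * `|s k| * `|V| / 2.
  by rewrite normrM (normrM (s k ^+ 2)) normrX expr2 [`|2^-1|]ger0_norm.
have := @total (s k) b (N k) L p e0; cbv zeta; rewrite nth; move=> /(_ _ p0 (ltW e0_gt0) Hp) => h.
apply: le_trans (h _) (le_trans _ Fk).
  by rewrite (le_trans (ler_norm _)).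
rewrite /F /Y /W -(real_normK (num_real (s k))) le_eqVlt; apply/orP; left; apply/eqP.
by field.
Unshelve. all: by end_near. Qed.

End clt.

(** * From cosines to bounded continuous test functions *)

Lemma Ex_bounded_cvg d (T : measurableType d) (R : realType)
  (P : probability T R) (f : nat -> T -> R) (g : T -> R) (B : R) :
  (forall n, measurable_fun setT (f n)) -> (forall n w, `|f n w| <= B) ->
  measurable_fun setT g ->
  {ae P, forall w, f n w @[n --> \oo] --> g w} ->
  \int[P]_w f n w @[n --> \oo] --> \int[P]_w g w.
Proof.
move=> mf fB mg fg.
have intB : P.-integrable setT (EFin \o cst B).
  by apply: bmf_integrable; exact: bmf_cst.
have := @dominated_convergence _ _ _ P setT measurableT
  (fun n w => (f n w)%:E) (fun w => (g w)%:E) (fun=> B%:E).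
move=> /(_ _ _ _ intB) [||||ig _ H].
- by move=> n; exact/measurable_EFinP.
- exact/measurable_EFinP.
- apply: filterS fg => w fgw _; apply: cvg_EFin => //; exact: nearW.
- by apply: aeW => w n _; rewrite lee_fin.
apply: fine_cvg; rewrite /Rintegral fineK//.
exact: integrable_fin_num.
Qed.

Lemma measurable_norm_gt (R : realType) (K : R) :
  measurable [set y : measurableTypeR R | K < `|y|].
Proof.
rewrite -[X in measurable X]setTI.
have mn : measurable_fun setT (fun y : R => `|y|) by exact: normr_measurable.
rewrite (_ : [set y | _] = (fun y : R => `|y|) @^-1` `]K, +oo[%classic); last first.
  by apply/seteqP; split=> y /=; rewrite in_itv/= andbT.
by apply: mn => //; exact: measurable_itv.
Qed.

Lemma probability_tail (R : realType) (mu : probability (measurableTypeR R) R)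
  (e : R) : 0 < e -> exists K0 : R, forall K, K0 <= K ->
    \int[mu]_x (\1_[set y : R | K < `|y|] x) <= e.
Proof.
move=> e0.
have H : \int[mu]_x (\1_[set y : R | n.+1%:R < `|y|] x) @[n --> \oo] --> \int[mu]_x 0.
  apply: (@Ex_bounded_cvg _ _ _ mu (fun n => \1_[set y : R | n.+1%:R < `|y|]) (fun=> 0) 1).
  - by move=> n; apply: measurable_indic; exact: (@measurable_norm_gt R).
  - by move=> n w; rewrite indicE; case: (_ \in _); rewrite ?normr1 ?normr0.
  - exact: measurable_cst.
  - apply: aeW => y; apply: cvg_near_cst.
    near=> n; rewrite indicE memNset//=; apply/negP; rewrite -leNgt.
    have : (Num.truncn `|y| <= n)%N by near: n; exact: nbhs_infty_ge.
    rewrite -ltnS => h; rewrite ltW// (lt_le_trans (truncnS_gt _))// ler_nat//.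
rewrite Ex_cst in H; have [n _ /(_ n (leqnn n)) h] := cvgr_le _ H _ e0.
exists n.+1%:R => K nK.
apply: le_trans h; apply: le_Ex; [by apply: bmf_indic; exact: (@measurable_norm_gt R)..|move=> y].
rewrite !indicE; have [/set_mem/= Ky|_] := boolP (y \in [set y0 | K < `|y0|]).
  by rewrite mem_set//= (le_lt_trans nK).
by case: (y \in _).
Unshelve. all: by end_near. Qed.

(** * Bernstein polynomials through binomial means *)

Section bernstein.
Context {R : realType}.
Implicit Types (phi psi : nat -> R) (y : R).

(* The expectation of [phi] under the binomial distribution with parameters
   [n] and [y]. *)
Fixpoint binomial_mean y n phi : R :=
  if n is n'.+1 then
    y * binomial_mean y n' (phi \o succn) + (1 - y) * binomial_mean y n' phi
  else phi 0.

Lemma binomial_mean_le y n phi psi : 0 <= y <= 1 ->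
  (forall k, (k <= n)%N -> phi k <= psi k) ->
  binomial_mean y n phi <= binomial_mean y n psi.
Proof.
move=> /andP[y0 y1]; elim: n phi psi => [|n IH] phi psi h /=; first exact: h.
rewrite lerD// ler_wpM2l ?subr_ge0// IH// => k kn; apply: h => //.
exact: ltnW.
Qed.

Lemma binomial_mean_affine y n phi (a b : R) :
  binomial_mean y n (fun k => a + b * phi k) = a + b * binomial_mean y n phi.
Proof.
elim: n phi => [//|n IH] phi /=.
by rewrite (IH (phi \o succn)) IH; ring.
Qed.

(** Binomial variance plus squared bias. The centre is arbitrary because conditioning on a success
    in the first trial replaces [c] by [c - 1]. *)
Lemma binomial_mean_sqr y n (c : R) :
  binomial_mean y n (fun k => (k%:R - c) ^+ 2) = n%:R * y * (1 - y) + (n%:R * y - c) ^+ 2.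
Proof.
elim: n c => [|n IH] c /=; first by ring.
have -> : (fun k => (k%:R - c) ^+ 2) \o succn = (fun k => (k%:R - (c - 1)) ^+ 2).
  by apply/funext => k /=; rewrite -natr1; ring.
by rewrite !IH -natr1; ring.
Qed.

(** Only [x] is confined to the segment. Compactness is used in its near-covering form, which yields
    a common [del] at once. *)
Lemma compact_continuous_modulus (g : R -> R) (a b e : R) : continuous g -> 0 < e ->
  exists2 del : R, 0 < del &
    forall x z, a <= x <= b -> `|z - x| < del -> `|g z - g x| < e.
Proof.
move=> cg e0.
have e20 : 0 < e / 2 by rewrite divr_gt0.
have := @segment_compact R a b; rewrite compact_near_coveringP => NC.
pose PP (del y : R) := forall z, `|z - y| < del -> `|g z - g y| < e.
have H : \forall del \near 0^'+, `[a, b]%classic `<=` PP del.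
  apply: NC => x _.
  have /cvgrPdist_lt/(_ _ e20) := cg x.
  rewrite -near_nbhs nearE => /nbhs_ballP[r /= r0 Hr].
  have r20 : 0 < r / 2 by rewrite divr_gt0.
  exists (ball x (r / 2), [set del | del < r / 2]) => /=.
    split; first exact: nbhsx_ballx.
    exact: nbhs_right_lt.
  case=> y del /= [xy dr] z zy.
  have yr : ball x r y by apply: le_ball xy; lra.
  have zr : ball x r z.
    move: xy; rewrite /ball/= => xy; rewrite -(subrKA y) (le_lt_trans (ler_normD _ _))//.
    by rewrite (splitr r) ltrD// distrC (lt_trans zy).
  rewrite -(subrKA (g x)) (le_lt_trans (ler_normD _ _))// (splitr e) ltrD//.
    by rewrite distrC; exact: Hr.
  exact: Hr.
near (0 : R)^'+ => del; exists del; first by [].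
near: del; move: H; apply: filterS => del h x z axb; apply: h.
by rewrite /= in_itv.
Unshelve. all: by end_near. Qed.

(** Chebyshev's argument made pointwise: the difference of [g] at k / n and at y is below e / 2 when
    the two points are close, and otherwise below [2 * M], hence below a multiple of (k / n - y)^2,
    whose binomial mean is y (1 - y) / n. *)
Lemma bernstein_approx (g : R -> R) (M e : R) : continuous g ->
  (forall y, `|g y| <= M) -> 0 < e ->
  exists n, forall y, 0 <= y <= 1 ->
    `|binomial_mean y n (fun k => g (k%:R / n%:R)) - g y| <= e.
Proof.
move=> cg gM e0.
have M0 : 0 <= M by exact: le_trans (gM 0).
have e20 : 0 < e / 2 by rewrite divr_gt0.
have [del del0 Hdel] := compact_continuous_modulus 0 1 cg e20.
pose C := 2 * M / del ^+ 2.
have C0 : 0 <= C by rewrite divr_ge0 ?sqr_ge0 ?mulr_ge0.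
pose n := (Num.truncn (C / (e / 2))).+1.
have n0 : 0 < n%:R :> R by rewrite ltr0n.
have Cn : C / n%:R <= e / 2.
  by rewrite ler_pdivrMr// mulrC -ler_pdivrMr// ltW// truncnS_gt.
exists n => y y01.
have key k : `|g (k%:R / n%:R) - g y| <= e / 2 + C / n%:R ^+ 2 * (k%:R - n%:R * y) ^+ 2.
  have -> : C / n%:R ^+ 2 * (k%:R - n%:R * y) ^+ 2 = C * (k%:R / n%:R - y) ^+ 2.
    by field; rewrite gt_eqF.
  have [near_|far] := ltP `|k%:R / n%:R - y| del.
    apply: (le_trans (ltW (Hdel _ _ y01 near_))).
    by rewrite lerDl mulr_ge0 ?sqr_ge0.
  rewrite -[leLHS]add0r lerD ?(ltW e20)//.
  apply: (@le_trans _ _ (2 * M)).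
    by rewrite (le_trans (ler_normB _ _))// [2 * M]mulr_natl mulr2n lerD.
  rewrite /C -[leLHS]mulr1 -[leRHS]mulrA ler_wpM2l ?mulr_ge0//.
  rewrite mulrC ler_pdivlMr ?exprn_gt0// mul1r -(real_normK (num_real (_ - y))).
  by rewrite lerXn2r ?nnegrE// ltW.
pose psi k := e / 2 + C / n%:R ^+ 2 * (k%:R - n%:R * y) ^+ 2.
have psiE : binomial_mean y n psi <= e.
  have -> : binomial_mean y n psi = e / 2 + C / n%:R * (y * (1 - y)).
    rewrite /psi.
    rewrite (binomial_mean_affine y n (fun k => (k%:R - n%:R * y) ^+ 2) (e / 2)).
    by rewrite binomial_mean_sqr; field; rewrite gt_eqF.
  have /andP[y0 y1] := y01.
  have : C / n%:R * (y * (1 - y)) <= e / 2 * 1.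
    apply: ler_pM => //; first by rewrite divr_ge0.
      by rewrite mulr_ge0// subr_ge0.
    by rewrite -[leRHS]mulr1 ler_pM ?subr_ge0// lerBlDr lerDl.
  lra.
have E : binomial_mean y n (fun k => g (k%:R / n%:R)) - g y =
    binomial_mean y n (fun k => - g y + 1 * g (k%:R / n%:R)).
  by rewrite (binomial_mean_affine y n (fun k => g (k%:R / n%:R))); ring.
rewrite E ler_norml; apply/andP; split.
  rewrite lerNl -[leLHS]mulN1r -[leLHS]add0r -binomial_mean_affine (le_trans _ psiE)// binomial_mean_le// => k _.
  rewrite (le_trans _ (key k))// -normrN (le_trans _ (ler_norm _))//.
  by rewrite le_eqVlt; apply/orP; left; apply/eqP; ring.
rewrite (le_trans _ psiE)// binomial_mean_le// => k _.
rewrite (le_trans _ (key k))// (le_trans _ (ler_norm _))//.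
by rewrite le_eqVlt; apply/orP; left; apply/eqP; ring.
Qed.

End bernstein.

(** * Convergence in distribution from cosine transforms *)

Section levy.
Context d (T : measurableType d) (R : realType) (P : probability T R).
Variables (Z : nat -> T -> R) (mu : probability (measurableTypeR R) R) (C : R).
Hypothesis bZ : forall n, bounded_measurable (Z n).
Hypothesis Z2 : forall n, \int[P]_w (Z n w ^+ 2) <= C.
Hypothesis cosZ : forall t b : R,
  (fun n => \int[P]_w cos (t * Z n w + b)) @ \oo --> \int[mu]_x cos (t * x + b).

Local Notation bmfR := (@bounded_measurable _ (measurableTypeR R) R).

Let mZ n : measurable_fun setT (Z n). Proof. by have [] := bZ n. Qed.

Let bcosZ (t b : R) n : bounded_measurable (fun w => cos (t * Z n w + b)).
Proof.
by apply: bmf_cos; apply: measurable_funD => //; exact: measurable_funM.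
Qed.

Let bcos (t b : R) : bmfR (fun x => cos (t * x + b)).
Proof.
by apply: bmf_cos; apply: measurable_funD => //; exact: measurable_funM.
Qed.

Let bsin (t : R) : bmfR (fun x => sin (t * x)).
Proof. by apply: bmf_sin; exact: measurable_funM. Qed.

(** A cosine with free frequency and phase is kept as a factor, so that multiplication by a sine
    stays in the class: the product formula only changes [t] and [b]. At [t = b = 0] the factor
    disappears. *)
Let trig_cvg (h : R -> R) := bmfR h /\ forall t b : R,
  (fun n => \int[P]_w (cos (t * Z n w + b) * h (Z n w))) @ \oo -->
    \int[mu]_x (cos (t * x + b) * h x).

Let bhZ h n : bmfR h -> bounded_measurable (fun w => h (Z n w)).
Proof. by move=> bh; exact: bmf_comp. Qed.

Let trig_cvg_cst (c : R) : trig_cvg (fun=> c).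
Proof.
split=> [|t b]; first exact: bmf_cst.
have E d' (T' : measurableType d') (Q : probability T' R) (f : T' -> R) :
    bounded_measurable f -> \int[Q]_w (f w * c) = c * \int[Q]_w f w.
  by move=> bf; rewrite -ExZ//; apply: eq_Ex => w; rewrite mulrC.
under eq_fun do rewrite E//.
by rewrite E//; apply: cvgM => //; exact: cvg_cst.
Qed.

Let trig_cvg_lin (a1 a2 : R) h1 h2 : trig_cvg h1 -> trig_cvg h2 ->
  trig_cvg (fun x => a1 * h1 x + a2 * h2 x).
Proof.
move=> [b1 c1] [b2 c2]; split=> [|t b].
  by apply: bmfD; apply: bmfM => //; exact: bmf_cst.
have E d' (T' : measurableType d') (Q : probability T' R) (f g1 g2 : T' -> R) :
    bounded_measurable f -> bounded_measurable g1 -> bounded_measurable g2 ->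
    \int[Q]_w (f w * (a1 * g1 w + a2 * g2 w)) =
    a1 * \int[Q]_w (f w * g1 w) + a2 * \int[Q]_w (f w * g2 w).
  move=> bf bg1 bg2; rewrite -!ExZ; [|by bmf|by bmf].
  by rewrite -ExD; [apply: eq_Ex => w; ring|by bmf|by bmf].
have E1 n : \int[P]_w (cos (t * Z n w + b) * (a1 * h1 (Z n w) + a2 * h2 (Z n w))) =
    a1 * \int[P]_w (cos (t * Z n w + b) * h1 (Z n w)) +
    a2 * \int[P]_w (cos (t * Z n w + b) * h2 (Z n w)).
  by rewrite E//; exact: bhZ.
under eq_fun do rewrite E1.
rewrite E//; apply: cvgD; apply: cvgM => //; exact: cvg_cst.
Qed.

Let cosM_sin (t b w x : R) : cos (t * x + b) * sin (w * x) =
  2^-1 * cos ((t + w) * x + (b - pi / 2)) + (- 2^-1) * cos ((t - w) * x + (b - pi / 2)).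
Proof.
rewrite !addrA !cosBpihalf.
rewrite (_ : (t + w) * x + b = (t * x + b) + w * x); last by ring.
rewrite (_ : (t - w) * x + b = (t * x + b) - w * x); last by ring.
by rewrite sinB sinD; field.
Qed.

Let trig_cvg_sin (w : R) h : trig_cvg h -> trig_cvg (fun x => sin (w * x) * h x).
Proof.
move=> [bh ch]; split=> [|t b]; first by bmf.
have E d' (T' : measurableType d') (Q : probability T' R) (f g : T' -> R) :
    measurable_fun setT f -> bounded_measurable g ->
    \int[Q]_u (cos (t * f u + b) * (sin (w * f u) * g u)) =
    2^-1 * \int[Q]_u (cos ((t + w) * f u + (b - pi / 2)) * g u) +
    (- 2^-1) * \int[Q]_u (cos ((t - w) * f u + (b - pi / 2)) * g u).
  move=> mf bg.
  have bc (t' b' : R) : bounded_measurable (fun u => cos (t' * f u + b')).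
    by apply: bmf_cos; apply: measurable_funD => //; exact: measurable_funM.
  rewrite -!ExZ; [|by bmf|by bmf].
  by rewrite -ExD; [apply: eq_Ex => u; rewrite mulrA cosM_sin; ring|by bmf|by bmf].
have E1 n : \int[P]_u (cos (t * Z n u + b) * (sin (w * Z n u) * h (Z n u))) =
    2^-1 * \int[P]_u (cos ((t + w) * Z n u + (b - pi / 2)) * h (Z n u)) +
    (- 2^-1) * \int[P]_u (cos ((t - w) * Z n u + (b - pi / 2)) * h (Z n u)).
  by rewrite (E _ _ _ (Z n) (h \o Z n))//; exact: bhZ.
under eq_fun do rewrite E1.
rewrite (E _ _ mu id h)//; apply: cvgD; apply: cvgM; try exact: cvg_cst; exact: ch.
Qed.

(** The recursion of [binomial_mean] needs only linear combinations and products with (1 + sin (w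
    x)) / 2. *)
Let trig_cvg_bernstein (w : R) n (phi : nat -> R) :
  trig_cvg (fun x => binomial_mean ((1 + sin (w * x)) / 2) n phi).
Proof.
elim: n phi => [|n IH] phi /=; first exact: trig_cvg_cst.
have h1 := IH (phi \o succn); have h2 := IH phi.
have := trig_cvg_lin 1 1
  (trig_cvg_lin 2^-1 2^-1 h1 (trig_cvg_sin w h1))
  (trig_cvg_lin 2^-1 (- 2^-1) h2 (trig_cvg_sin w h2)).
by congr trig_cvg; apply/funext => x; field.
Qed.

Lemma levy (f : R -> R) (M : R) : continuous f -> (forall x, `|f x| <= M) ->
  \int[P]_w f (Z n w) @[n --> \oo] --> \int[mu]_x f x.
Proof.
move=> cf fM.
have bf : bmfR f by split; [exact: continuous_measurable_fun|exists M].
have M0 : 0 <= M := le_trans (normr_ge0 _) (fM 0).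
have C0 : 0 <= C.
  by apply: le_trans (Z2 0); apply: Rintegral_ge0 => w _; exact: sqr_ge0.
apply/cvgrPdist_le => eps eps0.
(* Both laws contribute [e] from the approximation and [2 * M * e] from the tail, a quarter of [eps]
   each. *)
pose e := eps / (4 * (1 + 2 * M)).
have D0 : 0 < 4 * (1 + 2 * M) by lra.
have e0 : 0 < e by rewrite divr_gt0.
have [K0 HK0] := probability_tail mu e0.
(* [K0] controls the tail of the limit. [C / e] controls the tails of all [Z n] by Chebyshev's
   inequality, where [1 <= K] allows the passage from [K] to [K ^+ 2]. *)
pose K := Num.max K0 (C / e + 1).
have K1 : 1 <= K by rewrite le_max; apply/orP; right; rewrite lerDr divr_ge0// ltW.
have K_gt0 : 0 < K by exact: lt_le_trans K1.
have CK : C / K ^+ 2 <= e.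
  rewrite ler_pdivrMr ?exprn_gt0//.
  have : C / e <= K by rewrite le_max; apply/orP; right; rewrite lerDl.
  rewrite ler_pdivrMr// => h; apply: (le_trans h); rewrite mulrC ler_wpM2l ?(ltW e0)//.
  by rewrite expr2 ler_peMl// ltW.
pose s1 : R := sin 1.
have pi2 : 1 < pi / 2 :> R.
  rewrite lt_neqAle pihalf_ge1 andbT; apply/eqP => h.
  by have := cos1_gt0 R; rewrite h cos_pihalf ltxx.
(* On the interval of radius [K], sin (x / K) stays between - sin 1 and sin 1. Clipping to this
   range, strictly inside the domain of [asin] because 1 < pi / 2, makes [g] continuous on the whole
   line. *)
pose clip (u : R) := Num.max (- s1) (Num.min s1 u).
have s1_gt0 : 0 < s1 by apply: sin_gt0_pi; apply/andP; split=> //; lra.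
have s1_lt1 : s1 < 1.
  rewrite -(sin_pihalf R) ltr_sin// in_itv/=; apply/andP; split; lra.
have clip_itv u : - s1 <= clip u <= s1.
  by rewrite le_max lexx/= ge_max ge_min lexx/= andbT; lra.
have clip_id u : `|u| <= s1 -> clip u = u.
  by rewrite ler_norml => /andP[h1 h2]; rewrite /clip min_r// max_r.
have cclip : continuous clip.
  move=> u; apply: (@continuous_max _ _ (cst (- s1)) (fun u => Num.min s1 u)) => //.
    exact: cvg_cst.
  by apply: continuous_min => //; exact: cvg_cst.
(* Built so that [g] at (1 + sin (x / K)) / 2 equals [f x] when [|x| <= K]: a polynomial close to
   [g] on [0, 1] then becomes one in sin (x / K) close to [f]. *)
pose g (y : R) := f (K * asin (clip (2 * y - 1))).
have c1 : continuous (fun y : R => 2 * y - 1).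
  by move=> y; apply: cvgB; [apply: cvgM => //; exact: cvg_cst|exact: cvg_cst].
have c2 : continuous (asin \o (clip \o (fun y : R => 2 * y - 1))).
  move=> y; apply: continuous_comp; first by apply: continuous_comp; [exact: c1|exact: cclip].
  apply: continuous_asin => /=.
  by have := clip_itv (2 * y - 1); lra.
have cg : continuous g.
  have -> : g = f \o (fun z => K * z) \o (asin \o (clip \o (fun y : R => 2 * y - 1))) by [].
  move=> y; apply: continuous_comp; first exact: c2.
  apply: continuous_comp; last exact: cf.
  by apply: cvgM => //; exact: cvg_cst.
have gM y : `|g y| <= M by exact: fM.
have [n Hn] := bernstein_approx cg gM e0.
pose p (x : R) := binomial_mean ((1 + sin (K^-1 * x)) / 2) n (fun k => g (k%:R / n%:R)).
have [bp cp] := trig_cvg_bernstein K^-1 n (fun k => g (k%:R / n%:R)).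
rewrite -/p in bp cp.
have pf x : `|p x - f x| <= e + 2 * M * \1_[set y : R | K < `|y|] x.
  have sx01 : 0 <= (1 + sin (K^-1 * x)) / 2 <= 1.
    by have := sin_max (K^-1 * x); rewrite ler_norml; lra.
  have h := Hn _ sx01; rewrite -/(p x) in h.
  rewrite indicE; have [/set_mem/= Kx|] := boolP (x \in _).
    rewrite mulr1 -(subrKA (g ((1 + sin (K^-1 * x)) / 2))) (le_trans (ler_normD _ _))//.
    by rewrite lerD// (le_trans (ler_normB _ _))// [2 * M]mulr_natl mulr2n lerD.
  rewrite notin_setE/= => /negP; rewrite -leNgt => xK.
  have gx : g ((1 + sin (K^-1 * x)) / 2) = f x.
    rewrite /g (_ : 2 * ((1 + sin (K^-1 * x)) / 2) - 1 = sin (K^-1 * x)); last by field.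
    have Kx1 : `|K^-1 * x| <= 1.
      by rewrite normrM normfV (gtr0_norm K_gt0) mulrC ler_pdivrMr// mul1r.
    move: Kx1; rewrite ler_norml => /andP[Kx1 Kx2].
    rewrite clip_id; last first.
      rewrite ler_norml -sinN !leNgt !ltr_sin ?in_itv/=; lra.
    by rewrite sinK ?in_itv/= ?mulVKf ?gt_eqF//; lra.
  by rewrite mulr0 addr0 -gx.
have bind : bmfR \1_[set y : R | K < `|y|].
  by apply: bmf_indic; exact: measurable_norm_gt.
have fin d' (T' : measurableType d') (Q : probability T' R) (h : T' -> R) :
    measurable_fun setT h -> \int[Q]_w (\1_[set y : R | K < `|y|] (h w)) <= e ->
    `|\int[Q]_w p (h w) - \int[Q]_w f (h w)| <= e + 2 * M * e.
  move=> mh tl.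
  have bph : bounded_measurable (fun w => p (h w)) by exact: (@bmf_comp _ _ _ (measurableTypeR R) _ p h).
  have bfh : bounded_measurable (fun w => f (h w)) by exact: (@bmf_comp _ _ _ (measurableTypeR R) _ f h).
  have bih : bounded_measurable (fun w => \1_[set y : R | K < `|y|] (h w) : R).
    exact: (bmf_comp bind mh).
  rewrite -ExB//.
  apply: (@le_trans _ _ (\int[Q]_w (e + 2 * M * \1_[set y : R | K < `|y|] (h w)))).
    by apply: norm_Ex_le; [by bmf|by bmf|move=> w; exact: pf].
  rewrite ExD; [|by bmf|by bmf].
  by rewrite Ex_cst ExZ// lerD// ler_wpM2l// mulr_ge0.
have h1 n' : `|\int[P]_w p (Z n' w) - \int[P]_w f (Z n' w)| <= e + 2 * M * e.
  apply: fin => //; apply: le_trans CK.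
  have K2 : 0 < K ^+ 2 by rewrite exprn_gt0.
  rewrite ler_pdivlMr// mulrC -ExZ; last exact: (bmf_comp bind (mZ n')).
  apply: le_trans (Z2 n'); apply: le_Ex.
  - apply: bmfM; first exact: bmf_cst.
    exact: (bmf_comp bind (mZ n')).
  - by bmf.
  move=> w; rewrite indicE; have [/set_mem/= Kw|_] := boolP (_ \in _).
    by rewrite mulr1 -(real_normK (num_real (Z _ _))) lerXn2r ?nnegrE// ltW.
  by rewrite mulr0 sqr_ge0.
have h2 : `|\int[mu]_x p x - \int[mu]_x f x| <= e + 2 * M * e.
  by apply: (fin _ _ mu id) => //; apply: HK0; rewrite le_max lexx.
have h3 : (fun n => \int[P]_w p (Z n w)) @ \oo --> \int[mu]_x p x.
  have := cp 0 0.
  have E d' (T' : measurableType d') (Q : probability T' R) (h z : T' -> R) :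
    \int[Q]_w (cos (0 * z w + 0) * h w) = \int[Q]_w h w.
    by apply: eq_Ex => w; rewrite mul0r addr0 cos0 mul1r.
  under eq_fun do rewrite (E _ _ P (p \o Z _)).
  by rewrite (E _ _ mu p).
have e4 : 0 < eps / 2 by rewrite divr_gt0.
move/cvgrPdist_le : h3 => /(_ _ e4); apply: filterS => k hk.
have -> : \int[mu]_x f x - \int[P]_w f (Z k w) =
  - (\int[mu]_x p x - \int[mu]_x f x) + (\int[mu]_x p x - \int[P]_w p (Z k w))
  + (\int[P]_w p (Z k w) - \int[P]_w f (Z k w)) by ring.
have ee : (e + 2 * M * e) * 2 = eps / 2.
  by rewrite /e; field; rewrite gt_eqF//; lra.
have := h1 k; have := ler_normD (- (\int[mu]_x p x - \int[mu]_x f x)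
   + (\int[mu]_x p x - \int[P]_w p (Z k w))) (\int[P]_w p (Z k w) - \int[P]_w f (Z k w)).
have := ler_normD (- (\int[mu]_x p x - \int[mu]_x f x)) (\int[mu]_x p x - \int[P]_w p (Z k w)).
rewrite normrN; lra.
Qed.

End levy.

(** * The characteristic function of the normal law *)

Section normal.
Context {R : realType}.
Variable sigma : R.
Hypothesis sigma0 : sigma != 0.
Local Notation leb := (@lebesgue_measure R).
Local Notation phi := (normal_pdf 0 sigma).

(** The Radon-Nikodym derivative of the normal law with respect to Lebesgue measure is almost
    everywhere equal to [phi]. *)
Lemma Rintegral_normal_prob (f : R -> R) :
  @bounded_measurable _ (measurableTypeR R) R f ->
  \int[normal_prob 0 sigma]_x f x = \int[leb]_x (f x * phi x).
Proof.
move=> bf; congr fine; have [mf _] := bf.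
have intf := bmf_integrable (normal_prob 0 sigma) bf.
rewrite -(Radon_Nikodym_change_of_variables (normal_prob_dominates 0 sigma))//=.
transitivity (\int[leb]_x ((f x)%:E * (phi x)%:E))%E; last first.
  by apply: eq_integral => x _; rewrite EFinM.
apply: ae_eq_integral => //.
- apply: emeasurable_funM => //; first exact/measurable_EFinP.
  apply: (measurable_int leb).
  by apply: Radon_Nikodym_integrable; exact: normal_prob_dominates.
- apply: emeasurable_funM => //=; first exact/measurable_EFinP.
  by apply/measurable_EFinP; exact: measurable_normal_pdf.
- apply: ae_eqe_mul2l => /=.
  rewrite Radon_NikodymE//=; first exact: normal_prob_dominates.
  move=> dom; case: cid => /= h [h1 h2 h3].
  apply: integral_ae_eq => //=.
    by apply/measurable_EFinP; exact: measurable_normal_pdf.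
  by move=> E _ mE; rewrite -h3.
Qed.

Lemma phiE (x : R) : phi x = normal_peak sigma * expR (- x ^+ 2 / (sigma ^+ 2 *+ 2)).
Proof. by rewrite normal_pdfE// /normal_fun subr0. Qed.

Let s2 : 0 < sigma ^+ 2. Proof. by rewrite exprn_even_gt0. Qed.

Lemma is_derive_phi (x : R) : is_derive x 1 phi (- (x / sigma ^+ 2) * phi x).
Proof.
have -> : phi = (fun x => normal_peak sigma * expR (- x ^+ 2 / (sigma ^+ 2 *+ 2))).
  by apply/funext => y; exact: phiE.
apply: is_derive_eq; rewrite /GRing.scale/= -mulr_natr.
by field; rewrite sigma0.
Qed.

Let mphi : measurable_fun setT phi. Proof. exact: measurable_normal_pdf. Qed.
Let phi_ge0 x : 0 <= phi x. Proof. exact: normal_pdf_ge0. Qed.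

Let integrable_phi_bounded (f : R -> R) (B : R) : measurable_fun setT f ->
  (forall x, `|f x| <= B) -> leb.-integrable setT (EFin \o (fun x => f x * phi x)).
Proof.
move=> mf fB.
have mh : measurable_fun setT (fun x => f x * phi x) by exact: measurable_funM.
apply: (@le_integrable _ _ _ leb setT measurableT _ (fun x => B%:E * (phi x)%:E)%E).
- exact/measurable_EFinP.
- move=> x _ /=; rewrite lee_fin normrM normrM (ger0_norm (phi_ge0 x)).
  by rewrite ler_wpM2r// (le_trans (fB x))// ler_norm.
- by apply: integrableZl => //; exact: integrable_normal_pdf.
Qed.

(** Domination by a multiple of the normal density with doubled variance: with y = x^2 / (4
    sigma^2), [phi] is proportional to exp (- y)^2; one factor is kept and the other absorbs
    [|x|]. *)
Let integrable_phi1 : leb.-integrable setT (EFin \o (fun x => `|x| * phi x)).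
Proof.
pose s' := Num.sqrt 2 * sigma.
have s'0 : s' != 0 by rewrite mulf_neq0// gt_eqF// sqrtr_gt0.
have s'2 : s' ^+ 2 = 2 * sigma ^+ 2 by rewrite exprMn sqr_sqrtr.
pose K := normal_peak sigma / normal_peak s' * (1 + 4 * sigma ^+ 2).
have pk (s : R) : s != 0 -> 0 < normal_peak s by exact: normal_peak_gt0.
apply: (@le_integrable _ _ _ leb setT measurableT _ (fun x => K%:E * (normal_pdf 0 s' x)%:E)%E).
- by apply/measurable_EFinP; apply: measurable_funM => //; exact: normr_measurable.
- move=> x _ /=; rewrite lee_fin [leRHS]ger0_norm; last first.
    by rewrite !mulr_ge0 ?invr_ge0 ?normal_peak_ge0 ?normal_pdf_ge0// addr_ge0// mulr_ge0// ltW.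
  rewrite ger0_norm ?mulr_ge0// phiE (normal_pdfE _ s'0) /normal_fun subr0.
  rewrite s'2 /K; set y := x ^+ 2 / (4 * sigma ^+ 2).
  have -> : - x ^+ 2 / (sigma ^+ 2 *+ 2) = - y - y.
    by rewrite /y -mulr_natr; field.
  have -> : - x ^+ 2 / (2 * sigma ^+ 2 *+ 2) = - y.
    by rewrite /y -mulr_natr; field.
  rewrite expRD.
  have h : `|x| * expR (- y) <= 1 + 4 * sigma ^+ 2.
    have y0 : 0 <= y by rewrite divr_ge0 ?sqr_ge0// mulr_ge0// ltW.
    have hx : `|x| <= 1 + x ^+ 2.
      rewrite -(real_normK (num_real x)).
      have := normr_ge0 x; move: (`|x|) => z z0; have := sqr_ge0 (z - 1); rewrite sqrrB1 => hz.
      rewrite -subr_ge0 in hz *; nra.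
    have xy : x ^+ 2 = 4 * sigma ^+ 2 * y by rewrite /y; field.
    rewrite expRN ler_pdivrMr ?expR_gt0//.
    have e1 : 1 + y <= expR y by exact: expR_ge1Dx.
    have e2 : 4 * sigma ^+ 2 * y <= 4 * sigma ^+ 2 * expR y.
      by apply: ler_wpM2l; [rewrite mulr_ge0// ltW|lra].
    by rewrite xy in hx; lra.
  have -> : normal_peak sigma / normal_peak s' * (1 + 4 * sigma ^+ 2) * (normal_peak s' * expR (- y))
    = normal_peak sigma * expR (- y) * (1 + 4 * sigma ^+ 2).
    by field; rewrite gt_eqF// pk.
  rewrite (_ : `|x| * _ = normal_peak sigma * expR (- y) * (`|x| * expR (- y))); last by ring.
  by rewrite ler_wpM2l// mulr_ge0 ?expR_ge0// ltW// pk.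
- by apply: integrableZl => //; exact: integrable_normal_pdf.
Qed.

Variable b : R.
Let psi (t : R) := \int[leb]_x (cos (t * x + b) * phi x).

Let mcos (t : R) : measurable_fun setT (fun x : R => cos (t * x + b)).
Proof.
by have [] := @bmf_cos _ (measurableTypeR R) R (fun x => t * x + b) _;
  [apply: measurable_funD => //; exact: measurable_funM|].
Qed.

Let msin (t : R) : measurable_fun setT (fun x : R => sin (t * x + b)).
Proof.
by have [] := @bmf_sin _ (measurableTypeR R) R (fun x => t * x + b) _;
  [apply: measurable_funD => //; exact: measurable_funM|].
Qed.

Let int_cos (t : R) : leb.-integrable setT (EFin \o (fun x => cos (t * x + b) * phi x)).
Proof. by apply: (@integrable_phi_bounded _ 1) => // x; exact: cos_max. Qed.

Let int_xsin (t : R) : leb.-integrable setT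
  (EFin \o (fun x => - x * sin (t * x + b) * phi x)).
Proof.
have mf : measurable_fun setT (fun x : R => - x * sin (t * x + b) * phi x).
  by apply: measurable_funM => //; apply: measurable_funM.
apply: le_integrable integrable_phi1 => //.
- exact/measurable_EFinP.
- move=> x _ /=; rewrite lee_fin !normrM normrN normr_id ler_wpM2r//.
  by rewrite -[leRHS]mulr1 ler_wpM2l// sin_max.
Qed.

Let partialE (t x : R) : is_derive t 1 (fun t => cos (t * x + b) * phi x)
  (- x * sin (t * x + b) * phi x).
Proof. by apply: is_derive_eq; rewrite /GRing.scale/=; ring. Qed.

(** Differentiation under the integral sign; the derivative of the integrand is dominated by
    [|x| * phi x], uniformly in [t]. *)
Let is_derive_psi (t : R) : is_derive t 1 psi (\int[leb]_x (- x * sin (t * x + b) * phi x)).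
Proof.
have It : `](t - 1), (t + 1)[%classic t by rewrite /= in_itv/=; lra.
have d1 u x : partial1of2 (fun u x => cos (u * x + b) * phi x) u x =
    - x * sin (u * x + b) * phi x.
  rewrite partial1of2E; exact: (@derive_val _ _ _ _ _ _ _ (partialE u x)).
have h1 : forall u : R, `](t - 1), (t + 1)[%classic u ->
    leb.-integrable setT (EFin \o (fun x => cos (u * x + b) * phi x)).
  by move=> u _; exact: int_cos.
have h2 : forall u x : R, `](t - 1), (t + 1)[%classic u -> [set: R] x ->
    derivable (fun u : R => cos (u * x + b) * phi x) u 1.
  by move=> u x _ _; exact: (@ex_derive _ _ _ _ _ _ _ (partialE u x)).
have h3 : forall u x : R, `](t - 1), (t + 1)[%classic u -> [set: R] x ->
    `|partial1of2 (fun u x => cos (u * x + b) * phi x) u x| <= `|x| * phi x.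
  move=> u x _ _; rewrite d1 !normrM normrN (ger0_norm (phi_ge0 x)) ler_wpM2r//.
  by rewrite -[leRHS]mulr1 ler_wpM2l// sin_max.
have h0 : forall x : R, 0 <= `|x| * phi x by move=> x; rewrite mulr_ge0.
apply: DeriveDef.
  exact: (derivable_under_integral measurableT It h1 h2 h0 integrable_phi1 h3).
rewrite -derive1E (differentiation_under_integral measurableT It h1 h2 h0 integrable_phi1 h3).
by apply: eq_Rintegral => x _; rewrite d1.
Qed.


Let F (t x : R) := sin (t * x + b) * phi x.
Let F' (t x : R) := t * (cos (t * x + b) * phi x)
  + (sigma ^+ 2)^-1 * (- x * sin (t * x + b) * phi x).

Let is_derive_F t (x : R) : is_derive x 1 (F t) (F' t x).
Proof.
have h := is_derive_phi x.
by apply: is_derive_eq; rewrite /GRing.scale/= /F'; ring.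
Qed.

Let int_F' t : leb.-integrable setT (EFin \o F' t).
Proof.
rewrite (_ : EFin \o F' t = (fun x => t%:E * (cos (t * x + b) * phi x)%:E
  + ((sigma ^+ 2)^-1)%:E * (- x * sin (t * x + b) * phi x)%:E)%E)//.
apply: integrableD => //.
- by apply: integrableZl => //; exact: int_cos.
- by apply: integrableZl => //; exact: int_xsin.
Qed.

Let continuous_phi : continuous phi. Proof. exact: continuous_normal_pdf. Qed.

Let continuous_F' t : continuous (F' t).
Proof.
have ct : continuous (fun x : R => t * x + b).
  by move=> x; apply: cvgD; [apply: cvgM => //; exact: cvg_cst|exact: cvg_cst].
have cc : continuous (fun x : R => cos (t * x + b)).
  by move=> x; apply: (continuous_comp (ct x)); exact: continuous_cos.
have cs : continuous (fun x : R => sin (t * x + b)).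
  by move=> x; apply: (continuous_comp (ct x)); exact: continuous_sin.
move=> x; apply: cvgD; apply: cvgM; try exact: cvg_cst; apply: cvgM; last 2 first.
- exact: cvgM (cvgN cvg_id) (cs x).
- exact: continuous_phi.
- exact: cc.
- exact: continuous_phi.
Qed.

(** The end points use [n.+1] so that the interval never reduces to a point. *)
Let FTC_F t (n : nat) :
  \int[leb]_(x in `[- n.+1%:R, n.+1%:R]) (F' t x) = F t n.+1%:R - F t (- n.+1%:R).
Proof.
rewrite /Rintegral (@continuous_FTC2 _ (F' t) (F t))//.
- by have n0 : 0 < n.+1%:R :> R by []; lra.
- exact/continuous_subspaceT/continuous_F'.
- have cF : continuous (F t).
    move=> x; apply: differentiable_continuous; apply/derivable1_diffP.
    exact: (@ex_derive _ _ _ _ _ _ _ (is_derive_F t x)).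
  split.
  + by move=> x _; exact: (@ex_derive _ _ _ _ _ _ _ (is_derive_F t x)).
  + exact/cvg_at_right_filter/cF.
  + exact/cvg_at_left_filter/cF.
- by move=> x _; rewrite derive1E; exact: (@derive_val _ _ _ _ _ _ _ (is_derive_F t x)).
Qed.

Let phi_cvg0 : phi n.+1%:R @[n --> \oo] --> 0.
Proof.
apply: (@squeeze_cvgr _ _ _ _ (cst 0) (fun n => normal_peak sigma * (2 * sigma ^+ 2) * harmonic n)).
- apply: nearW => n; rewrite phi_ge0/= phiE -mulrA ler_wpM2l ?normal_peak_ge0//.
  set y := n.+1%:R ^+ 2 / (sigma ^+ 2 *+ 2).
  have yE : y = n.+1%:R ^+ 2 / (2 * sigma ^+ 2) by rewrite /y -[sigma ^+ 2 *+ 2]mulr_natl.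
  have n1 : 1 <= n.+1%:R :> R by rewrite ler1n.
  have s20 : 0 < 2 * sigma ^+ 2 by rewrite mulr_gt0.
  have y1 : n.+1%:R / (2 * sigma ^+ 2) <= y.
    by rewrite yE ler_pM2r ?invr_gt0// expr2 ler_peMl// ler0n.
  have ye : 1 + y <= expR y by exact: expR_ge1Dx.
  have y0 : 0 < n.+1%:R / (2 * sigma ^+ 2) by rewrite divr_gt0.
  have -> : 2 * sigma ^+ 2 * harmonic n = (n.+1%:R / (2 * sigma ^+ 2))^-1.
    by rewrite /harmonic invf_div.
  rewrite mulNr -/y expRN lef_pV2 ?posrE ?expR_gt0//; lra.
- exact: cvg_cst.
- rewrite -[X in _ --> X](mulr0 (normal_peak sigma * (2 * sigma ^+ 2))).
  by apply: cvgM; [exact: cvg_cst|exact: cvg_harmonic].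
Qed.

Let F_cvg0 t : F t n.+1%:R - F t (- n.+1%:R) @[n --> \oo] --> 0.
Proof.
apply: norm_cvg0.
apply: (@squeeze_cvgr _ _ _ _ (cst 0) (fun n => 2 * phi n.+1%:R)).
- apply: nearW => n; rewrite normr_ge0/= (le_trans (ler_normB _ _))//.
  rewrite mulr_natl mulr2n lerD//.
    by rewrite /F normrM (ger0_norm (phi_ge0 _)) ler_piMl// sin_max.
  rewrite /F normrM (ger0_norm (phi_ge0 _)) [X in _ * X]phiE sqrrN -phiE.
  by rewrite ler_piMl// sin_max.
- exact: cvg_cst.
- rewrite -[X in _ --> X](mulr0 2).
  by apply: cvgM; [exact: cvg_cst|exact: phi_cvg0].
Qed.

Let Rintegral_cvg (f : R -> R) : leb.-integrable setT (EFin \o f) ->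
  \int[leb]_(x in `[- n.+1%:R, n.+1%:R]) (f x) @[n --> \oo] --> \int[leb]_x f x.
Proof.
move=> intf; have mf := measurable_int leb intf.
apply: fine_cvg; rewrite fineK; last exact: integrable_fin_num.
have E (n : nat) : (\int[leb]_(x in `[(- n.+1%:R)%R, n.+1%:R%R]) (f x)%:E =
    \int[leb]_x (((EFin \o f) \_ `[(- n.+1%:R)%R, n.+1%:R%R]) x))%E.
  by rewrite integral_mkcond.
under eq_fun do rewrite E.
apply: (@dominated_cvg _ _ _ leb setT measurableT _ _ (fun x => `|(f x)%:E|)%E).
- move=> n; apply/(measurable_restrictT (EFin \o f)) => //.
  exact: measurable_funS mf.
- move=> x _; apply: cvg_near_cst; near=> n.
  rewrite patchE mem_set//= in_itv/=.
  have h : `|x| <= n.+1%:R.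
    have : (Num.truncn `|x| <= n)%N by near: n; exact: nbhs_infty_ge.
    by rewrite -ltnS => h; rewrite ltW// (lt_le_trans (truncnS_gt _))// ler_nat.
  by move: h; rewrite ler_norml.
- by move=> x _.
- exact: integrable_abse.
- move=> n x _; rewrite patchE; case: ifP => _ //.
  by rewrite abse0.
Unshelve. all: by end_near. Qed.

Let intZ (c : R) f : leb.-integrable setT (EFin \o f) ->
  leb.-integrable setT (EFin \o (fun x => c * f x)).
Proof. by move=> intf; exact: (integrableZl measurableT c intf). Qed.

(* The integral of [(sin (t x + b) phi(x))'] over the line vanishes. *)
Let stein (t : R) : \int[leb]_x (- x * sin (t * x + b) * phi x) = - (t * sigma ^+ 2) * psi t.
Proof.
have -> : \int[leb]_x (- x * sin (t * x + b) * phi x) =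
    sigma ^+ 2 * (\int[leb]_x F' t x - t * psi t).
  rewrite /F' RintegralD//; [|by apply: intZ; exact: int_cos|by apply: intZ; exact: int_xsin].
  rewrite (@RintegralZl _ _ _ leb setT (fun x => cos (t * x + b) * phi x) t)//.
  rewrite (@RintegralZl _ _ _ leb setT (fun x => - x * sin (t * x + b) * phi x))//.
  by rewrite -/(psi t) addrAC subrr add0r mulVKf// gt_eqF.
suff -> : \int[leb]_x F' t x = 0 by ring.
have h2 := Rintegral_cvg (int_F' t).
have h1 := F_cvg0 t.
have h3 : F t n.+1%:R - F t (- n.+1%:R) @[n --> \oo] --> \int[leb]_x F' t x.
  by move: h2; under eq_fun do rewrite FTC_F.
exact: (cvg_unique _ h3 h1).
Qed.

(** By [stein] the transform satisfies psi' = - t sigma^2 psi, so its product with exp (t^2 sigma^2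
    / 2) has derivative zero and equals its value at 0. *)
Lemma normal_cos t : \int[normal_prob 0 sigma]_x cos (t * x + b) =
  expR (- (t ^+ 2 * sigma ^+ 2 / 2)) * cos b.
Proof.
rewrite Rintegral_normal_prob; last first.
  by apply: bmf_cos; apply: measurable_funD => //; exact: measurable_funM.
rewrite -/(psi t).
have D (u : R) : is_derive u 1 (fun u : R => psi u * expR (u ^+ 2 * sigma ^+ 2 / 2)) 0.
  have := is_derive_psi u; rewrite stein => hpsi.
  by apply: is_derive_eq; rewrite /GRing.scale/=; field.
have [c _] := MVT_between D 0 t.
rewrite mul0r => /eqP; rewrite subr_eq0 expr0n/= !mul0r expR0 mulr1 => /eqP h.
have psi0 : psi 0 = cos b.
  rewrite /psi; under eq_Rintegral do rewrite mul0r add0r.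
  rewrite RintegralZl//; last exact: integrable_normal_pdf.
  by rewrite /Rintegral integral_normal_pdf/= mulr1.
by rewrite -psi0 -h mulrCA -expRD addNr expR0 mulr1.
Qed.

End normal.

(** * Decay of correlations given the past *)

Section integrable_times_bounded.
Context d (T : measurableType d) (R : realType) (P : probability T R).

Lemma integrableM_bmf (Z W : T -> R) : bounded_measurable Z ->
  P.-integrable setT (EFin \o W) ->
  P.-integrable setT (EFin \o (fun w => Z w * W w)).
Proof.
move=> [mZ [B ZB]] iW; have mW := measurable_int P iW.
have mW' : measurable_fun setT W by exact/measurable_EFinP.
apply: (@le_integrable _ _ _ P setT measurableT _ (fun w => (B%:E * `|(W w)%:E|)%E)).
- by apply/measurable_EFinP; exact: measurable_funM.
- move=> w _ /=; rewrite lee_fin !normrM normr_id ler_wpM2r//.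
  by rewrite (le_trans (ZB w))// ler_norm.
- apply: integrableZl => //; exact: integrable_abse.
Qed.

(* A bounded function measurable for the sub-sigma-algebra generated by [G] is
   the uniform limit of [N^-1 * floor (N * Z)], a finite combination of
   indicators of superlevel sets. *)
Lemma Rintegral_orthogonal (G : set (set T)) (Z W : T -> R) (B : R) :
  <<s G >> `<=` measurable ->
  measurable_fun setT (Z : g_sigma_algebraType G -> R) ->
  (forall w, `|Z w| <= B) -> P.-integrable setT (EFin \o W) ->
  (forall A, <<s G >> A -> \int[P]_(w in A) W w = 0) ->
  \int[P]_w (Z w * W w) = 0.
Proof.
move=> GM mZ ZB iW W0.
have mGZ (U : set R) : measurable U -> <<s G >> (Z @^-1` U).
  by move=> mU; have := mZ measurableT U mU; rewrite setTI.
have mZT : measurable_fun setT Z.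
  by move=> _ U mU; rewrite setTI; apply: GM; exact: mGZ.
have bZ : bounded_measurable Z by split=> //; exists B.
(* Adding [B] makes the function nonnegative, so that its integer part counts the superlevel sets
   that contain the point. *)
pose A N j : set T := [set w | (j.+1%:R <= N%:R * (Z w + B))].
have GA N j : <<s G >> (A N j).
  have -> : A N j = Z @^-1` [set z | j.+1%:R <= N%:R * (z + B)] by [].
  apply: mGZ.
  have mh : measurable_fun setT (fun z : R => N%:R * (z + B)).
    by apply: measurable_funM => //; exact: measurable_funD.
  have := mh measurableT `[j.+1%:R, +oo[%classic (measurable_itv _).
  by rewrite setTI; congr measurable; apply/seteqP; split => z /=; rewrite in_itv/= andbT.
have mA N j : measurable (A N j) by exact: GM.
have bA N j : bounded_measurable (\1_(A N j) : T -> R) by exact: bmf_indic.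
pose D N K w : R := \sum_(0 <= j < K) \1_(A N j) w.
have bD N K : bounded_measurable (D N K) by rewrite /D; bmf.
have ID N K : \int[P]_w (D N K w * W w) = 0.
  elim: K => [|K IH].
    rewrite /D; under eq_Rintegral do rewrite big_geq// mul0r.
    by rewrite Ex_cst.
  under eq_Rintegral do rewrite /D big_nat_recr//= mulrDl.
  rewrite RintegralD//; last 2 first.
  - exact: (integrableM_bmf (bD N K) iW).
  - exact: (integrableM_bmf (bA N K) iW).
  rewrite IH add0r -[RHS](W0 _ (GA N K)) [RHS]Rintegral_mkcond.
  apply: eq_Rintegral => w _; rewrite patchE indicE.
  by case: (_ \in _); rewrite ?mul1r ?mul0r.
have intW0 : \int[P]_w W w = 0.
  by apply: W0; rewrite -(preimage_setT Z); exact: mGZ.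
(* Orthogonality to constants and to the indicators allows [Z] to be replaced by its discretization
   error, which is at most 1 / N. *)
have key N : (0 < N)%N -> `|\int[P]_w (Z w * W w)| <= N%:R^-1 * \int[P]_w `|W w|.
  move=> N0; have N0' : 0 < N%:R :> R by rewrite ltr0n.
  pose K := (Num.truncn (N%:R * (B + B))).+1.
  have E : \int[P]_w (Z w * W w) =
      \int[P]_w ((Z w + B - N%:R^-1 * D N K w) * W w).
    have -> : \int[P]_w ((Z w + B - N%:R^-1 * D N K w) * W w) =
       \int[P]_w (Z w * W w + (B * W w - N%:R^-1 * (D N K w * W w))).
      by apply: eq_Rintegral => w _; ring.
    rewrite RintegralD//; last 2 first.
    - exact: (integrableM_bmf bZ iW).
    - exact: (integrableB measurableT (integrableZl measurableT B iW)
         (integrableZl measurableT N%:R^-1 (integrableM_bmf (bD N K) iW))).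
    rewrite RintegralB//; last 2 first.
    - exact: (integrableZl measurableT B iW).
    - exact: (integrableZl measurableT N%:R^-1 (integrableM_bmf (bD N K) iW)).
    rewrite RintegralZl// intW0 RintegralZl//; last exact: (integrableM_bmf (bD N K) iW).
    by rewrite ID !mulr0 subrr addr0.
  have bdiff : bounded_measurable (fun w => Z w + B - N%:R^-1 * D N K w) by bmf.
  rewrite E (le_trans (le_normr_Rintegral _ _))//; first exact: (integrableM_bmf bdiff iW).
  rewrite -RintegralZl//; last exact: (integrable_abse iW).
  apply: le_Rintegral => //.
  - have := integrable_abse (integrableM_bmf bdiff iW); exact.
  - exact: (integrableZl measurableT N%:R^-1 (integrable_abse iW)).
  move=> w _; rewrite normrM ler_wpM2r//.
  have ZB0 : 0 <= Z w + B by have := ZB w; rewrite ler_norml; lra.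
  have ZBN : 0 <= N%:R * (Z w + B) by rewrite mulr_ge0.
  pose mm := Num.truncn (N%:R * (Z w + B)).
  have -> : D N K w = mm%:R.
    rewrite /D (eq_bigr (fun j => (j < mm)%:R)); last first.
      move=> j _; rewrite indicE /mm; congr (_%:R); congr nat_of_bool.
      by rewrite truncn_ge_nat//; apply/idP/idP; rewrite inE.
    have mK : (mm <= K)%N.
      rewrite ltnW// ltnS; apply: Num.Theory.le_truncn.
      by rewrite ler_wpM2l// lerD2r (le_trans (ler_norm _)).
    rewrite (big_cat_nat _ (n := mm))//= [X in _ + X]big1_seq ?addr0; last first.
      by move=> j; rewrite mem_index_iota => /andP[_ /andP[h _]]; rewrite ltnNge h.
    rewrite big_nat (eq_bigr (fun=> 1)) -?big_nat; last by move=> j /andP[_ ->].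
    by rewrite sumr_const_nat subn0.
  have /andP[h1 h2] := truncn_itv ZBN; rewrite -/mm in h1 h2.
  have -> : Z w + B - N%:R^-1 * mm%:R = N%:R^-1 * (N%:R * (Z w + B) - mm%:R).
    by field; rewrite gt_eqF.
  rewrite normrM ger0_norm ?invr_ge0// -[leRHS]mulr1 ler_wpM2l ?invr_ge0//.
  by rewrite ger0_norm ?subr_ge0// -natr1 in h2 *; lra.
apply/eqP; rewrite -normr_le0; apply/ler_addgt0Pr => e e0; rewrite add0r.
pose I := \int[P]_w `|W w|.
pose N := (Num.truncn (I / e)).+1.
apply: (le_trans (key N _)) => //.
rewrite mulrC ler_pdivrMr ?ltr0n// mulrC -ler_pdivrMr// ltW//.
exact: truncnS_gt.
Qed.

End integrable_times_bounded.

(** Access by [nth] permits sums over ranges of natural numbers; the default value beyond the length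
    is harmless for measurability. *)
Lemma measurable_nth (R : realType) n j :
  measurable_fun setT (fun u : n.-tuple R => nth 0 u j).
Proof.
have [jn|nj] := ltnP j n.
  rewrite (_ : (fun u : n.-tuple R => _) = (@tnth _ R ^~ (Ordinal jn))).
    exact: measurable_tnth.
  by apply/funext => u; rewrite (tnth_nth 0).
rewrite (_ : (fun u : n.-tuple R => _) = cst 0); first exact: measurable_cst.
by apply/funext => u; rewrite nth_default// size_tuple.
Qed.

(** * Windows of a stationary process *)

Section window.
Context d (T : measurableType d) (R : realType) (P : probability T R).
Variable X : int -> {RV P >-> R}.

(** Indices start at 1, as in the statistic; the shift [- n] moves the window to the indices 1 - n,
    ..., 0 of the past. *)
Definition window n (h : int) (w : T) : n.-tuple R :=
  [tuple X (i.+1%:Z + h) w | i < n].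

Lemma nth_window n h w j : (j < n)%N -> nth 0 (window n h w) j = X (j.+1%:Z + h) w.
Proof. by move=> jn; rewrite -(tnth_nth 0 _ (Ordinal jn)) tnth_mktuple. Qed.

Lemma measurable_window n h : measurable_fun setT (window n h).
Proof.
apply/measurable_fun_tnthP => i.
rewrite (_ : _ \o _ = X (i.+1%:Z + h)); last first.
  by apply/funext => w /=; rewrite tnth_mktuple.
exact: measurable_funPT.
Qed.

Hypothesis X_stationary : strictly_stationary X.

Lemma Ex_window_shift n h (psi : n.-tuple R -> R) : bounded_measurable psi ->
  \int[P]_w psi (window n h w) = \int[P]_w psi (window n 0 w).
Proof.
move=> bpsi; have [mpsi _] := bpsi.
have E h' : \int[P]_w psi (window n h' w) =
    fine (\int[pushforward P (window n h')]_u (psi u)%:E)%E.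
  rewrite /Rintegral; congr fine.
  rewrite (integral_pushforward (@measurable_window n h') _ _ measurableT)//.
  - exact/measurable_EFinP.
  - rewrite preimage_setT; apply: bmf_integrable.
    exact: (bmf_comp bpsi (@measurable_window n h')).
rewrite !E; congr fine.
apply: eq_measure_integral; [exact: measurable_window..|move=> m1 m2 A mA _].
rewrite /= /pushforward.
have := X_stationary [tuple i.+1%:Z | i < n] h mA.
have Ew h' : window n h' @^-1` A =
    [set w | A [tuple X (tnth [tuple i.+1%:Z | i < n] i + h') w | i < n]].
  apply/seteqP; split => w /=; congr A; apply: eq_mktuple => i;
  by rewrite tnth_mktuple.
have E0 : window n 0 @^-1` A =
    [set w | A [tuple X (tnth [tuple i.+1%:Z | i < n] i) w | i < n]].
  apply/seteqP; split => w /=; congr A; apply: eq_mktuple => i;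
  by rewrite tnth_mktuple addr0.
by rewrite Ew E0 => ->.
Qed.

Lemma Ex_shift (f : R -> R) (i j : int) : bounded_measurable f ->
  \int[P]_w f (X i w) = \int[P]_w f (X j w).
Proof.
move=> bf.
have H k : \int[P]_w f (X k w) = \int[P]_w f (X 1 w).
  have b1 : @bounded_measurable _ (1.-tuple R) R (fun u => f (nth 0 u 0)).
    exact: (bmf_comp bf (@measurable_nth R 1 0)).
  transitivity (\int[P]_w f (nth 0 (window 1 (k - 1) w) 0)).
    by apply: eq_Ex => w; rewrite nth_window// addrC subrK.
  by rewrite (Ex_window_shift (k - 1) b1); apply: eq_Ex => w; rewrite nth_window// addr0.
by rewrite H H.
Qed.

End window.

Section alpha_coefficient.
Context d (T : measurableType d) (R : realType) (P : probability T R).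
Variable X : int -> {RV P >-> R}.
Hypothesis X_stationary : strictly_stationary X.

Let past_generators := \bigcup_(i in [set k : int | k <= 0])
  preimage_set_system setT (X i) measurable.

(** As [Z] is measurable for the past, the indicator may be replaced by its conditional expectation,
    whose L^1 distance to the distribution function is at most the coefficient. *)
Lemma alpha1_past_bound k (Z : T -> R) (B x : R) : alpha1 X k \is a fin_num ->
  measurable_fun setT (Z : g_sigma_algebraType past_generators -> R) ->
  (forall w, `|Z w| <= B) ->
  `|\int[P]_w (Z w * ((X k w <= x)%R%:R - fine (cdf (X 0) x)))|
    <= B * fine (alpha1 X k).
Proof.
move=> afin mZ ZB.
have [sG GM] := sigma_processP X [set k : int | k <= 0].
have mA : measurable [set w | (X k w <= x)%R].
  have := @measurable_funPT _ _ _ _ (X k) measurableT `]-oo, x]%classic (measurable_itv _).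
  by rewrite setTI; congr measurable; apply/seteqP; split => w /=; rewrite in_itv.
set f := \1_[set w' | (X k w' <= x)%R] : T -> R.
have bf : bounded_measurable f by exact: bmf_indic.
have intf : P.-integrable setT (EFin \o f) by exact: bmf_integrable.
have [c1 c2 c3] := cond_expP sG GM intf.
set g := cond_exp P (past X) f in c1 c2 c3.
have bZ : bounded_measurable Z.
  split; last by exists B.
  by move=> _ U mU; have := mZ measurableT U mU; rewrite !setTI => /GM.
set F := fine (cdf (X 0) x).
have iW : P.-integrable setT (EFin \o (fun w => f w - g w)).
  exact: (integrableB measurableT intf c2).
have orth : \int[P]_w (Z w * (f w - g w)) = 0.
  apply: (@Rintegral_orthogonal _ _ _ P past_generators _ _ B) => // A GA.
  have mA' : measurable A by exact: GM.
  rewrite RintegralB//; [|exact: (integrableS measurableT mA' (@subsetT _ _) intf)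
     |exact: (integrableS measurableT mA' (@subsetT _ _) c2)].
  by rewrite /Rintegral (c3 _ GA) subrr.
have igF : P.-integrable setT (EFin \o (fun w => g w - F)).
  exact: (integrableB measurableT c2 (bmf_integrable P (@bmf_cst _ T R F))).
have -> : \int[P]_w (Z w * ((X k w <= x)%R%:R - F)) = \int[P]_w (Z w * (g w - F)).
  rewrite -[RHS]add0r -orth -RintegralD//; [|exact: integrableM_bmf..].
  apply: eq_Ex => w; rewrite -mulrDr addrA subrK /f indicE.
  by congr (_ * (_%:R - _)); congr nat_of_bool; apply/idP/idP; rewrite inE.
have aE : \int[P]_w `|g w - F| <= fine (alpha1 X k).
  rewrite -lee_fin [leRHS]fineK// /Rintegral fineK; last first.
    by apply: integrable_fin_num => //; exact: (integrable_abse igF).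
  apply: ereal_sup_ubound; exists x => //=.
  by rewrite Lnorm1.
have [w0|T0] := pselect (exists w : T, True); last first.
  have : P setT = 0%E.
    rewrite (_ : setT = set0) ?measure0//.
    by apply/seteqP; split => w // _; case: T0; exists w.
  by rewrite probability_setT => /eqP; rewrite onee_eq0.
have B0 : 0 <= B by have [w _] := w0; exact: le_trans (ZB w).
rewrite (le_trans (le_normr_Rintegral _ _))//; first exact: integrableM_bmf.
apply: (@le_trans _ _ (\int[P]_w (B * `|g w - F|))); last first.
  rewrite RintegralZl//; first by rewrite ler_wpM2l.
  exact: (integrable_abse igF).
apply: le_Rintegral => //.
- exact: (integrable_abse (integrableM_bmf bZ igF)).
- exact: (integrableZl measurableT B (integrable_abse igF)).
- by move=> w _; rewrite normrM ler_wpM2r.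
Qed.

End alpha_coefficient.

(** * Fubini and independence *)

Section fubini.
Context d1 d2 (T1 : measurableType d1) (T2 : measurableType d2) (R : realType).
Variables (P1 : probability T1 R) (P2 : probability T2 R).
Variable h : T1 * T2 -> R.
Hypothesis bh : bounded_measurable h.

Let PP : probability (T1 * T2)%type R := (P1 \x P2)%E.

Let int_h : PP.-integrable setT (EFin \o h). Proof. exact: bmf_integrable. Qed.

Lemma bmf_section1 x : bounded_measurable (fun y => h (x, y)).
Proof. by apply: (bmf_comp bh); exact: measurable_pair1. Qed.

Lemma bmf_section2 y : bounded_measurable (fun x => h (x, y)).
Proof. by apply: (bmf_comp bh); exact: measurable_pair2. Qed.

Lemma bmf_partial_Ex1 : bounded_measurable (fun x => \int[P2]_y h (x, y)).
Proof.
split.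
  apply/measurable_EFinP.
  have := measurable_fubini_F int_h; congr measurable_fun.
  by apply/funext => x /=; rewrite -Ex_EFin//; exact: bmf_section1.
have [_ [M hM]] := bh; exists M => x.
by apply: norm_Ex_le_cst => // ; exact: bmf_section1.
Qed.

Lemma bmf_partial_Ex2 : bounded_measurable (fun y => \int[P1]_x h (x, y)).
Proof.
split.
  apply/measurable_EFinP.
  have := measurable_fubini_G int_h; congr measurable_fun.
  by apply/funext => y /=; rewrite -Ex_EFin//; exact: bmf_section2.
have [_ [M hM]] := bh; exists M => y.
by apply: norm_Ex_le_cst => //; exact: bmf_section2.
Qed.

Lemma Ex_prod1 : \int[P1]_x (\int[P2]_y h (x, y)) = \int[PP]_z h z.
Proof.
rewrite {1 3}/Rintegral; congr fine.
rewrite -(integral12_prod_meas1 int_h); apply: eq_integral => x _.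
by rewrite -Ex_EFin//; exact: bmf_section1.
Qed.

Lemma Ex_prod2 : \int[P2]_y (\int[P1]_x h (x, y)) = \int[PP]_z h z.
Proof.
rewrite {1 3}/Rintegral; congr fine.
rewrite -(integral21_prod_meas1 int_h); apply: eq_integral => x _.
by rewrite -Ex_EFin//; exact: bmf_section2.
Qed.

Lemma Ex_swap : \int[P1]_x (\int[P2]_y h (x, y)) = \int[P2]_y (\int[P1]_x h (x, y)).
Proof. by rewrite Ex_prod1 Ex_prod2. Qed.

End fubini.

Lemma Ex_pushforward d d1 (T : measurableType d) (E1 : measurableType d1)
  (R : realType) (P : probability T R) (U : T -> E1) (mU : measurable_fun setT U) (f : E1 -> R) :
  bounded_measurable f ->
  \int[P]_w f (U w) = fine (\int[pushforward P U]_u (f u)%:E)%E.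
Proof.
move=> bf; have [mf _] := bf.
rewrite /Rintegral; congr fine.
rewrite (integral_pushforward mU _ _ measurableT)//.
- exact/measurable_EFinP.
- rewrite preimage_setT; apply: bmf_integrable.
  exact: (bmf_comp bf mU).
Qed.

Section independent_pair.
Context d d1 d2 (T : measurableType d) (E1 : measurableType d1)
  (E2 : measurableType d2) (R : realType) (P : probability T R).

(** The law of the pair is the product of its marginals. The right-hand side uses two copies of the
    sample space, so that one variable can be frozen while the other is averaged. *)
Lemma Ex_independent (U : T -> E1) (V : T -> E2) (h : E1 * E2 -> R) :
  measurable_fun setT U -> measurable_fun setT V ->
  (forall A B, measurable A -> measurable B ->
    P (U @^-1` A `&` V @^-1` B) = (P (U @^-1` A) * P (V @^-1` B))%E) ->
  bounded_measurable h ->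
  \int[P]_w h (U w, V w) = \int[P]_w' (\int[P]_w h (U w, V w')).
Proof.
move=> mU mV ind bh.
pose U' : {RV P >-> E1} := HB.pack U (isMeasurableFun.Build _ _ _ _ U mU).
pose V' : {RV P >-> E2} := HB.pack V (isMeasurableFun.Build _ _ _ _ V mV).
pose PU : probability E1 R := distribution P U'.
pose PV : probability E2 R := distribution P V'.
have mUV : measurable_fun setT (fun w => (U w, V w)) by exact: measurable_fun_pair.
rewrite (Ex_pushforward P mUV bh).
transitivity (\int[(PU \x PV)%E]_z h z).
  rewrite /Rintegral; congr fine.
  apply: eq_measure_integral => A mA _.
  apply/esym; apply: product_measure_unique => //.
transitivity (\int[PV]_y (\int[PU]_x h (x, y))); first exact: (esym (Ex_prod2 PU PV bh)).
rewrite [RHS](_ : _ = \int[P]_w' (\int[PU]_u h (u, V w'))).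
  rewrite (Ex_pushforward P mV (bmf_partial_Ex2 PU PV bh)).
  by [].
apply: eq_Ex => w'.
by rewrite (Ex_pushforward P mU (bmf_section2 bh (V w'))).
Qed.

End independent_pair.

Lemma bmf_le (R : realType) (x : R) :
  bounded_measurable (fun y : R => (y <= x)%R%:R : R).
Proof.
have -> : (fun y : R => (y <= x)%R%:R : R) = \1_(`]-oo, x]%classic).
  apply/funext => y; rewrite indicE; congr (nat_of_bool _)%:R.
  by apply/idP/idP; rewrite inE/= in_itv.
by apply: bmf_indic; exact: measurable_itv.
Qed.

Lemma bmf_lt (R : realType) (x : R) :
  bounded_measurable (fun y : R => (y < x)%R%:R : R).
Proof.
have -> : (fun y : R => (y < x)%R%:R : R) = \1_(`]-oo, x[%classic).
  apply/funext => y; rewrite indicE; congr (nat_of_bool _)%:R.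
  by apply/idP/idP; rewrite inE/= in_itv.
by apply: bmf_indic; exact: measurable_itv.
Qed.

(** * Observables whose correlations with the past decay *)

Section mixing.
Context d (T : measurableType d) (R : realType) (P : probability T R).
Variable X : int -> {RV P >-> R}.
Hypothesis X_stationary : strictly_stationary X.
Variable a : nat -> R.
Hypothesis a_alpha : forall k, (0 < k)%N -> alpha1 X k = (a k)%:E.

(* The decay of correlations between the past and [e (X_n)], in a form that is
   stable under pointwise limits and mixtures in [e]. *)
Definition mixes (e : R -> R) := bounded_measurable e /\
  forall j k (phi : j.+1.-tuple R -> R) (B : R), (0 < k)%N ->
    bounded_measurable phi -> (forall u, `|phi u| <= B) ->
    `|\int[P]_w (phi (window X j.+1 0 w) *
        (e (X (j.+1 + k)%N w) - \int[P]_w' e (X 0 w')))| <= B * a k.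

Let bX (e : R -> R) (i : int) : bounded_measurable e -> bounded_measurable (fun w => e (X i w)).
Proof. by move=> be; apply: (bmf_comp be); exact: measurable_funPT. Qed.

Let bwin j h (phi : j.+1.-tuple R -> R) : bounded_measurable phi ->
  bounded_measurable (fun w => phi (window X j.+1 h w)).
Proof. by move=> bphi; apply: (bmf_comp bphi); exact: measurable_window. Qed.

Lemma cdf_Ex (x : R) : fine (cdf (X 0) x) = \int[P]_w (X 0 w <= x)%R%:R.
Proof.
have -> : \int[P]_w (X 0 w <= x)%R%:R = \int[P]_w \1_(X 0 @^-1` `]-oo, x]) w.
  apply: eq_Ex => w; rewrite indicE; congr (nat_of_bool _)%:R.
  by apply/idP/idP; rewrite inE/= in_itv.
rewrite /Rintegral integral_indic ?setIT//.
have := @measurable_funPT _ _ _ _ (X 0) measurableT `]-oo, x]%classic (measurable_itv _).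
by rewrite setTI.
Qed.

(** A shift by [- j.+1] brings the window to the indices - j, ..., 0, hence into the past, and
    [X (j.+1 + k)] to [X k]. *)
Lemma mixes_le (x : R) : mixes (fun y => (y <= x)%R%:R).
Proof.
split=> [|j k phi B k0 bphi phiB]; first exact: bmf_le.
rewrite -cdf_Ex; set F := fine _.
pose n := (j.+1 + k)%N.
pose restr (u : n.-tuple R) : j.+1.-tuple R := [tuple nth 0 u i | i < j.+1].
have mrestr : measurable_fun setT restr.
  apply/measurable_fun_tnthP => i.
  rewrite (_ : _ \o _ = (fun u : n.-tuple R => nth 0 u i)); first exact: measurable_nth.
  by apply/funext => u /=; rewrite tnth_mktuple.
pose psi (u : n.-tuple R) := phi (restr u) * ((nth 0 u (j + k) <= x)%R%:R - F).
have bpsi : bounded_measurable psi.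
  apply: bmfM; first exact: (bmf_comp bphi mrestr).
  apply: bmfB; last exact: bmf_cst.
  exact: (bmf_comp (bmf_le x) (@measurable_nth R n (j + k))).
have restrE h w : restr (window X n h w) = window X j.+1 h w.
  apply: eq_from_tnth => i; rewrite tnth_mktuple nth_window ?tnth_mktuple//.
  by rewrite (leq_trans (ltn_ord i))// leq_addr.
have psiE h w : psi (window X n h w) =
    phi (window X j.+1 h w) * ((X (n%:Z + h) w <= x)%R%:R - F).
  by rewrite /psi restrE nth_window//.
have -> : \int[P]_w (phi (window X j.+1 0 w) * ((X n w <= x)%R%:R - F)) =
    \int[P]_w psi (window X n 0 w).
  by apply: eq_Ex => w; rewrite psiE addr0.
rewrite -(Ex_window_shift X_stationary (- j.+1%:Z) bpsi).
have -> : \int[P]_w psi (window X n (- j.+1%:Z) w) =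
    \int[P]_w (phi (window X j.+1 (- j.+1%:Z) w) * ((X k w <= x)%R%:R - F)).
  by apply: eq_Ex => w; rewrite psiE; congr (_ * ((X _ w <= x)%R%:R - F)); rewrite /n; lia.
have := @alpha1_past_bound _ _ _ P X k (fun w => phi (window X j.+1 (- j.+1%:Z) w)) B x.
rewrite (a_alpha k0); apply => //.
have [mphi _] := bphi.
apply: (measurableT_comp mphi).
apply/measurable_fun_tnthP => i.
rewrite (_ : _ \o _ = (X (i.+1%:Z - j.+1%:Z) : T -> R)); last first.
  by apply/funext => w /=; rewrite tnth_mktuple.
move=> _ U mU; rewrite setTI; apply: sub_sigma_algebra.
exists (i.+1%:Z - j.+1%:Z); last by exists U => //; rewrite setTI.
by rewrite /=; have := ltn_ord i; lia.
Qed.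

Lemma mixes_cvg (en : nat -> R -> R) e (C : R) : (forall n, mixes (en n)) ->
  (forall n y, `|en n y| <= C) -> bounded_measurable e ->
  (forall y, en n y @[n --> \oo] --> e y) -> mixes e.
Proof.
move=> men enC be ene; split=> // j k phi B k0 bphi phiB.
have ben n : bounded_measurable (en n) by have [] := men n.
have h1 : \int[P]_w en n (X 0 w) @[n --> \oo] --> \int[P]_w e (X 0 w).
  apply: (Ex_bounded_cvg (B := C)) => //.
  - by move=> n; have [] := bX 0 (ben n).
  - by have [] := bX 0 be.
  - by apply: aeW => w; exact: ene.
have h2 : \int[P]_w (phi (window X j.+1 0 w) * en n (X (j.+1 + k)%N w)) @[n --> \oo] -->
    \int[P]_w (phi (window X j.+1 0 w) * e (X (j.+1 + k)%N w)).
  apply: (Ex_bounded_cvg (B := B * C)) => //.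
  - by move=> n; have [] := bmfM (bwin 0 bphi) (bX (j.+1 + k)%N (ben n)).
  - by move=> n w; rewrite normrM ler_pM.
  - by have [] := bmfM (bwin 0 bphi) (bX (j.+1 + k)%N be).
  - by apply: aeW => w; apply: cvgM; [exact: cvg_cst|exact: ene].
have E (f : R -> R) : bounded_measurable f ->
   \int[P]_w (phi (window X j.+1 0 w) * (f (X (j.+1 + k)%N w) - \int[P]_w' f (X 0 w'))) =
   \int[P]_w (phi (window X j.+1 0 w) * f (X (j.+1 + k)%N w)) -
   \int[P]_w' f (X 0 w') * \int[P]_w phi (window X j.+1 0 w).
  move=> bf; rewrite -ExZ; last exact: bwin.
  rewrite -ExB; [|by apply: bmfM; [exact: bwin|exact: bX]
                 |by apply: bmfM; [exact: bmf_cst|exact: bwin]].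
  by apply: eq_Ex => w; ring.
have h3 : \int[P]_w (phi (window X j.+1 0 w) * (en n (X (j.+1 + k)%N w) - \int[P]_w' en n (X 0 w'))) @[n --> \oo]
  --> \int[P]_w (phi (window X j.+1 0 w) * (e (X (j.+1 + k)%N w) - \int[P]_w' e (X 0 w'))).
  rewrite E//; under eq_fun do rewrite E//.
  by apply: cvgB => //; apply: cvgM => //; exact: cvg_cst.
apply: (cvgr_to_le (cvg_norm h3)); apply: nearW => n.
by have [_] := men n; apply.
Qed.

(** The strict inequality is the pointwise limit of the non-strict ones at [x - n.+1%:R^-1]. *)
Lemma mixes_lt (x : R) : mixes (fun y => (y < x)%R%:R).
Proof.
apply: (mixes_cvg (en := fun n y => (y <= x - n.+1%:R^-1)%R%:R) (C := 1)).
- by move=> n; exact: mixes_le.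
- by move=> n y; case: (y <= _); rewrite ?normr1 ?normr0.
- exact: bmf_lt.
- move=> y; apply: cvg_near_cst.
  have [yx|xy] := ltP y x; last first.
    apply: nearW => n; apply/eqP; rewrite pnatr_eq0 eqb0 -ltNge ltrBlDr.
    by rewrite (le_lt_trans xy)// ltrDl invr_gt0.
  near=> n; apply/eqP; rewrite (_ : (y <= _) = true)//.
  rewrite lerBrDr -lerBrDl.
  have xy0 : 0 < x - y by rewrite subr_gt0.
  rewrite -[leRHS]invrK lef_pV2 ?posrE ?invr_gt0//.
  have : (Num.truncn (x - y)^-1 <= n)%N by near: n; exact: nbhs_infty_ge.
  by rewrite -ltnS => h; rewrite ltW// (lt_le_trans (truncnS_gt _))// ler_nat.
Unshelve. all: by end_near. Qed.

Lemma mixes_gt (x : R) : mixes (fun y => (x < y)%R%:R).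
Proof.
have E (y : R) : (x < y)%R%:R = 1 - (y <= x)%R%:R :> R.
  by rewrite ltNge; case: (y <= x); rewrite ?subrr ?subr0.
have [_ H] := mixes_le x.
split=> [|j k phi B k0 bphi phiB].
  by under eq_fun do rewrite E; apply: bmfB; [exact: bmf_cst|exact: bmf_le].
pose q w := phi (window X j.+1 0 w) *
  ((X (j.+1 + k)%N w <= x)%R%:R - \int[P]_w' (X 0 w' <= x)%R%:R).
have bq : bounded_measurable q.
  apply: bmfM; first exact: bwin.
  by apply: bmfB; [exact: (bX _ (bmf_le x))|exact: bmf_cst].
have -> : \int[P]_w (phi (window X j.+1 0 w) *
    ((x < X (j.+1 + k)%N w)%R%:R - \int[P]_w' (x < X 0 w')%R%:R)) = - \int[P]_w q w.
  rewrite -[RHS]ExN//; apply: eq_Ex => w.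
  have -> : \int[P]_w' (x < X 0 w')%R%:R = 1 - \int[P]_w' (X 0 w' <= x)%R%:R.
    rewrite -[X in X - _](Ex_cst P) -ExB; [|exact: bmf_cst|exact: (bX _ (bmf_le x))].
    by apply: eq_Ex => w'; rewrite E.
  by rewrite E /q; ring.
by rewrite normrN; exact: H.
Qed.

(** By Fubini the correlation of a mixture is the mixture of the correlations; as [Q] has mass 1,
    the bound passes through unchanged. *)
Lemma mixes_mixture d' (T' : measurableType d') (Q : probability T' R)
  (e : R * T' -> R) : bounded_measurable e ->
  (forall w', mixes (fun y => e (y, w'))) -> mixes (fun y => \int[Q]_w' e (y, w')).
Proof.
move=> be me; split=> [|j k phi B k0 bphi phiB].
  (* [bmf_partial_Ex1] concerns a product of two probabilities; any law on the line can serve as the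
     first one, here a Dirac mass. *)
  exact: (bmf_partial_Ex1 (\d_(0 : measurableTypeR R) : probability (measurableTypeR R) R) Q be).
have beX i : bounded_measurable (fun z : T * T' => e (X i z.1, z.2)).
  apply: (bmf_comp be); apply: measurable_fun_pair => //.
  by apply: measurableT_comp => //; exact: measurable_funPT.
have beX1 i w' : bounded_measurable (fun w => e (X i w, w')).
  exact: (bmf_section2 (beX i) w').
have bp1 : bounded_measurable (fun z : T * T' => phi (window X j.+1 0 z.1)).
  exact: (bmf_comp (bwin 0 bphi) measurable_fst).
pose m0 w' := \int[P]_w e (X 0 w, w').
have bm0 : bounded_measurable m0 by exact: (bmf_partial_Ex2 P Q (beX 0)).
pose h (z : T * T') := phi (window X j.+1 0 z.1) * (e (X (j.+1 + k)%N z.1, z.2) - m0 z.2).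
have bh : bounded_measurable h.
  apply: bmfM => //; apply: bmfB; first exact: beX.
  exact: (bmf_comp bm0 measurable_snd).
have -> : \int[P]_w (phi (window X j.+1 0 w) *
     (\int[Q]_w' e (X (j.+1 + k)%N w, w') - \int[P]_w0 \int[Q]_w' e (X 0 w0, w'))) =
   \int[Q]_w' (\int[P]_w h (w, w')).
  rewrite -(Ex_swap P Q bh); apply: eq_Ex => w.
  rewrite /h /= ExZ; last first.
    apply: bmfB => //; exact: (bmf_section1 (beX (j.+1 + k)%N) w).
  rewrite ExB//; last exact: (bmf_section1 (beX (j.+1 + k)%N) w).
  by congr (_ * (_ - _)); rewrite (Ex_swap P Q (beX 0)).
apply: norm_Ex_le_cst; first exact: (bmf_partial_Ex2 P Q bh).
by move=> w'; have [_] := me w'; apply.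
Qed.

End mixing.

(** * Central limit theorem for a process *)

(** Passage to real numbers, with [tau] the tail of the series. The series starts at 1, so [a]
    represents the coefficients at positive lags only. *)
Lemma alpha1_summable d (T : measurableType d) (R : realType)
  (P : probability T R) (X : int -> {RV P >-> R}) :
  (\sum_(1 <= k <oo) alpha1 X k < +oo)%E ->
  exists a tau : nat -> R, [/\ forall k, (0 < k)%N -> alpha1 X k = (a k)%:E,
    forall k, 0 <= a k,
    forall L n, \sum_(L.+1 <= l < n) a l <= tau L & tau @ \oo --> 0].
Proof.
move=> sfin.
have al0 k : (0 <= alpha1 X k)%E.
  rewrite /alpha1; set A := [set _ | _ in _].
  have [y Ay] : A !=set0 by eexists; exists 0.
  apply: (@le_trans _ _ y); last exact: ereal_sup_ubound.
  by case: Ay => z _ <-; exact: Lnorm_ge0.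
pose S := (\sum_(1 <= k <oo) alpha1 X k)%E.
have S0 : (0 <= S)%E by apply: nneseries_ge0 => k _ _; exact: al0.
have Sfin : S \is a fin_num by rewrite ge0_fin_numE.
have part n : (\sum_(1 <= k < n) alpha1 X k <= S)%E.
  by apply: nneseries_lim_ge => k _ _; exact: al0.
have fin k : (0 < k)%N -> alpha1 X k \is a fin_num.
  move=> k0; rewrite ge0_fin_numE// (le_lt_trans _ sfin)// (le_trans _ (part k.+1))//.
  rewrite big_nat_recr//= leeDr// sume_ge0//.
pose a k := fine (alpha1 X k).
have a0 k : 0 <= a k by exact: fine_ge0.
have aE k : (0 < k)%N -> alpha1 X k = (a k)%:E by move=> k0; rewrite fineK// fin.
have partE n : (\sum_(1 <= k < n) alpha1 X k = (\sum_(1 <= k < n) a k)%:E)%E.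
  by rewrite -sumEFin !big_nat; apply: eq_bigr => k /andP[k1 _]; exact: aE.
have partS n : \sum_(1 <= k < n) a k <= fine S.
  by rewrite -lee_fin -partE fineK.
exists a, (fun L => fine S - \sum_(1 <= k < L.+1) a k); split => //.
- move=> L n; rewrite lerBrDl.
  have [Ln|nL] := leqP L.+1 n; last by rewrite [X in _ + X]big_geq ?addr0// ltnW.
  by rewrite -big_cat_nat.
- have : (\sum_(1 <= k < n) alpha1 X k)%E @[n --> \oo] --> S.
    by apply: is_cvg_nneseries => k _ _; exact: al0.
  rewrite -(fineK Sfin) => /fine_cvgP[_ h].
  rewrite -[X in _ --> X](subrr (fine S)); apply: cvgB; first exact: cvg_cst.
  rewrite (_ : fine \o _ = (fun n => \sum_(1 <= k < n) a k)) in h; last first.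
    by apply/funext => n /=; rewrite partE.
  by rewrite -(cvg_shiftS (fun n => \sum_(1 <= k < n) a k)) in h.
Qed.

Section process_clt.
Context d (T : measurableType d) (R : realType) (P : probability T R).
Variable X : int -> {RV P >-> R}.
Hypotheses (X_stationary : strictly_stationary X) (X_ergodic : two_ergodic X).
Variables (a tau : nat -> R).
Hypothesis tail : forall L n, \sum_(L.+1 <= l < n) a l <= tau L.
Hypothesis tau0 : tau @ \oo --> 0.
Variable f : R -> R.
Hypothesis mf : mixes X a f.
Hypothesis f1 : forall x, `|f x| <= 1.
Hypothesis f_mean0 : \int[P]_w f (X 0 w) = 0.

Definition autocov (l : nat) : R := \int[P]_w (f (X 0 w) * f (X l w)).
Local Notation c := autocov.

Let bf : bounded_measurable f. Proof. by have [] := mf. Qed.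

Let bfX (i : int) : bounded_measurable (fun w => f (X i w)).
Proof. by apply: (bmf_comp bf); exact: measurable_funPT. Qed.

(** Sums start at index 0 in [psum] and at index 1 in the statistic. *)
Let xi (i : nat) (w : T) : R := f (X i.+1 w).

Let bxi i : bounded_measurable (xi i). Proof. exact: bfX. Qed.

Let bnth n j : bounded_measurable (fun u : n.-tuple R => f (nth 0 u j)).
Proof. by apply: (bmf_comp bf); exact: measurable_nth. Qed.

(** The increment of the cosine is a function of [X 1], ..., [X i.+1] bounded by [|s|], since [f] is
    bounded by 1; [mixes] applies to it. *)
Let dep (s b : R) i l : (0 < l)%N ->
  `|\int[P]_w ((cos (s * psum xi i.+1 w + b) - cos (s * psum xi i w + b)) * xi (i + l)%N w)|
    <= `|s| * 1 * a l.
Proof.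
move=> l0; rewrite mulr1.
pose Su k (u : i.+1.-tuple R) := \sum_(0 <= j < k) f (nth 0 u j).
have bSu k : bounded_measurable (Su k) by rewrite /Su; apply: bmf_sum => j; exact: bnth.
have bcSu k : bounded_measurable (fun u => cos (s * Su k u + b)).
  apply: bmf_cos; apply: measurable_funD => //; apply: measurable_funM => //.
  by have [] := bSu k.
pose phi u := cos (s * Su i.+1 u + b) - cos (s * Su i u + b).
have bphi : bounded_measurable phi by exact: bmfB.
have phiB u : `|phi u| <= `|s|.
  rewrite (le_trans (cos_lip _ _))//.
  have -> : s * Su i.+1 u + b - (s * Su i u + b) = s * f (nth 0 u i).
    by rewrite /Su big_nat_recr//=; ring.
  by rewrite normrM ler_piMr.
have [_ H] := mf.
have := H _ _ _ _ l0 bphi phiB; congr (`|_| <= _).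
apply: eq_Ex => w; rewrite f_mean0 subr0 /xi addSn; congr (_ * _).
have SE k : (k <= i.+1)%N -> Su k (window X i.+1 0 w) = psum xi k w.
  move=> ki; rewrite /Su /psum !big_nat; apply: eq_bigr => j /andP[_ jk].
  by rewrite nth_window ?addr0//; exact: leq_trans jk ki.
by rewrite /phi !SE.
Qed.

(** Ergodicity speaks of blocks with a fixed start; stationarity makes the L^1 estimate uniform in
    the start, as the averaging over blocks requires. *)
Let shifted_products l p h :
  \int[P]_w `|\sum_(0 <= j < p) (xi (h + j)%N w * xi (h + j + l)%N w - c l)|
  = \int[P]_w `|\sum_(0 <= j < p) (xi j w * xi (j + l)%N w - c l)|.
Proof.
pose psi (u : (p + l).-tuple R) :=
  `|\sum_(0 <= j < p) (f (nth 0 u j) * f (nth 0 u (j + l)) - c l)|.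
have bpsi : bounded_measurable psi.
  apply: bmf_norm; apply: bmf_sum => j; apply: bmfB; last exact: bmf_cst.
  by apply: bmfM; exact: bnth.
have E (k : nat) w : psi (window X (p + l) k w) =
    `|\sum_(0 <= j < p) (xi (k + j)%N w * xi (k + j + l)%N w - c l)|.
  congr (`|_|); rewrite !big_nat; apply: eq_bigr => j /andP[_ jp].
  rewrite !nth_window; [|lia|lia].
  by congr (f (X _ w) * f (X _ w) - _); lia.
transitivity (\int[P]_w psi (window X (p + l) h w)).
  by apply: eq_Ex => w; rewrite E.
rewrite (Ex_window_shift X_stationary)//.
by apply: eq_Ex => w; rewrite -[0 : int]/(0%N : int) E.
Qed.

Let cE l i : c l = \int[P]_w (xi i w * xi (i + l)%N w).
Proof.
pose psi (u : l.+1.-tuple R) := f (nth 0 u 0) * f (nth 0 u l).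
have bpsi : bounded_measurable psi by apply: bmfM; exact: bnth.
have H (h : int) : \int[P]_w psi (window X l.+1 h w) =
    \int[P]_w (f (X (1 + h) w) * f (X (l.+1%:Z + h) w)).
  by apply: eq_Ex => w; rewrite /psi !nth_window.
have := H (-1); rewrite (Ex_window_shift X_stationary)// -(Ex_window_shift X_stationary i)//.
rewrite H subrr => /esym; congr (_ = _); apply: eq_Ex => w.
  by congr (f (X _ w) * f (X _ w)); lia.
by rewrite /xi; congr (f (X _ w) * f (X _ w)); lia.
Qed.

Lemma autocov_le l : (0 < l)%N -> `|c l| <= a l.
Proof.
move=> l0; rewrite (cE l 0).
have [_ H] := mf.
have := H 0 l (fun u => f (nth 0 u 0)) 1 l0 (@bnth 1 0) (fun u => f1 _).
rewrite mul1r; congr (`|_| <= _); apply: eq_Ex => w.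
by rewrite f_mean0 subr0 nth_window.
Qed.

Lemma autocov_series_cvg : cvgn (fun n => \sum_(1 <= k < n.+1) c k).
Proof.
have -> : (fun n => \sum_(1 <= k < n.+1) c k) = series (fun k => c k.+1).
  by apply/funext => n; rewrite /series/= big_add1.
apply: normed_cvg; apply: nondecreasing_is_cvgn.
  by apply: nondecreasing_series => k _ _; exact: normr_ge0.
exists (tau 0) => _ [n _ <-]; apply: le_trans (tail 0 n.+1).
rewrite big_add1 /series/=; apply: ler_sum => k _; exact: autocov_le.
Qed.

Definition asymptotic_variance : R := c 0 + 2 * limn (fun n => \sum_(1 <= k < n.+1) c k).

(** The mean of [lagged_products]: half of the asymptotic variance truncated at lag [L]. *)
Let v L := \sum_(0 <= i < L) c (L - i)%N + c 0 / 2.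

Let v_cvg : v @ \oo --> asymptotic_variance / 2.
Proof.
have -> : v = (fun L => \sum_(1 <= k < L.+1) c k + c 0 / 2).
  apply/funext => L; rewrite /v; congr (_ + _).
  rewrite big_nat_rev/= big_add1/= !big_nat; apply: eq_bigr => k /andP[_ kL].
  by congr c; lia.
rewrite (_ : asymptotic_variance / 2 = limn (fun n => \sum_(1 <= k < n.+1) c k) + c 0 / 2).
  by apply: cvgD; [exact: autocov_series_cvg|exact: cvg_cst].
by rewrite /asymptotic_variance; field.
Qed.

Let rho l p := \int[P]_w `|\sum_(0 <= j < p) (xi j w * xi (j + l)%N w - c l)|.

Let bprod l p : bounded_measurable (fun w => \sum_(0 <= j < p) (xi j w * xi (j + l)%N w - c l)).
Proof. by apply: bmf_sum => j; apply: bmfB; [exact: bmfM|exact: bmf_cst]. Qed.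

(** Boundedness turns the almost sure convergence of 2-ergodicity into convergence in L^1; lengths
    [p.+1] avoid the empty block. *)
Let rho_cvg l : (fun p => p.+1%:R^-1 * rho l p.+1) @ \oo --> 0.
Proof.
pose F (z : R * R) := f z.1 * f z.2.
have bF : bounded_measurable F.
  by apply: bmfM; apply: (bmf_comp bf); [exact: measurable_fst|exact: measurable_snd].
have [mF Fb] := bF.
have h := X_ergodic l mF Fb.
have EE : fine 'E_P[(fun w' => F (X 0 w', X l w'))] = c l by rewrite unlock.
rewrite EE in h.
have E p : p.+1%:R^-1 * rho l p.+1 =
    \int[P]_w `|p.+1%:R^-1 * \sum_(1 <= i < p.+2) F (X i w, X (i + l)%N w) - c l|.
  rewrite /rho -ExZ; last exact/bmf_norm/bprod.
  apply: eq_Ex => w.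
  rewrite -{1}(ger0_norm (_ : 0 <= p.+1%:R^-1 :> R))// -normrM; congr (`|_|).
  rewrite sumrB sumr_const_nat subn0 big_add1/= mulrBr -[c l *+ _]mulr_natl (mulrA _ p.+1%:R) mulVf ?pnatr_eq0// mul1r.
  by congr (_ - _); congr (_ * _); apply: eq_bigr => i _; rewrite /F/= /xi addSn.
under eq_fun do rewrite E.
have bG p : bounded_measurable (fun w =>
    `|p.+1%:R^-1 * \sum_(1 <= i < p.+2) F (X i w, X (i + l)%N w) - c l|).
  apply: bmf_norm; apply: bmfB; last exact: bmf_cst.
  apply: bmfM; first exact: bmf_cst.
  by apply: bmf_sum => i; apply: bmfM; exact: bfX.
have c1 : `|c l| <= 1.
  apply: norm_Ex_le_cst => [|w]; first exact: bmfM.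
  by rewrite normrM -[leRHS]mulr1 ler_pM.
suff H : \int[P]_w `|p.+1%:R^-1 * \sum_(1 <= i < p.+2) F (X i w, X (i + l)%N w) - c l|
    @[p --> \oo] --> \int[P]_w (0 : R) by rewrite Ex_cst in H.
apply: (Ex_bounded_cvg (B := 2)).
- by move=> p; have [] := bG p.
- move=> p w; rewrite normr_id (le_trans (ler_normB _ _))// [2]mulr2n lerD//.
  rewrite normrM ger0_norm ?invr_ge0// mulrC ler_pdivrMr// mul1r.
  rewrite (le_trans (ler_norm_sum _ _ _))//.
  apply: (@le_trans _ _ (\sum_(1 <= i < p.+2) 1)).
    by apply: ler_sum => i _; rewrite normrM -[leRHS]mulr1 ler_pM.
  by rewrite sumr_const_nat subn1.
- exact: measurable_cst.
- apply: filterS h => w h.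
  rewrite -(cvg_shiftS (fun n : nat => n%:R^-1 * \sum_(1 <= i < n.+1) F (X i w, X (i + l)%N w))) in h.
  have h2 : p.+1%:R^-1 * \sum_(1 <= i < p.+2) F (X i w, X (i + l)%N w) - c l
      @[p --> \oo] --> c l - c l by apply: cvgB => //; exact: cvg_cst.
  by have := cvg_norm h2; rewrite subrr normr0; exact.
Qed.

(** There are finitely many lags up to [L], so one block length serves them all. *)
Let rho_small L (e : R) : 0 < e -> exists2 p, (0 < p)%N &
  forall l, (l <= L)%N -> rho l p <= e * p%:R.
Proof.
move=> e0.
have [N HN] : exists N, forall p, (N <= p)%N -> forall l, (l <= L)%N ->
    rho l p.+1 <= e * p.+1%:R.
  elim: L => [|L [N HN]].
    have := cvgr_le _ (rho_cvg 0) _ e0 => -[N _ HN]; exists N => p Np l.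
    rewrite leqn0 => /eqP ->.
    by have := HN p Np; rewrite /= mulrC ler_pdivrMr.
  have := cvgr_le _ (rho_cvg L.+1) _ e0 => -[N' _ HN'].
  exists (maxn N N') => p; rewrite geq_max => /andP[Np N'p] l.
  rewrite leq_eqVlt ltnS => /predU1P[->|lL]; last exact: HN.
  by have := HN' p N'p; rewrite /= mulrC ler_pdivrMr.
by exists N.+1 => // l lL; exact: HN.
Qed.

Let erg L (e : R) : 0 < e -> exists2 p, (0 < p)%N &
  forall q, \int[P]_w `|\sum_(0 <= i < p) (lagged_products xi L (q + i)%N w - v L)| <= e * p%:R.
Proof.
move=> e0.
(* The lagged products split into [L] sums of products at positive lags and half of one at lag 0;
   each gets an equal share of [e]. *)
have e'0 : 0 < e / L.+1%:R by rewrite divr_gt0.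
have [p p0 Hp] := rho_small L e'0; exists p => // q.
pose D i w := \sum_(0 <= j < p) (xi (q + i + j)%N w * xi (q + i + j + (L - i))%N w - c (L - i)%N).
have bD i : bounded_measurable (D i).
  by apply: bmf_sum => j; apply: bmfB; [exact: bmfM|exact: bmf_cst].
have DE i : (i <= L)%N -> \int[P]_w `|D i w| <= e / L.+1%:R * p%:R.
  by move=> iL; rewrite /D shifted_products; apply: Hp; lia.
have QE w : \sum_(0 <= j < p) (lagged_products xi L (q + j)%N w - v L) =
    \sum_(0 <= i < L) D i w + 2^-1 * D L w.
  rewrite /D exchange_big/= mulr_sumr -big_split/=; apply: eq_bigr => j _.
  rewrite /lagged_products /v big_split/= sumrN mulr_suml subnn addn0.
  have -> : \sum_(0 <= i < L) xi (q + i + j)%N w * xi (q + i + j + (L - i))%N w =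
      \sum_(0 <= i < L) xi (q + j + i)%N w * xi (q + j + L)%N w.
    rewrite !big_nat; apply: eq_bigr => i /andP[_ iL].
    by congr (xi _ w * xi _ w); lia.
  by rewrite (_ : q + L + j = q + j + L)%N; [field|lia].
apply: (@le_trans _ _ (\int[P]_w (\sum_(0 <= i < L) `|D i w| + `|D L w|))).
  apply: le_Ex.
  - apply: bmf_norm; under eq_fun do rewrite QE.
    by apply: bmfD; [exact: bmf_sum|apply: bmfM => //; exact: bmf_cst].
  - by apply: bmfD; [apply: bmf_sum => i; exact: bmf_norm|exact: bmf_norm].
  move=> w; rewrite QE (le_trans (ler_normD _ _))// lerD ?ler_norm_sum//.
  rewrite normrM ger0_norm// ler_piMl//; lra.
rewrite ExD; [|by apply: bmf_sum => i; exact: bmf_norm|exact: bmf_norm].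
rewrite Ex_sum; last by move=> i; exact: bmf_norm.
apply: (@le_trans _ _ (\sum_(0 <= i < L) (e / L.+1%:R * p%:R) + e / L.+1%:R * p%:R)).
  rewrite lerD ?DE// !big_nat; apply: ler_sum => i /andP[_ iL].
  by rewrite DE// ltnW.
rewrite sumr_const_nat subn0 -mulrSr -[leLHS]mulr_natl le_eqVlt; apply/orP; left; apply/eqP.
by field.
Qed.

Lemma process_clt_cos (N : nat -> nat) (s : nat -> R) (t b : R) :
  s @ \oo --> 0 -> (fun k => (N k)%:R * s k ^+ 2) @ \oo --> t ->
  (fun k => \int[P]_w cos (s k * \sum_(0 <= i < N k) f (X i.+1 w) + b)) @ \oo -->
    expR (- (t * asymptotic_variance / 2)) * cos b.
Proof.
apply: (@clt_cos _ _ _ P xi 1 a tau v asymptotic_variance) => //.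
- by move=> k; have [] := bxi k.
- by move=> k w; exact: f1.
- by move=> k; rewrite /xi (Ex_shift X_stationary _ 0).
Qed.

(* Gives tightness of the normalized sums. *)
Lemma process_psum_sqr n :
  \int[P]_w ((\sum_(0 <= i < n) f (X i.+1 w)) ^+ 2) <= n%:R * (1 + 2 * tau 0).
Proof.
have t0 : 0 <= tau 0 by have := tail 0 0; rewrite big_geq.
have bS k : bounded_measurable (psum xi k) by rewrite /psum; exact: bmf_sum.
elim: n => [|n IH].
  rewrite mul0r; under eq_Rintegral do rewrite big_geq// expr0n.
  by rewrite Ex_cst.
have E : \int[P]_w ((\sum_(0 <= i < n.+1) f (X i.+1 w)) ^+ 2) =
   \int[P]_w (psum xi n w ^+ 2) + (2 * \sum_(0 <= i < n) \int[P]_w (xi i w * xi n w)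
     + \int[P]_w (xi n w ^+ 2)).
  rewrite -Ex_sum; last by move=> i; exact: bmfM.
  rewrite -ExZ; last by apply: bmf_sum => i; exact: bmfM.
  rewrite -ExD; [|by bmf|by bmf].
  rewrite -ExD; [|by bmf|by bmf].
  apply: eq_Ex => w; rewrite big_nat_recr//= -mulr_suml -/(psum xi n w) -/(xi n w).
  by rewrite /psum; ring.
rewrite E -[n.+1%:R]natr1 [leRHS]mulrDl mul1r; apply: lerD; first exact: IH.
rewrite [leRHS]addrC; apply: lerD.
  rewrite ler_wpM2l//; apply: le_trans (tail 0 n.+1).
  rewrite big_nat_rev/= big_add1/= !big_nat; apply: ler_sum => i /andP[_ ni].
  apply: (le_trans (ler_norm _)); apply: le_trans (autocov_le (ltn0Sn i)).
  rewrite (cE i.+1 (0 + n - i.+1)).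
  by rewrite le_eqVlt; apply/orP; left; apply/eqP; congr (`|_|); apply: eq_Ex => w; congr (_ * xi _ w); lia.
apply: (le_trans (ler_norm _)); apply: norm_Ex_le_cst => [|w]; first by bmf.
by rewrite normrX; apply: exprn_ile1 => //; exact: f1.
Qed.

End process_clt.

(** * Hoeffding decomposition *)

Definition process_generators d (T : measurableType d) (R : realType)
    (P : probability T R) (X : int -> {RV P >-> R}) : set (set T) :=
  \bigcup_(i in setT) preimage_set_system setT (X i) measurable.

Lemma measurable_process d (T : measurableType d) (R : realType)
  (P : probability T R) (X : int -> {RV P >-> R}) i :
  measurable_fun setT (X i : g_sigma_algebraType (process_generators X) -> R).
Proof.
move=> _ U mU; rewrite setTI; apply: sub_sigma_algebra.
by exists i => //; exists U => //; rewrite setTI.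
Qed.

Section independent_processes.
Context d (T : measurableType d) (R : realType) (P : probability T R).
Variables X Y : int -> {RV P >-> R}.
Hypothesis XY_independent : independent_processes X Y.

Lemma Ex_independent_processes d1 d2 (E1 : measurableType d1)
  (E2 : measurableType d2) (U : T -> E1) (V : T -> E2) (h : E1 * E2 -> R) :
  measurable_fun setT (U : g_sigma_algebraType (process_generators X) -> E1) ->
  measurable_fun setT (V : g_sigma_algebraType (process_generators Y) -> E2) ->
  bounded_measurable h ->
  \int[P]_w h (U w, V w) = \int[P]_w' (\int[P]_w h (U w, V w')).
Proof.
move=> mU mV bh.
have sU A : measurable A -> sigma_process X setT (U @^-1` A).
  by move=> mA; have := mU measurableT A mA; rewrite setTI.
have sV A : measurable A -> sigma_process Y setT (V @^-1` A).
  by move=> mA; have := mV measurableT A mA; rewrite setTI.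
have [_ GX] := sigma_processP X setT; have [_ GY] := sigma_processP Y setT.
apply: Ex_independent => //.
- by move=> _ A mA; rewrite setTI; apply: GX; exact: sU.
- by move=> _ A mA; rewrite setTI; apply: GY; exact: sV.
- by move=> A B mA mB; apply: XY_independent; [exact: sU|exact: sV].
Qed.

End independent_processes.

Lemma bmf_ltr d (T : measurableType d) (R : realType) (f g : T -> R) :
  measurable_fun setT f -> measurable_fun setT g ->
  bounded_measurable (fun w => (f w < g w)%R%:R : R).
Proof.
move=> mf mg.
have -> : (fun w => (f w < g w)%R%:R : R) = (fun w => (f w - g w < 0)%R%:R).
  by apply/funext => w; rewrite subr_lt0.
by apply: (bmf_comp (bmf_lt 0)); exact: measurable_funB.
Qed.

(** * Covariances of centred mixing functions *)

Section centered_mixing.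
Context d (T : measurableType d) (R : realType) (P : probability T R).
Variable X : int -> {RV P >-> R}.
Variable a : nat -> R.

(** Tailored to the sections of [hoeffding_rest]: with one argument fixed, the kernel is an
    indicator minus [H_] or [G_], both centred. The bound 2 and the two mixing parts together give
    the factor 4 in the covariance estimate. *)
Definition centered_mixing (q : R -> R) := (forall x, `|q x| <= 2) /\
  exists e h, [/\ mixes X a e, mixes X a h &
    forall x, q x = (e x - \int[P]_w e (X 0 w)) - (h x - \int[P]_w h (X 0 w))].

Lemma bmf_centered_mixing q : centered_mixing q -> bounded_measurable q.
Proof.
move=> [_ [e [h [[be _] [bh _] E]]]].
rewrite (_ : q = (fun x => (e x - \int[P]_w e (X 0 w)) - (h x - \int[P]_w h (X 0 w)))).
  by apply: bmfB; apply: bmfB => //; exact: bmf_cst.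
exact/funext.
Qed.

Let bX (e : R -> R) (i : int) : bounded_measurable e ->
  bounded_measurable (fun w => e (X i w)).
Proof. by move=> be; apply: (bmf_comp be); exact: measurable_funPT. Qed.

(* The index [(i - k) + (k - i)] is the distance between [i] and [k]. *)
Lemma centered_mixing_cov q q' i k : centered_mixing q -> centered_mixing q' ->
  `|\int[P]_w (q (X i.+1 w) * q' (X k.+1 w))| <=
    4 * (if i == k then 1 else a ((i - k) + (k - i))).
Proof.
have main p p' i' l : centered_mixing p -> centered_mixing p' -> (0 < l)%N ->
    `|\int[P]_w (p (X i'.+1 w) * p' (X (i'.+1 + l)%N w))| <= 4 * a l.
  move=> cp cp' l0; have bp := bmf_centered_mixing cp; have [pB _] := cp.
  have [_ [e [h [[be me] [bh mh] E]]]] := cp'.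
  have bphi : @bounded_measurable _ (i'.+1.-tuple R) R (fun u => p (nth 0 u i')).
    by apply: (bmf_comp bp); exact: measurable_nth.
  have := me _ _ _ _ l0 bphi (fun u => pB _).
  have := mh _ _ _ _ l0 bphi (fun u => pB _).
  set I1 := \int[P]_w _; set I2 := \int[P]_w _ => h1 h2.
  have -> : \int[P]_w (p (X i'.+1 w) * p' (X (i'.+1 + l)%N w)) = I2 - I1.
    rewrite -ExB; last 2 first.
    - apply: bmfM; first exact: (bmf_comp bphi (@measurable_window _ _ _ _ _ _ _)).
      by apply: bmfB; [exact: bX|exact: bmf_cst].
    - apply: bmfM; first exact: (bmf_comp bphi (@measurable_window _ _ _ _ _ _ _)).
      by apply: bmfB; [exact: bX|exact: bmf_cst].
    by apply: eq_Ex => w; rewrite nth_window// addr0 E; ring.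
  rewrite (le_trans (ler_normB _ _))// (_ : 4 * a l = 2 * a l + 2 * a l); last by ring.
  exact: (lerD h2 h1).
move=> cq cq'.
have [ik|ki|->] := ltngtP i k.
- have := main q q' i (k - i)%N cq cq'; rewrite subn_gt0 => /(_ ik).
  rewrite (_ : (i - k = 0)%N) ?add0n; last by apply/eqP; rewrite subn_eq0 ltnW.
  by congr (`|_| <= _); apply: eq_Ex => w; congr (_ * q' (X _ w)); lia.
- have := main q' q k (i - k)%N cq' cq; rewrite subn_gt0 => /(_ ki).
  rewrite (_ : (k - i = 0)%N) ?addn0; last by apply/eqP; rewrite subn_eq0 ltnW.
  by congr (`|_| <= _); apply: eq_Ex => w; rewrite mulrC; congr (q (X _ w) * _); lia.
- rewrite mulr1; apply: norm_Ex_le_cst => [|w].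
    by apply: bmfM; apply: bX; exact: bmf_centered_mixing.
  rewrite normrM (_ : 4 = 2 * 2); last by rewrite -natrM.
  by apply: ler_pM => //; [case: cq|case: cq'].
Qed.

End centered_mixing.

(** Each distance from [i] occurs at most twice, once on either side. *)
Lemma sum_distance_le (R : realDomainType) (phi : nat -> R) n i : (forall u, 0 <= phi u) ->
  (i < n)%N ->
  \sum_(0 <= k < n) phi ((i - k) + (k - i))%N <= 2 * \sum_(0 <= u < n) phi u.
Proof.
move=> phi0 ilt.
have mono N : (N <= n)%N -> \sum_(0 <= u < N) phi u <= \sum_(0 <= u < n) phi u.
  by move=> Nn; rewrite [leRHS](big_cat_nat _ (n := N))//= lerDl sumr_ge0.
rewrite (big_cat_nat _ (n := i.+1))//= [2]mulr2n mulrDl mul1r lerD//.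
  apply: le_trans (mono _ ilt); rewrite big_nat_rev/= !big_nat.
  rewrite le_eqVlt; apply/orP; left; apply/eqP; apply: eq_bigr => u /andP[_ ui].
  by congr phi; lia.
apply: le_trans (mono (n - i.+1).+1 _); last by lia.
rewrite -[X in \sum_(X <= _ < _) _]add0n big_addn big_nat_recl//= ler_wpDl//.
rewrite !big_nat le_eqVlt; apply/orP; left; apply/eqP.
by apply: eq_bigr => u /andP[_ ui]; congr phi; lia.
Qed.

Section hoeffding.
Context d (T : measurableType d) (R : realType) (P : probability T R).
Variables X Y : int -> {RV P >-> R}.
Hypotheses (X_stationary : strictly_stationary X) (Y_stationary : strictly_stationary Y).
Hypothesis XY_independent : independent_processes X Y.
Variables (a tau b sigma : nat -> R).
Hypothesis a_alpha : forall k, (0 < k)%N -> alpha1 X k = (a k)%:E.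
Hypothesis a_ge0 : forall k, 0 <= a k.
Hypothesis a_tail : forall L n, \sum_(L.+1 <= l < n) a l <= tau L.
Hypothesis b_alpha : forall k, (0 < k)%N -> alpha1 Y k = (b k)%:E.
Hypothesis b_ge0 : forall k, 0 <= b k.
Hypothesis b_tail : forall L n, \sum_(L.+1 <= l < n) b l <= sigma L.

Local Notation H := (H_ Y).
Local Notation G := (G_ X).
Local Notation PI := (prob_lt X Y).

Let mX i : measurable_fun setT (X i). Proof. exact: measurable_funPT. Qed.
Let mY i : measurable_fun setT (Y i). Proof. exact: measurable_funPT. Qed.

Let probE (f g : T -> R) : measurable_fun setT f -> measurable_fun setT g ->
  fine (P [set w | f w < g w]) = \int[P]_w (f w < g w)%R%:R.
Proof.
move=> mf mg.
have mA : measurable [set w | f w < g w].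
  have := measurable_funB mg mf measurableT (measurable_itv `]0, +oo[).
  rewrite setTI; congr measurable; apply/seteqP; split => w /=;
  by rewrite in_itv/= andbT subr_gt0.
have -> : \int[P]_w (f w < g w)%R%:R = \int[P]_w \1_[set w | f w < g w] w.
  by apply: eq_Ex => w; rewrite indicE; congr (nat_of_bool _)%:R;
    apply/idP/idP; rewrite inE.
by rewrite /Rintegral integral_indic ?setIT.
Qed.

Lemma H_E x : H x = \int[P]_w (x < Y 1 w)%R%:R. Proof. exact: (probE (f := cst x)). Qed.
Lemma G_E y : G y = \int[P]_w (X 1 w < y)%R%:R. Proof. exact: (probE (g := cst y)). Qed.
Lemma PI_E : PI = \int[P]_w (X 1 w < Y 1 w)%R%:R. Proof. exact: probE. Qed.

Let in01 (f g : T -> R) : measurable_fun setT f -> measurable_fun setT g ->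
  0 <= \int[P]_w (f w < g w)%R%:R <= 1.
Proof.
move=> mf mg; apply/andP; split.
  by apply: Rintegral_ge0 => w _; rewrite ler0n.
rewrite -[leRHS](Ex_cst P); apply: le_Ex; [exact: bmf_ltr|exact: bmf_cst|move=> w].
by case: (_ < _); rewrite ?ler01.
Qed.

Lemma H_01 x : 0 <= H x <= 1. Proof. by rewrite H_E; exact: (in01 (f := cst x)). Qed.
Lemma G_01 y : 0 <= G y <= 1. Proof. by rewrite G_E; exact: (in01 (g := cst y)). Qed.
Lemma PI_01 : 0 <= PI <= 1. Proof. by rewrite PI_E; exact: in01. Qed.

Let beH : bounded_measurable (fun z : R * T => (z.1 < Y 1 z.2)%R%:R : R).
Proof. by apply: bmf_ltr => //; apply: measurableT_comp. Qed.

Let beG : bounded_measurable (fun z : R * T => (X 1 z.2 < z.1)%R%:R : R).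
Proof. by apply: bmf_ltr => //; apply: measurableT_comp. Qed.

Lemma mixes_H : mixes X a H.
Proof.
rewrite (_ : H = fun x => \int[P]_w (x < Y 1 w)%R%:R); last exact/funext/H_E.
by apply: (mixes_mixture P beH) => w; exact: (mixes_lt X_stationary a_alpha (Y 1 w)).
Qed.

Lemma mixes_G : mixes Y b G.
Proof.
rewrite (_ : G = fun y => \int[P]_w (X 1 w < y)%R%:R); last exact/funext/G_E.
by apply: (mixes_mixture P beG) => w; exact: (mixes_gt Y_stationary b_alpha (X 1 w)).
Qed.

Let bH : bounded_measurable H. Proof. by case: mixes_H. Qed.
Let bG : bounded_measurable G. Proof. by case: mixes_G. Qed.

Let bltR : bounded_measurable (fun z : R * R => (z.1 < z.2)%R%:R : R).
Proof. by apply: bmf_ltr. Qed.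

Lemma Ex_H : \int[P]_w H (X 0 w) = PI.
Proof.
rewrite (Ex_shift X_stationary 0 1 bH) PI_E.
rewrite (Ex_independent_processes XY_independent (U := X 1) (V := Y 1)
  (h := fun z : R * R => (z.1 < z.2)%R%:R : R)); [|exact: measurable_process..|exact: bltR].
rewrite -(Ex_swap P P (h := fun z : T * T => (X 1 z.1 < Y 1 z.2)%R%:R)).
  by apply: eq_Ex => w; rewrite H_E.
by apply: bmf_ltr; apply: measurableT_comp.
Qed.

Lemma Ex_G : \int[P]_w G (Y 0 w) = PI.
Proof.
rewrite (Ex_shift Y_stationary 0 1 bG) PI_E.
rewrite (Ex_independent_processes XY_independent (U := X 1) (V := Y 1)
  (h := fun z : R * R => (z.1 < z.2)%R%:R : R)); [|exact: measurable_process..|exact: bltR].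
by apply: eq_Ex => w; rewrite G_E.
Qed.

(** The degenerate part of the kernel: with either argument fixed, it has mean zero in the other. *)
Definition hoeffding_rest (x y : R) : R := (x < y)%R%:R - H x - G y + PI.
Local Notation r := hoeffding_rest.

Let r2 x y : `|r x y| <= 2.
Proof.
rewrite ler_norml /r; have := H_01 x; have := G_01 y; have := PI_01.
by case: (x < y) => /=; lra.
Qed.

Lemma centered_mixing_restX y : centered_mixing X a (r ^~ y).
Proof.
split=> [x|]; first exact: r2.
exists (fun x => (x < y)%R%:R), H; split; [exact: mixes_lt|exact: mixes_H|].
move=> x; rewrite Ex_H /r (Ex_shift X_stationary 0 1 (bmf_lt y)) -G_E.
by ring.
Qed.

Lemma centered_mixing_restY x : centered_mixing Y b (r x).
Proof.
split=> [y|]; first exact: r2.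
exists (fun y => (x < y)%R%:R), G; split; [exact: mixes_gt|exact: mixes_G|].
have [bgt _] := mixes_gt Y_stationary b_alpha x.
move=> y; rewrite Ex_G /r (Ex_shift Y_stationary 0 1 bgt) -H_E.
by ring.
Qed.

Let br : bounded_measurable (fun z : R * R => r z.1 z.2).
Proof.
apply: bmfD; last exact: bmf_cst.
apply: bmfB; first apply: bmfB => //.
- by apply: (bmf_comp bH); exact: measurable_fst.
- by apply: (bmf_comp bG); exact: measurable_snd.
Qed.

Let br_comp d' (T' : measurableType d') (f g : T' -> R) :
  measurable_fun setT f -> measurable_fun setT g ->
  bounded_measurable (fun w => r (f w) (g w)).
Proof.
by move=> mf mg; exact: (bmf_comp br (g := fun w => (f w, g w)) (measurable_fun_pair mf mg)).
Qed.

Let brXY i j : bounded_measurable (fun w => r (X i w) (Y j w)).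
Proof. exact: br_comp. Qed.

(** At lag 0 the coefficient is replaced by 1, so that the factor 4 gives the trivial bound coming
    from [|r| <= 2]. *)
Let A u := if u == 0%N then 1 else a u.
Let B u := if u == 0%N then 1 else b u.
Let dist (i k : nat) := ((i - k) + (k - i))%N.

Let dist0 i k : (dist i k == 0%N) = (i == k).
Proof. by rewrite /dist; apply/idP/idP; lia. Qed.

Let rest_cov i j k l :
  `|\int[P]_w (r (X i.+1 w) (Y j.+1 w) * r (X k.+1 w) (Y l.+1 w))| <= 4 * A (dist i k) /\
  `|\int[P]_w (r (X i.+1 w) (Y j.+1 w) * r (X k.+1 w) (Y l.+1 w))| <= 4 * B (dist j l).
Proof.
pose h (z : (R * R) * (R * R)) := r z.1.1 z.2.1 * r z.1.2 z.2.2.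
have bh : bounded_measurable h.
  by apply: bmfM; apply: br_comp; apply: measurableT_comp.
have E : \int[P]_w (r (X i.+1 w) (Y j.+1 w) * r (X k.+1 w) (Y l.+1 w)) =
    \int[P]_w' \int[P]_w (r (X i.+1 w) (Y j.+1 w') * r (X k.+1 w) (Y l.+1 w')).
  apply: (Ex_independent_processes XY_independent (U := fun w => (X i.+1 w, X k.+1 w))
    (V := fun w => (Y j.+1 w, Y l.+1 w)) (h := h)) => //.
  - by apply: measurable_fun_pair; exact: measurable_process.
  - by apply: measurable_fun_pair; exact: measurable_process.
pose h2 (z : T * T) := r (X i.+1 z.1) (Y j.+1 z.2) * r (X k.+1 z.1) (Y l.+1 z.2).
have bh2 : bounded_measurable h2.
  by apply: bmfM; apply: br_comp; apply: measurableT_comp.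
rewrite E; split.
  apply: norm_Ex_le_cst; first exact: (bmf_partial_Ex2 P P bh2).
  move=> w'; rewrite /A dist0.
  exact: (centered_mixing_cov i k (centered_mixing_restX (Y j.+1 w')) (centered_mixing_restX (Y l.+1 w'))).
rewrite -(Ex_swap P P bh2).
apply: norm_Ex_le_cst; first exact: (bmf_partial_Ex1 P P bh2).
move=> w'; rewrite /B dist0 /h2 /=.
exact: (centered_mixing_cov j l (centered_mixing_restY (X i.+1 w')) (centered_mixing_restY (X k.+1 w'))).
Qed.

Let B_ge0 u : 0 <= B u. Proof. by rewrite /B; case: eqP. Qed.

Let tau_ge0 L : 0 <= tau L. Proof. by have := a_tail L 0; rewrite big_geq. Qed.
Let sigma_ge0 L : 0 <= sigma L. Proof. by have := b_tail L 0; rewrite big_geq. Qed.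

(* Each covariance is bounded through [X] at lags larger than [L] and through
   [Y] at smaller lags. *)
Lemma rest_sqr_le n m L :
  \int[P]_w ((\sum_(0 <= i < n) \sum_(0 <= j < m) r (X i.+1 w) (Y j.+1 w)) ^+ 2)
  <= 16 * n%:R * m%:R * (L.+1%:R * (1 + sigma 0)) + 8 * n%:R * m%:R ^+ 2 * tau L.
Proof.
pose near_ u : R := (u <= L)%N%:R.
pose far u : R := if (u <= L)%N then 0 else a u.
have near_ge0 u : 0 <= near_ u by rewrite ler0n.
have far_ge0 u : 0 <= far u by rewrite /far; case: ifP.
have E : \int[P]_w ((\sum_(0 <= i < n) \sum_(0 <= j < m) r (X i.+1 w) (Y j.+1 w)) ^+ 2) =
  \sum_(0 <= i < n) \sum_(0 <= k < n) \sum_(0 <= j < m) \sum_(0 <= l < m)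
    \int[P]_w (r (X i.+1 w) (Y j.+1 w) * r (X k.+1 w) (Y l.+1 w)).
  have br2 i j k l : bounded_measurable
    (fun w => r (X i.+1 w) (Y j.+1 w) * r (X k.+1 w) (Y l.+1 w)) by exact: bmfM.
  transitivity (\int[P]_w \sum_(0 <= i < n) \sum_(0 <= k < n) \sum_(0 <= j < m) \sum_(0 <= l < m)
    (r (X i.+1 w) (Y j.+1 w) * r (X k.+1 w) (Y l.+1 w))).
    apply: eq_Ex => w; rewrite expr2 mulr_suml; apply: eq_bigr => i _.
    rewrite mulr_sumr; apply: eq_bigr => k _.
    rewrite mulr_suml; apply: eq_bigr => j _.
    by rewrite mulr_sumr.
  rewrite Ex_sum; last by move=> i; do 3 (apply: bmf_sum => ?).
  apply: eq_bigr => i _; rewrite Ex_sum; last by move=> k; do 2 (apply: bmf_sum => ?).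
  apply: eq_bigr => k _; rewrite Ex_sum; last by move=> j; apply: bmf_sum => ?.
  by apply: eq_bigr => j _; rewrite Ex_sum.
rewrite E.
apply: (@le_trans _ _ (\sum_(0 <= i < n) \sum_(0 <= k < n) \sum_(0 <= j < m) \sum_(0 <= l < m)
    (4 * (near_ (dist i k) * B (dist j l) + far (dist i k))))).
  apply: ler_sum => i _; apply: ler_sum => k _; apply: ler_sum => j _; apply: ler_sum => l _.
  apply: (le_trans (ler_norm _)).
  have [h1 h2] := rest_cov i j k l.
  rewrite /near_ /far; case: leqP => hL; first by rewrite mul1r addr0.
  rewrite mul0r add0r; apply: (le_trans h1); rewrite /A.
  by case: eqP => // d0; move: hL; rewrite d0.
(* Row sums. The near part leaves at most [2 * L.+1] choices of [k] and a bounded sum over [l],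
   hence the order n m; the far part leaves [j] and [l] free, hence n m^2, but carries the small
   factor [tau L]. *)
have sB j : (j < m)%N -> \sum_(0 <= l < m) B (dist j l) <= 2 * (1 + sigma 0).
  move=> jm; apply: (le_trans (sum_distance_le B_ge0 jm)); rewrite ler_wpM2l//.
  have m0 : (0 < m)%N by exact: leq_ltn_trans jm.
  rewrite (big_cat_nat _ (n := 1))//= big_nat1 {1}/B eqxx lerD//.
  apply: le_trans (b_tail 0 m); rewrite !big_nat; apply: ler_sum => u /andP[u0 _].
  by rewrite /B; case: eqP u0 => // ->.
have snear i : (i < n)%N -> \sum_(0 <= k < n) near_ (dist i k) <= 2 * L.+1%:R.
  move=> iln; apply: (le_trans (sum_distance_le near_ge0 iln)); rewrite ler_wpM2l//.
  have N0 N : \sum_(L.+1 <= u < N) near_ u = 0.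
    by rewrite big_nat big1// => u /andP[Lu _]; rewrite /near_ leqNgt Lu.
  have le1 N : \sum_(0 <= u < N) near_ u <= N%:R.
    apply: (@le_trans _ _ (\sum_(0 <= u < N) 1)); last by rewrite sumr_const_nat subn0.
    by apply: ler_sum => u _; rewrite /near_; case: (_ <= _)%N; rewrite ?ler01.
  have [nL|Ln] := leqP n L.+1; first by apply: (le_trans (le1 _)); rewrite ler_nat.
  by rewrite (big_cat_nat _ (n := L.+1))//= 1?ltnW// N0 addr0.
have sfar i : (i < n)%N -> \sum_(0 <= k < n) far (dist i k) <= 2 * tau L.
  move=> iln; apply: (le_trans (sum_distance_le far_ge0 iln)); rewrite ler_wpM2l//.
  have N0 N : (N <= L.+1)%N -> \sum_(0 <= u < N) far u = 0.
    move=> NL; rewrite big_nat big1// => u /andP[_ uN]; rewrite /far.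
    by rewrite (_ : (u <= L)%N)// -ltnS (leq_trans uN).
  have [nL|Ln] := leqP n L.+1; first by rewrite N0.
  rewrite (big_cat_nat _ (n := L.+1))//= 1?ltnW// N0// add0r.
  apply: le_trans (a_tail L n); rewrite le_eqVlt; apply/orP; left; apply/eqP.
  by rewrite !big_nat; apply: eq_bigr => u /andP[Lu _]; rewrite /far leqNgt Lu.
apply: (@le_trans _ _ (\sum_(0 <= i < n) \sum_(0 <= k < n)
   (4 * (near_ (dist i k) * (m%:R * (2 * (1 + sigma 0))) + m%:R ^+ 2 * far (dist i k))))).
  apply: ler_sum => i _; apply: ler_sum => k _.
  under eq_bigr do rewrite -mulr_sumr.
  rewrite -mulr_sumr ler_wpM2l//.
  under eq_bigr do rewrite big_split/= -mulr_sumr.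
  rewrite big_split/= lerD//.
    rewrite -mulr_sumr ler_wpM2l//.
    apply: (@le_trans _ _ (\sum_(0 <= j < m) (2 * (1 + sigma 0)))).
      by rewrite !big_nat; apply: ler_sum => j /andP[_ jm]; exact: sB.
    by rewrite sumr_const_nat subn0 -[leLHS]mulr_natl.
  by rewrite !sumr_const_nat !subn0 -mulrnA -[leLHS]mulr_natl natrM expr2.
apply: (@le_trans _ _ (\sum_(0 <= i < n)
   (4 * (2 * L.+1%:R * (m%:R * (2 * (1 + sigma 0))) + m%:R ^+ 2 * (2 * tau L))))).
  rewrite !big_nat; apply: ler_sum => i /andP[_ iln].
  rewrite -mulr_sumr ler_wpM2l// big_split/= -mulr_suml -mulr_sumr lerD//.
    by rewrite ler_wpM2r ?snear// !mulr_ge0// addr_ge0.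
  by rewrite ler_wpM2l ?sfar// exprn_ge0.
rewrite sumr_const_nat subn0 -[leLHS]mulr_natl le_eqVlt; apply/orP; left; apply/eqP.
by ring.
Qed.

End hoeffding.

(** * The Mann-Whitney statistic *)

Lemma centered_normal_cos (R : realType) (V t b : R) : 0 <= V ->
  \int[centered_normal V]_x cos (t * x + b) = expR (- (t ^+ 2 * V / 2)) * cos b.
Proof.
move=> V0; rewrite /centered_normal; case: eqP => [->|/eqP Vn0].
  rewrite mulr0 mul0r oppr0 expR0 mul1r /Rintegral integral_dirac//.
    by rewrite diracT mul1e/= mulr0 add0r.
  apply/measurable_EFinP.
  by have [] := @bmf_cos _ (measurableTypeR R) R (fun x => t * x + b) _;
    [apply: measurable_funD => //; exact: measurable_funM|].
by rewrite normal_cos ?sqr_sqrtr// gt_eqF// sqrtr_gt0 lt_neqAle eq_sym Vn0.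
Qed.

Section covariances.
Context d (T : measurableType d) (R : realType) (P : probability T R).
Variable X : int -> {RV P >-> R}.
Hypothesis X_stationary : strictly_stationary X.
Variables (g : R -> R) (p : R).
Hypotheses (bg : bounded_measurable g) (gp : \int[P]_w g (X 0 w) = p).

Let f x := g x - p.

Lemma autocovE k : autocov X f k = fine (covariance P (g \o X 0) (g \o X k)).
Proof.
have E i : fine 'E_P[g \o X i] = p.
  by rewrite unlock -[RHS]gp; exact: (Ex_shift X_stationary i 0 bg).
by rewrite covariance.unlock !E unlock.
Qed.

Lemma cov_sumE : cov_sum g X = (fun n => \sum_(1 <= k < n.+1) autocov X f k).
Proof. by apply/funext => n; apply: eq_bigr => k _; rewrite autocovE. Qed.

Lemma long_run_varianceE : long_run_variance g X = asymptotic_variance X f.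
Proof. by rewrite /long_run_variance /asymptotic_variance autocovE cov_sumE. Qed.

Lemma mixes_center a : mixes X a g -> mixes X a f.
Proof.
move=> [_ mg]; split=> [|j k phi B k0 bphi phiB]; first by apply: bmfB => //; exact: bmf_cst.
have bgX : bounded_measurable (fun w => g (X 0 w)).
  by apply: (bmf_comp bg); exact: measurable_funPT.
have -> : \int[P]_w f (X 0 w) = \int[P]_w g (X 0 w) - p.
  by rewrite ExB ?Ex_cst//; exact: bmf_cst.
have fE w x : f (X w x) - (\int[P]_w g (X 0 w) - p) = g (X w x) - \int[P]_w g (X 0 w).
  by rewrite /f opprB addrA subrK.
by under eq_Ex do rewrite fE; exact: mg.
Qed.

Lemma Ex_center : \int[P]_w f (X 0 w) = 0.
Proof.
rewrite ExB ?gp; [by rewrite Ex_cst subrr| |exact: bmf_cst].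
by apply: (bmf_comp bg); exact: measurable_funPT.
Qed.

End covariances.

(** * Normalization for a sample size comparable with the index *)

Section scaling.
Context {R : realType}.
Variables (N : nat -> nat) (c : R).
Hypothesis Nc : (fun k => k%:R / (N k)%:R : R) @ \oo --> c.

(** 1 / N_k is the product of k / N_k and 1 / k. The index is shifted because this may fail at
    [k = 0]. *)
Lemma inv_size_cvg0 : (fun k => (N k)%:R^-1 : R) @ \oo --> 0.
Proof.
have H : (fun k => (N k.+1)%:R^-1 : R) @ \oo --> (0 : R).
  have -> : (fun k => (N k.+1)%:R^-1 : R) = (fun k => (k.+1%:R / (N k.+1)%:R) * harmonic k).
    by apply/funext => k; rewrite /harmonic mulrAC mulfV ?pnatr_eq0// mul1r.
  rewrite -[X in _ --> X](mulr0 c); apply: cvgM; last exact: cvg_harmonic.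
  by rewrite (cvg_shiftS (fun k => k%:R / (N k)%:R : R)).
by rewrite -(cvg_shiftS (fun k => (N k)%:R^-1 : R)).
Qed.

Lemma sqr_scale t k : (N k)%:R * (t * (Num.sqrt k%:R * (N k)%:R^-1)) ^+ 2 = t ^+ 2 * (k%:R / (N k)%:R) :> R.
Proof.
rewrite !exprMn sqr_sqrtr//.
(* If [N k = 0], its inverse is 0 by convention and both sides vanish. *)
have [->|Nk] := eqVneq ((N k)%:R : R) 0; first by rewrite !invr0 mul0r !mulr0.
by field.
Qed.

Lemma scale_cvg0 t : (fun k => t * (Num.sqrt k%:R * (N k)%:R^-1) : R) @ \oo --> 0.
Proof.
rewrite -[X in _ --> X](mulr0 t); apply: cvgM; first exact: cvg_cst.
have -> : (fun k => Num.sqrt k%:R * (N k)%:R^-1 : R) =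
    (fun k => Num.sqrt (k%:R / (N k)%:R * (N k)%:R^-1)).
  apply/funext => k; rewrite -mulrA -expr2 sqrtrM// sqrtr_sqr ger0_norm//.
rewrite -[X in _ --> X]sqrtr0; apply: continuous_cvg; first exact: sqrt_continuous.
by rewrite -[X in _ --> X](mulr0 c); apply: cvgM => //; exact: inv_size_cvg0.
Qed.

Lemma sqr_scale_cvg t :
  (fun k => (N k)%:R * (t * (Num.sqrt k%:R * (N k)%:R^-1)) ^+ 2) @ \oo --> t ^+ 2 * c.
Proof.
under eq_fun do rewrite sqr_scale.
by apply: cvgM => //; exact: cvg_cst.
Qed.

Lemma ratio_bounded : exists C, forall k, k%:R / (N k)%:R <= C :> R.
Proof.
have [M [_ HM]] := cvg_seq_bounded (cvgP _ Nc).
exists (M + 1) => k; rewrite (le_trans (ler_norm _))//; apply: HM => //.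
by rewrite ltrDl.
Qed.

End scaling.

Section scaled_sums.
Context d (T : measurableType d) (R : realType) (P : probability T R).
Variable X : int -> {RV P >-> R}.
Hypotheses (X_stationary : strictly_stationary X) (X_ergodic : two_ergodic X).
Variables (a tau : nat -> R).
Hypothesis tail : forall L n, \sum_(L.+1 <= l < n) a l <= tau L.
Hypothesis tau0 : tau @ \oo --> 0.
Variable f : R -> R.
Hypothesis mf : mixes X a f.
Hypothesis f1 : forall x, `|f x| <= 1.
Hypothesis f_mean0 : \int[P]_w f (X 0 w) = 0.
Variables (N : nat -> nat) (c : R).
Hypothesis Nc : (fun k => k%:R / (N k)%:R : R) @ \oo --> c.

(** The form common to both linear parts: [N] is the identity for [X] and [m] for [Y], with the same
    [k] under the root. *)
Definition scaled_sum (k : nat) (w : T) : R :=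
  Num.sqrt k%:R * (N k)%:R^-1 * \sum_(0 <= i < N k) f (X i.+1 w).

Lemma scaled_sum_cos t b : (fun k => \int[P]_w cos (t * scaled_sum k w + b)) @ \oo -->
  expR (- (t ^+ 2 * c * asymptotic_variance X f / 2)) * cos b.
Proof.
have h : (fun k => \int[P]_w cos (t * (Num.sqrt k%:R * (N k)%:R^-1) *
      \sum_(0 <= i < N k) f (X i.+1 w) + b)) @ \oo -->
    expR (- (t ^+ 2 * c * asymptotic_variance X f / 2)) * cos b.
  apply: (process_clt_cos X_stationary X_ergodic tail tau0 mf f1 f_mean0).
  - exact: (scale_cvg0 Nc).
  - exact: (sqr_scale_cvg Nc).
rewrite (_ : (fun k => _) = (fun k => \int[P]_w cos (t * (Num.sqrt k%:R * (N k)%:R^-1) *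
      \sum_(0 <= i < N k) f (X i.+1 w) + b)))//.
by apply/funext => k; apply: eq_Ex => w; rewrite /scaled_sum mulrA.
Qed.

Lemma bmf_scaled_sum k : bounded_measurable (scaled_sum k).
Proof.
have [bf _] := mf.
apply: bmfM; first exact: bmf_cst.
by apply: bmf_sum => i; apply: (bmf_comp bf); exact: measurable_funPT.
Qed.

(** Measurability for the sigma-algebra of the process itself, in terms of which independence is
    expressed. *)
Lemma measurable_scaled_sum k :
  measurable_fun setT (scaled_sum k : g_sigma_algebraType (process_generators X) -> R).
Proof.
have [[mf' _] _] := mf.
apply: measurable_funM; first exact: measurable_cst.
apply: measurable_sum => i; apply: (measurableT_comp mf'); exact: measurable_process.
Qed.

Lemma scaled_sum_sqr k : \int[P]_w (scaled_sum k w ^+ 2) <= k%:R / (N k)%:R * (1 + 2 * tau 0).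
Proof.
have [bf _] := mf.
have bS : bounded_measurable (fun w => \sum_(0 <= i < N k) f (X i.+1 w)).
  by apply: bmf_sum => i; apply: (bmf_comp bf); exact: measurable_funPT.
have -> : \int[P]_w (scaled_sum k w ^+ 2) =
    (k%:R / (N k)%:R ^+ 2) * \int[P]_w ((\sum_(0 <= i < N k) f (X i.+1 w)) ^+ 2).
  rewrite -ExZ; last exact: bmfX.
  by apply: eq_Ex => w; rewrite /scaled_sum !exprMn sqr_sqrtr// exprVn.
have h := process_psum_sqr X_stationary tail mf f1 f_mean0 (N k).
apply: (le_trans (ler_wpM2l _ h)); first by rewrite divr_ge0// exprn_ge0.
rewrite mulrA le_eqVlt; apply/orP; left; apply/eqP; congr (_ * _).
have [->|Nk] := eqVneq ((N k)%:R : R) 0; first by rewrite mulr0 invr0 mulr0.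
by field.
Qed.

End scaled_sums.

(** Gives the limit the shape of cos (u + v) = cos u cos v - sin u sin v. The second product is
    zero: the sine transform of a centred normal law vanishes. *)
Lemma gaussian_cos_split (R : realType) (t c V1 V2 e : R) :
  expR (- (t ^+ 2 * (V1 + c * V2) / 2)) * cos e =
  (expR (- (t ^+ 2 * 1 * V1 / 2)) * cos 0) * (expR (- (t ^+ 2 * c * V2 / 2)) * cos e) -
  (expR (- (t ^+ 2 * 1 * V1 / 2)) * cos (- (pi / 2))) *
  (expR (- (t ^+ 2 * c * V2 / 2)) * cos (e - pi / 2)).
Proof.
rewrite cosN cos_pihalf mulr0 mul0r subr0 cos0 mulr1 mulrA -expRD.
by congr (expR _ * _); field.
Qed.

Section sums_of_bounded.
Context d (T : measurableType d) (R : realType) (P : probability T R).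
Implicit Types U V W : T -> R.

Lemma Ex_sqrD3_le U V W :
  bounded_measurable U -> bounded_measurable V -> bounded_measurable W ->
  \int[P]_w ((U w + V w + W w) ^+ 2) <=
    3 * (\int[P]_w (U w ^+ 2) + \int[P]_w (V w ^+ 2) + \int[P]_w (W w ^+ 2)).
Proof.
move=> bU bV bW; apply: (@le_trans _ _ (\int[P]_w (3 * (U w ^+ 2 + V w ^+ 2 + W w ^+ 2)))).
  apply: le_Ex; [by bmf|by bmf|move=> w].
  by have := sqr_ge0 (U w - V w); have := sqr_ge0 (U w - W w);
    have := sqr_ge0 (V w - W w); nra.
by rewrite ExZ ?ExD//; bmf.
Qed.

(** The pointwise inequality |W| <= del + W^2 / del takes the place of the Cauchy-Schwarz
    inequality. *)
Lemma Ex_cos_perturb U W (t e del : R) :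
  bounded_measurable U -> bounded_measurable W -> 0 < del ->
  \int[P]_w (W w ^+ 2) <= del ^+ 2 ->
  `|\int[P]_w cos (t * (U w + W w) + e) - \int[P]_w cos (t * U w + e)| <=
    `|t| * (del + del).
Proof.
move=> bU bW del0 hW.
have bc A : bounded_measurable A -> bounded_measurable (fun w : T => cos (t * A w + e)).
  move=> [mA _]; apply: bmf_cos.
  by apply: measurable_funD => //; exact: measurable_funM.
have bUW : bounded_measurable (fun w => U w + W w) by exact: bmfD.
rewrite -ExB; [|exact: (bc _ bUW)|exact: bc].
apply: (@le_trans _ _ (\int[P]_w (`|t| * (del + del^-1 * W w ^+ 2)))).
  apply: norm_Ex_le; [|by bmf|].
    by apply: bmfB; [exact: (bc _ bUW)|exact: bc].
  move=> w; rewrite (le_trans (cos_lip _ _))//.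
  rewrite (_ : _ - _ = t * W w); last by ring.
  rewrite normrM ler_wpM2l// -(real_normK (num_real (W w))).
  move: (normr_ge0 (W w)); move: `|W w| => x x0.
  have [xd|dx] := leP x del.
    rewrite (le_trans xd)// lerDl; apply: mulr_ge0; last exact: sqr_ge0.
    by rewrite invr_ge0 ltW.
  rewrite -[leLHS]add0r; apply: lerD; first exact: ltW.
  by rewrite mulrC ler_pdivlMr// expr2 ler_wpM2l// ltW.
rewrite ExZ; last by bmf.
rewrite ExD; [|by bmf|by bmf].
rewrite Ex_cst ExZ; last by bmf.
by rewrite ler_wpM2l// lerD2l mulrC ler_pdivrMr// -expr2.
Qed.

End sums_of_bounded.

(** * Assembly of the limit theorem *)

Section mann_whitney_clt.
Context (R : realType) (d : measure_display) (T : measurableType d)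
  (P : probability T R) (X Y : int -> {RV P >-> R}) (m : nat -> nat) (c : R).
Hypotheses (X_stationary : strictly_stationary X) (Y_stationary : strictly_stationary Y)
  (X_ergodic : two_ergodic X) (Y_ergodic : two_ergodic Y)
  (XY_independent : independent_processes X Y).
Hypothesis m_gt0 : forall n : nat, (0 < n)%N -> (0 < m n)%N.
Hypothesis m_lim : (fun n => n%:R / (m n)%:R : R) @ \oo --> c.
Variables (a tau b sigma : nat -> R).
Hypothesis a_alpha : forall k, (0 < k)%N -> alpha1 X k = (a k)%:E.
Hypothesis a_ge0 : forall k, 0 <= a k.
Hypothesis a_tail : forall L n, \sum_(L.+1 <= l < n) a l <= tau L.
Hypothesis tau0 : tau @ \oo --> 0.
Hypothesis b_alpha : forall k, (0 < k)%N -> alpha1 Y k = (b k)%:E.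
Hypothesis b_ge0 : forall k, 0 <= b k.
Hypothesis b_tail : forall L n, \sum_(L.+1 <= l < n) b l <= sigma L.
Hypothesis sigma0 : sigma @ \oo --> 0.

Local Notation H := (H_ Y).
Local Notation G := (G_ X).
Local Notation PI := (prob_lt X Y).

Let f x := H x - PI.
Let g y := G y - PI.

Let mH : mixes X a H. Proof. exact: mixes_H. Qed.
Let mG : mixes Y b G. Proof. exact: mixes_G. Qed.
Let bH : bounded_measurable H. Proof. by have [] := mH. Qed.
Let bG : bounded_measurable G. Proof. by have [] := mG. Qed.
Let EH : \int[P]_w H (X 0 w) = PI. Proof. exact: (Ex_H X_stationary XY_independent a_alpha). Qed.
Let EG : \int[P]_w G (Y 0 w) = PI. Proof. exact: (Ex_G Y_stationary XY_independent b_alpha). Qed.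

Let mf : mixes X a f. Proof. exact: mixes_center. Qed.
Let mg : mixes Y b g. Proof. exact: mixes_center. Qed.
Let f_mean0 : \int[P]_w f (X 0 w) = 0. Proof. exact: (Ex_center bH EH). Qed.
Let g_mean0 : \int[P]_w g (Y 0 w) = 0. Proof. exact: (Ex_center bG EG). Qed.

Let f1 x : `|f x| <= 1.
Proof. by rewrite ler_norml /f; have := H_01 Y x; have := PI_01 X Y; lra. Qed.

Let g1 x : `|g x| <= 1.
Proof. by rewrite ler_norml /g; have := G_01 X x; have := PI_01 X Y; lra. Qed.

(** Only eventually constant, since 0 / 0 is 0. *)
Let id_lim : (fun n => n%:R / n%:R : R) @ \oo --> (1 : R).
Proof.
apply: cvg_near_cst; exists 1%N => // n /= n0.
by rewrite divff// pnatr_eq0 -lt0n.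
Qed.

Let U : nat -> T -> R := scaled_sum X f id.
Let V : nat -> T -> R := scaled_sum Y g m.
Let W n w : R := Num.sqrt n%:R * (n%:R * (m n)%:R)^-1 *
  \sum_(0 <= i < n) \sum_(0 <= j < m n) hoeffding_rest X Y (X i.+1 w) (Y j.+1 w).
Let Z n w : R := Num.sqrt n%:R * (mann_whitney X Y n (m n) w - PI).

Let ZE n w : Z n w = U n w + V n w + W n w.
Proof.
(* For [n = 0] the denominators vanish, but the factor sqrt 0 makes both sides zero. *)
have [->|n0] := posnP n.
  by rewrite /Z /U /V /W /scaled_sum sqrtr0 !mul0r !addr0.
have m0 := m_gt0 n0.
have nR : n%:R != 0 :> R by rewrite pnatr_eq0 -lt0n.
have mR : (m n)%:R != 0 :> R by rewrite pnatr_eq0 -lt0n.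
rewrite /Z /U /V /W /scaled_sum /mann_whitney.
set Sr := \sum_(0 <= i < n) \sum_(0 <= j < m n) _.
set Sf := \sum_(0 <= i < id n) _; set Sg := \sum_(0 <= i < m n) _.
have -> : \sum_(1 <= i < n.+1) \sum_(1 <= j < (m n).+1) \1_[set w' | X i w' < Y j w'] w =
    Sr + (m n)%:R * Sf + n%:R * Sg + n%:R * (m n)%:R * PI.
  rewrite big_add1/=.
  transitivity (\sum_(0 <= i < n) (\sum_(0 <= j < m n)
      hoeffding_rest X Y (X i.+1 w) (Y j.+1 w) + (m n)%:R * f (X i.+1 w) + Sg + (m n)%:R * PI)).
    apply: eq_bigr => i _; rewrite big_add1/=.
    rewrite (eq_bigr (fun j => hoeffding_rest X Y (X i.+1 w) (Y j.+1 w) + f (X i.+1 w)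
       + g (Y j.+1 w) + PI)).
      by do 3 rewrite big_split/=; rewrite -/Sg !sumr_const_nat !subn0 !(mulr_natl _ (m n)).
    move=> j _; rewrite indicE /hoeffding_rest /f /g.
    rewrite (_ : (w \in _) = (X i.+1 w < Y j.+1 w)); first by ring.
    by apply/idP/idP; rewrite inE.
  do 3 rewrite big_split/=.
  rewrite -/Sr -mulr_sumr !sumr_const_nat !subn0.
  rewrite -[Sg *+ n]mulr_natl -[(_ * PI) *+ n]mulr_natl mulrA.
  by [].
by field; rewrite nR mR.
Qed.

Let bU n : bounded_measurable (U n). Proof. exact: (bmf_scaled_sum mf). Qed.
Let bV n : bounded_measurable (V n). Proof. exact: (bmf_scaled_sum mg). Qed.

Let bW n : bounded_measurable (W n).
Proof.
apply: bmfM; first exact: bmf_cst.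
apply: bmf_sum => i; apply: bmf_sum => j.
have bHX : bounded_measurable (fun w => H (X i.+1 w)).
  by apply: (bmf_comp bH); exact: measurable_funPT.
have bGY : bounded_measurable (fun w => G (Y j.+1 w)).
  by apply: (bmf_comp bG); exact: measurable_funPT.
apply: bmfD; last exact: bmf_cst.
by apply: bmfB => //; apply: bmfB => //; apply: bmf_ltr; exact: measurable_funPT.
Qed.

Let bZ n : bounded_measurable (Z n).
Proof.
rewrite (_ : Z n = fun w => U n w + V n w + W n w); last exact/funext/ZE.
by apply: bmfD => //; exact: bmfD.
Qed.

Let tau_ge0 L : 0 <= tau L. Proof. by have := a_tail L 0; rewrite big_geq. Qed.
Let sigma_ge0 L : 0 <= sigma L. Proof. by have := b_tail L 0; rewrite big_geq. Qed.

(** In [rest_sqr_le], normalization cancels [n]: the near part becomes of order 1 / m and the far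
    part of order [tau L]. *)
Let W_sqr n L : \int[P]_w (W n w ^+ 2) <=
  16 * (m n)%:R^-1 * (L.+1%:R * (1 + sigma 0)) + 8 * tau L.
Proof.
have C0 : 0 <= 16 * (m n)%:R^-1 * (L.+1%:R * (1 + sigma 0)) + 8 * tau L.
  by rewrite addr_ge0// !mulr_ge0// addr_ge0.
have [n0|n0] := posnP n.
  have -> : \int[P]_w (W n w ^+ 2) = 0; last by [].
  rewrite -[RHS](Ex_cst P); apply: eq_Ex => w.
  by rewrite /W n0 sqrtr0 !mul0r expr0n.
have m0 := m_gt0 n0.
have nR : n%:R != 0 :> R by rewrite pnatr_eq0 -lt0n.
have mR : (m n)%:R != 0 :> R by rewrite pnatr_eq0 -lt0n.
pose S w := \sum_(0 <= i < n) \sum_(0 <= j < m n) hoeffding_rest X Y (X i.+1 w) (Y j.+1 w).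
have bS : bounded_measurable S.
  have := bmfM (@bmf_cst _ T R (n%:R * (m n)%:R / Num.sqrt n%:R)) (bW n).
  congr bounded_measurable; apply/funext => w; rewrite /W -/(S w).
  have sn : Num.sqrt n%:R != 0 :> R by rewrite gt_eqF// sqrtr_gt0 ltr0n.
  by field; rewrite nR mR sn.
have -> : \int[P]_w (W n w ^+ 2) = n%:R / (n%:R * (m n)%:R) ^+ 2 * \int[P]_w (S w ^+ 2).
  rewrite -ExZ; last exact: bmfX.
  by apply: eq_Ex => w; rewrite /W -/(S w) [LHS]exprMn [in LHS]exprMn sqr_sqrtr// exprVn.
have := rest_sqr_le X_stationary Y_stationary XY_independent a_alpha a_ge0 a_tail
  b_alpha b_ge0 b_tail n (m n) L.
rewrite -/(S _) => h; apply: (le_trans (ler_wpM2l _ h)).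
  by rewrite divr_ge0// exprn_ge0// mulr_ge0.
by rewrite le_eqVlt; apply/orP; left; apply/eqP; field; rewrite nR mR.
Qed.

(** First [L] makes the tail small, then [n] grows; [m n] tends to infinity because its ratio to [n]
    converges. *)
Let W_cvg0 : (fun n => \int[P]_w (W n w ^+ 2)) @ \oo --> (0 : R).
Proof.
apply/cvgrPdist_le => e e0.
have e20 : 0 < e / 2 by rewrite divr_gt0.
have [L HL] : exists L, 8 * tau L <= e / 2.
  have h : (fun L => 8 * tau L) @ \oo --> (0 : R).
    by rewrite -[X in _ --> X](mulr0 8); apply: cvgM; [exact: cvg_cst|exact: tau0].
  by have [L _ /(_ L (leqnn L))] := cvgr_le _ h _ e20; exists L.
pose D := 16 * (L.+1%:R * (1 + sigma 0)).
have hm : (fun n => D * (m n)%:R^-1) @ \oo --> (0 : R).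
  rewrite -[X in _ --> X](mulr0 D); apply: cvgM; first exact: cvg_cst.
  exact: (inv_size_cvg0 m_lim).
near=> n.
have hn : D * (m n)%:R^-1 <= e / 2 by near: n; exact: (cvgr_le _ hm _ e20).
rewrite sub0r normrN ger0_norm; last by apply: Rintegral_ge0 => w _; exact: sqr_ge0.
apply: (le_trans (W_sqr n L)); rewrite (splitr e); apply: lerD => //.
by rewrite (_ : 16 * _ * _ = D * (m n)%:R^-1)// /D; ring.
Unshelve. all: by end_near. Qed.

Let Z_sqr_bounded : exists C, forall n, \int[P]_w (Z n w ^+ 2) <= C.
Proof.
have [Cm HCm] := ratio_bounded m_lim; have [C1 HC1] := ratio_bounded id_lim.
exists (3 * (C1 * (1 + 2 * tau 0) + Cm * (1 + 2 * sigma 0)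
   + (16 * (1 + sigma 0) + 8 * tau 0))) => n.
under eq_Ex do rewrite ZE.
apply: (le_trans (Ex_sqrD3_le P (bU n) (bV n) (bW n))); rewrite ler_wpM2l//.
have t1 : 0 <= 1 + 2 * tau 0 by rewrite addr_ge0// mulr_ge0.
have s1 : 0 <= 1 + 2 * sigma 0 by rewrite addr_ge0// mulr_ge0.
apply: lerD; first apply: lerD.
- apply: (le_trans (scaled_sum_sqr X_stationary a_tail mf f1 f_mean0 id n)).
  by rewrite ler_wpM2r.
- apply: (le_trans (scaled_sum_sqr Y_stationary b_tail mg g1 g_mean0 m n)).
  by rewrite ler_wpM2r.
- apply: (le_trans (W_sqr n 0)); rewrite lerD2r mul1r ler_wpM2r ?addr_ge0//.
  rewrite ler_piMr//; case: (posnP (m n)) => [->|m0]; first by rewrite invr0.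
  by rewrite invf_le1 ?ltr0n// ler1n.
Qed.

Let V1 := asymptotic_variance X f.
Let V2 := asymptotic_variance Y g.

Let UV_cos t e : (fun n => \int[P]_w cos (t * (U n w + V n w) + e)) @ \oo -->
  expR (- (t ^+ 2 * (V1 + c * V2) / 2)) * cos e.
Proof.
have hU e' : (fun n => \int[P]_w cos (t * U n w + e')) @ \oo -->
    expR (- (t ^+ 2 * 1 * V1 / 2)) * cos e'.
  exact: (scaled_sum_cos X_stationary X_ergodic a_tail tau0 mf f1 f_mean0 id_lim).
have hV e' : (fun n => \int[P]_w cos (t * V n w + e')) @ \oo -->
    expR (- (t ^+ 2 * c * V2 / 2)) * cos e'.
  exact: (scaled_sum_cos Y_stationary Y_ergodic b_tail sigma0 mg g1 g_mean0 m_lim).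
(* The addition formula under independence, with sines written as cosines of phase shifted by pi / 2
   so that [hU] and [hV] apply to all four factors. *)
have E n : \int[P]_w cos (t * (U n w + V n w) + e) =
    \int[P]_w cos (t * U n w + 0) * \int[P]_w cos (t * V n w + e) -
    \int[P]_w cos (t * U n w + - (pi / 2)) * \int[P]_w cos (t * V n w + (e - pi / 2)).
  have mt (e' : R) : measurable_fun setT (fun x : R => t * x + e').
    by apply: measurable_funD => //; exact: measurable_funM.
  rewrite (Ex_independent_processes XY_independent (U := U n) (V := V n)
    (h := fun z => cos (t * (z.1 + z.2) + e))); last 3 first.
  - exact: (measurable_scaled_sum mf).
  - exact: (measurable_scaled_sum mg).
  - apply: bmf_cos; apply: (measurableT_comp (mt e)).
    by apply: measurable_funD; [exact: measurable_fst|exact: measurable_snd].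
  have bc A e' : bounded_measurable A -> bounded_measurable (fun w : T => cos (t * A w + e')).
    by move=> [mA _]; apply: bmf_cos; exact: (measurableT_comp (mt e') mA).
  rewrite -[X in X - _]ExZ; last exact: bc.
  rewrite -[X in _ - X]ExZ; last exact: bc.
  rewrite -ExB; [|by apply: bmfM; [exact: bmf_cst|exact: bc]..].
  apply: eq_Ex => w' /=.
  rewrite [X in X - _]mulrC [X in _ - X]mulrC -!ExZ; [|exact: bc..].
  rewrite -ExB; [|by apply: bmfM; [exact: bmf_cst|exact: bc]..].
  apply: eq_Ex => w.
  rewrite addr0 (addrA _ e) !cosBpihalf mulrDr -addrA cosD; ring.
under eq_fun do rewrite E.
rewrite gaussian_cos_split.
by apply: cvgB; apply: cvgM.
Qed.

Let Z_cos t e : (fun n => \int[P]_w cos (t * Z n w + e)) @ \oo -->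
  expR (- (t ^+ 2 * (V1 + c * V2) / 2)) * cos e.
Proof.
have bUV n : bounded_measurable (fun w => U n w + V n w) by exact: bmfD.
have D : (fun n => \int[P]_w cos (t * Z n w + e) -
    \int[P]_w cos (t * (U n w + V n w) + e)) @ \oo --> (0 : R).
  apply/cvgrPdist_le => eps eps0.
  pose del := eps / (2 * (`|t| + 1)).
  have D0 : 0 < 2 * (`|t| + 1) by rewrite mulr_gt0// ltr_wpDl.
  have del0 : 0 < del by rewrite divr_gt0.
  have del2 : 0 < del ^+ 2 by rewrite exprn_gt0.
  near=> n.
  have hn : \int[P]_w (W n w ^+ 2) <= del ^+ 2 by near: n; exact: (cvgr_le _ W_cvg0 _ del2).
  rewrite sub0r normrN; under [X in `|X - _|]eq_Ex do rewrite ZE.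
  apply: (le_trans (Ex_cos_perturb t e (bUV n) (bW n) del0 hn)).
  apply: (@le_trans _ _ ((`|t| + 1) * (del + del))).
    by rewrite ler_wpM2r ?lerDl// ltW// addr_gt0.
  rewrite le_eqVlt; apply/orP; left; apply/eqP; rewrite /del; field.
  by rewrite gt_eqF// ltr_wpDl.
have -> : (fun n => \int[P]_w cos (t * Z n w + e)) = (fun n => \int[P]_w cos (t * Z n w + e) -
    \int[P]_w cos (t * (U n w + V n w) + e) + \int[P]_w cos (t * (U n w + V n w) + e)).
  by apply/funext => n; rewrite subrK.
rewrite -[X in _ --> X]add0r; apply: cvgD; first exact: D.
exact: UV_cos.
Unshelve. all: by end_near. Qed.

Let varianceE : mann_whitney_variance X Y c = V1 + c * V2.
Proof.
by rewrite /mann_whitney_variance (long_run_varianceE X_stationary bH EH)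
  (long_run_varianceE Y_stationary bG EG).
Qed.

Lemma mann_whitney_variance_ge0 : 0 <= mann_whitney_variance X Y c.
Proof.
have h := @Z_cos 1 0.
have : expR (- (1 ^+ 2 * (V1 + c * V2) / 2)) * cos 0 <= 1 :> R.
  apply: (cvgr_to_le h); apply: nearW => n.
  apply: (le_trans (ler_norm _)); apply: norm_Ex_le_cst => [|w]; last exact: cos_max.
  have [mZ _] := bZ n; apply: bmf_cos.
  by apply: measurable_funD => //; exact: measurable_funM.
rewrite cos0 mulr1 -[leRHS]expR0 ler_expR varianceE; lra.
Qed.

Lemma mann_whitney_cvg_in_distribution :
  cvg_in_distribution P
    (fun n w => Num.sqrt n%:R * (mann_whitney X Y n (m n) w - PI))
    (centered_normal (mann_whitney_variance X Y c)).
Proof.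
split=> [n|F cF [M FM]]; first by have [] := bZ n.
have [C HC] := Z_sqr_bounded.
have h : \int[P]_w F (Z n w) @[n --> \oo] -->
    \int[centered_normal (mann_whitney_variance X Y c)]_x F x.
  apply: (levy bZ HC _ cF FM) => t e.
  (* The sign of the variance has to be known before the limit law is used, because
     [centered_normal] takes its square root. *)
  rewrite centered_normal_cos ?mann_whitney_variance_ge0//.
  by rewrite varianceE; exact: Z_cos.
have bF : @bounded_measurable _ (measurableTypeR R) R F.
  by split; [exact: continuous_measurable_fun|exists M].
have bFZ n : bounded_measurable (fun w => F (Z n w)).
  by apply: (bmf_comp bF); have [] := bZ n.
rewrite (Ex_EFin _ bF).
have -> : (fun n => 'E_P[F \o Z n])%E = (fun n => (\int[P]_w F (Z n w))%:E).
  by apply/funext => n; rewrite unlock -Ex_EFin.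
by apply: cvg_EFin => //; exact: nearW.
Qed.

(** [limn] is meaningful only along a convergent sequence; this certifies that the two series in the
    variance are genuine sums. *)
Lemma cov_sum_cvg : cvgn (cov_sum H X) /\ cvgn (cov_sum G Y).
Proof.
split; first rewrite (cov_sumE X_stationary bH EH).
  exact: (autocov_series_cvg X_stationary a_tail mf f1 f_mean0).
rewrite (cov_sumE Y_stationary bG EG).
exact: (autocov_series_cvg Y_stationary b_tail mg g1 g_mean0).
Qed.

End mann_whitney_clt.

Theorem theorem1p1 (R : realType) (d : measure_display) (T : measurableType d)
  (P : probability T R) (X Y : int -> {RV P >-> R}) (m : nat -> nat) (c : R)
  (X_stationary : strictly_stationary X) (Y_stationary : strictly_stationary Y)
  (X_ergodic : two_ergodic X) (Y_ergodic : two_ergodic Y)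
  (XY_independent : independent_processes X Y)
  (X_alpha : (\sum_(1 <= k <oo) alpha1 X k < +oo)%E)
  (Y_alpha : (\sum_(1 <= k <oo) alpha1 Y k < +oo)%E)
  (m_gt0 : forall n : nat, (0 < n)%N -> (0 < m n)%N)
  (c_ge0 : 0 <= c)
  (m_lim : (n%:R / (m n)%:R : R) @[n --> \oo] --> c) :
  [/\ cvgn (cov_sum (H_ Y) X),
      cvgn (cov_sum (G_ X) Y),
      0 <= mann_whitney_variance X Y c &
      cvg_in_distribution P
        (fun n w => Num.sqrt n%:R * (mann_whitney X Y n (m n) w - prob_lt X Y))
        (centered_normal (mann_whitney_variance X Y c))].
Proof.
have [a [tau [a_alpha a_ge0 a_tail tau0]]] := alpha1_summable X_alpha.
have [b [sigma [b_alpha b_ge0 b_tail sigma0]]] := alpha1_summable Y_alpha.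
have [? ?] := cov_sum_cvg X_stationary Y_stationary XY_independent
  a_alpha a_tail b_alpha b_tail.
split => //.
- exact: (mann_whitney_variance_ge0 X_stationary Y_stationary X_ergodic Y_ergodic
    XY_independent m_gt0 m_lim a_alpha a_ge0 a_tail tau0 b_alpha b_ge0 b_tail sigma0).
- exact: (mann_whitney_cvg_in_distribution X_stationary Y_stationary X_ergodic Y_ergodic
    XY_independent m_gt0 m_lim a_alpha a_ge0 a_tail tau0 b_alpha b_ge0 b_tail sigma0).
Qed.
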